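(* Let $(R,\mathfrak m)$ be a regular local ring with quotient field $F$ and $\dim R\ge 2$, let $\{(R_i,\mathfrak m_i)\}_{i\ge 0}$ be an infinite sequence of local quadratic transforms with $R_0=R$, let $S=\bigcup_{i\ge0}R_i$ with maximal ideal $N=\bigcup_i\mathfrak m_i$, let $x\in S$ be such that $xS$ is $N$-primary, let $T$ be the Noetherian hull of $S$ and assume $T$ is a localization of $R$. Let $S^*$ be the complete integral closure of $S$, let $V$ be the boundary valuation ring of $S$, and let $W$ be the rank one valuation overring of $V$. Assume $S$ is archimedean and not a DVR. Then $NV$ is the height $1$ prime ideal of $V$, hence $W=V_{NV}$. Furthermore: (1) $S^*=(N:_F N)=W\cap T$; and (2) $W$ is the unique rank $1$ valuation overring of $S$ such that $S^*=W\cap T$.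
   Context: A local quadratic transform of a regular local ring $(A,\mathfrak n)$ is a local ring $A[\mathfrak n/y]_{\mathfrak q}$ with $y\in\mathfrak n\setminus\mathfrak n^2$ and $\mathfrak q$ a prime ideal of $A[\mathfrak n/y]$ containing $\mathfrak n$. The sequence satisfies: for each $i\ge 0$, $R_{i+1}$ is a local quadratic transform of $R_i$, $R_i\subsetneq R_{i+1}$, and each $R_i$ is a regular local ring of dimension at least $2$ with maximal ideal $\mathfrak m_i$. $\mathrm{ord}_i$ is the order valuation of $R_i$ ($\mathrm{ord}_i(a)=\max\{n:a\in\mathfrak m_i^n\}$ for $0\ne a\in R_i$, extended to $F$ by $\mathrm{ord}_i(a/b)=\mathrm{ord}_i(a)-\mathrm{ord}_i(b)$), with valuation ring $V_i$. The boundary valuation ring of $S$ is the unique valuation ring $V$ with $R\subseteq V\subseteq F$ that is a limit point of $\{V_i\}$ in the patch topology (basic open sets $\{U: G\subseteq U, H\subseteq\mathfrak M_U\}$, $G,H\subseteq F$ finite); equivalently $V=\{q\in F:\mathrm{ord}_i(q)\ge 0\text{ for } i\gg0\}$. The rank one valuation overring $W$ of $V$ is the localization of $V$ at its height one prime ideal. The Noetherian hull $T$ of $S$ is the intersection of all DVRs with quotient field $F$ properly containing $S$ (empty intersection $=F$). A domain $A$ is archimedean if $\bigcap_{n>0}a^nA=0$ for every nonunit $a\in A$. The complete integral closure of $S$ is the ring of elements $\theta\in F$ that are almost integral over $S$, i.e. such that $S[\theta]$ is a fractional ideal of $S$. $(N:_FN)=\{q\in F: qN\subseteq N\}$. An ideal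 is $N$-primary if its radical is $N$. *)

(* Defs.v *)
(* All rings are subrings of a fixed field F, encoded as
   predicates F -> Prop. *)
From HB Require Import structures.
From mathcomp Require Import all_boot all_algebra.
Set Implicit Arguments. Unset Strict Implicit. Unset Printing Implicit Defensive.
Import GRing.Theory.
Local Open Scope ring_scope.

Section CommAlg.
Variable F : fieldType.
Implicit Types (A B S V : F -> Prop) (I P Q : F -> Prop).

Definition same_set (P Q : F -> Prop) := forall x, P x <-> Q x.
Definition subp (P Q : F -> Prop) := forall x, P x -> Q x.
Definition ssubp (P Q : F -> Prop) := subp P Q /\ exists x, Q x /\ ~ P x.
Definition interp (P Q : F -> Prop) : F -> Prop := fun x => P x /\ Q x.

Definition subring A :=
  [/\ A 0, A 1, (forall x y, A x -> A y -> A (x - y)) &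
      (forall x y, A x -> A y -> A (x * y))].

Definition gen_subring (G : F -> Prop) : F -> Prop :=
  fun x => forall B, subring B -> subp G B -> B x.

Definition ideal A I :=
  [/\ subp I A, I 0, (forall x y, I x -> I y -> I (x + y)) &
      (forall a x, A a -> I x -> I (a * x))].

Definition prime_ideal A P :=
  [/\ ideal A P, ~ P 1 &
      forall a b, A a -> A b -> P (a * b) -> P a \/ P b].

Definition gen_ideal A (G : F -> Prop) : F -> Prop :=
  fun x => forall I, ideal A I -> subp G I -> I x.

Definition fin_gen A I := exists s : seq F, (forall g, g \in s -> A g) /\
  same_set I (gen_ideal A (fun g => g \in s)).

Definition noetherian A := subring A /\ forall I, ideal A I -> fin_gen A I.

Definition frac_field A :=
  forall q, exists a b, [/\ A a, A b, b != 0 & q = a / b].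

Definition maxideal A : F -> Prop := fun x => A x /\ (x = 0 \/ ~ A x^-1).

Definition local A := subring A /\ ideal A (maxideal A) /\ ~ maxideal A 1.

Fixpoint pow_ideal A I (n : nat) : F -> Prop :=
  match n with
  | 0 => A
  | n.+1 => gen_ideal A (fun z => exists a b, [/\ pow_ideal A I n a, I b & z = a * b])
  end.

Definition prime_chain A (n : nat) :=
  exists C : nat -> F -> Prop,
    (forall k, (k <= n)%N -> prime_ideal A (C k)) /\
    (forall k, (k < n)%N -> ssubp (C k) (C k.+1)).
Definition krull_dim A (d : nat) := prime_chain A d /\ ~ prime_chain A d.+1.

Definition regular_local A :=
  [/\ local A, noetherian A &
      exists d, krull_dim A d /\ exists s : seq F, size s = d /\
         (forall g, g \in s -> A g) /\
         same_set (maxideal A) (gen_ideal A (fun g => g \in s))].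

Definition loc B Q : F -> Prop :=
  fun x => exists a b, [/\ B a, B b, ~ Q b & x = a / b].

Definition mult_set A (M : F -> Prop) :=
  [/\ subp M A, M 1, ~ M 0 & forall a b, M a -> M b -> M (a * b)].
Definition loc_mult A (M : F -> Prop) : F -> Prop :=
  fun x => exists a b, [/\ A a, M b & x = a / b].

Definition blowup A y : F -> Prop :=
  gen_subring (fun z => A z \/ exists w, maxideal A w /\ z = w / y).

Definition local_quadratic_transform A B :=
  exists y, [/\ maxideal A y, ~ pow_ideal A (maxideal A) 2 y &
    exists Q, [/\ prime_ideal (blowup A y) Q, subp (maxideal A) Q &
                  same_set B (loc (blowup A y) Q)]].

Definition valuation_ring V :=
  subring V /\ forall q, q != 0 -> V q \/ V q^-1.
Definition DVR V := [/\ valuation_ring V, noetherian V & exists q, ~ V q].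
Definition rank_one_valuation_ring V := valuation_ring V /\ krull_dim V 1.

Definition height_one_prime A P :=
  [/\ prime_ideal A P,
      (exists Q, prime_ideal A Q /\ ssubp Q P) &
      ~ (exists Q1 Q2, [/\ prime_ideal A Q1, prime_ideal A Q2,
                           ssubp Q1 Q2 & ssubp Q2 P])].

Definition ord_val A a (n : nat) :=
  [/\ A a, a != 0, pow_ideal A (maxideal A) n a &
      ~ pow_ideal A (maxideal A) n.+1 a].
Definition ord_ring A : F -> Prop := fun q =>
  q = 0 \/ exists a b n k, [/\ ord_val A a n, ord_val A b k, (k <= n)%N & q = a / b].

Definition union_seq (Rs : nat -> F -> Prop) : F -> Prop :=
  fun q => exists i, Rs i q.
Definition union_max (Rs : nat -> F -> Prop) : F -> Prop :=
  fun q => exists i, maxideal (Rs i) q.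

Definition boundary_valuation_ring (Rs : nat -> F -> Prop) : F -> Prop :=
  fun q => exists i0, forall i, (i0 <= i)%N -> ord_ring (Rs i) q.

Definition noetherian_hull S : F -> Prop :=
  fun q => forall V, DVR V -> ssubp S V -> V q.

Definition adjoin S (theta : F) : F -> Prop :=
  fun y => exists p : {poly F}, (forall i, S p`_i) /\ y = p.[theta].
Definition fractional_ideal S (M : F -> Prop) :=
  [/\ M 0, (forall x y, M x -> M y -> M (x + y)),
      (forall s x, S s -> M x -> M (s * x)) &
      exists d, [/\ S d, d != 0 & forall m, M m -> S (d * m)]].
Definition complete_integral_closure S : F -> Prop :=
  fun theta => fractional_ideal S (adjoin S theta).

Definition colon (N : F -> Prop) : F -> Prop :=
  fun q => forall n, N n -> N (q * n).

Definition radical S I : F -> Prop := fun s => S s /\ exists n, I (s ^+ n).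
Definition principal S x : F -> Prop := fun y => exists s, S s /\ y = x * s.

Definition archimedean S :=
  forall a, maxideal S a -> forall y, (forall n, (0 < n)%N -> principal S (a ^+ n) y) -> y = 0.

End CommAlg.

(* Main.v *)
(* The order function of a regular local ring is a valuation: by Krull's height theorem every
   part of a regular system of parameters generates a prime ideal, and the multiplicativity of
   the m-adic filtration follows by adding the parameters one at a time.  Orders do not increase
   under a quadratic transform (expand a form of degree r at the center of the transform), so for
   f, g the minimum of the orders of the successive transforms of (f, g) becomes stationary; hence
   the sign of ord_i(f/g) is eventually constant and V is a valuation ring.

   Each m_i generates a principal ideal y_i R_{i+1}.  As S is archimedean and not a DVR, the
   ideals y_i S increase strictly infinitely often, so N = N^2.  This makes NV a prime ideal, and
   shows that no DVR dominates S, so that 1/x lies in T.  The iterated transform of x becomes a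
   unit, which gives S[1/x] = T and V cap T = S; with the archimedean property NV has height one.
   Then S* is contained in W cap T because W has rank one, and (W cap T) N is contained in
   NV cap T, hence in N.  Finally, W is recovered from W cap T by comparing the elements
   a^j / x^k of T with a in S. *)
From Stdlib Require Import Classical ClassicalEpsilon FunctionalExtensionality PropExtensionality.
From mathcomp Require Import all_boot all_algebra.
From mathcomp Require Import ring mpoly.
Require Import Defs.
Set Implicit Arguments. Unset Strict Implicit. Unset Printing Implicit Defensive.
Import GRing.Theory.
Local Open Scope ring_scope.

(** The union S need not be Noetherian, so questions about it are pulled down to a single stage R_n.
    The device is the notion [excp] of an element of R_n whose successive transforms end in a unit.
    Every element of S is a/c with a in R_n and c of this kind, and once x lies in m_n each such c
    divides a power of x in S. Hence the localization of R_n at a prime that misses these elements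
    contains S[1/x], which is how primes of R_n produce the discrete valuation rings that define T.
    For such a localization to be a DVR, R_n has to be completely integrally closed. This is lifted
    from the residue field to R_n, one parameter at a time, along the chain of primes generated by
    the parameters. The inclusion of T in S[1/x] is where T being a localization of R enters: it
    reduces the question to the inverses 1/b that lie in T. *)

Section Basics.
Variable F : fieldType.
Implicit Types (A B S V : F -> Prop) (I J P Q : F -> Prop).

Lemma same_setE P Q : same_set P Q -> P = Q.
Proof.
by move=> h; apply: functional_extensionality => x; apply: propositional_extensionality.
Qed.

Lemma subp_anti P Q : subp P Q -> subp Q P -> P = Q.
Proof. by move=> h k; apply: same_setE => x; split; [apply: h|apply: k]. Qed.

Lemma nsubp P Q : ~ subp P Q -> exists2 x, P x & ~ Q x.
Proof.
move=> h; apply: NNPP => k; apply: h => x Px; apply: NNPP => nQ; apply: k.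
by exists x.
Qed.

Lemma ssubpW P Q : ssubp P Q -> subp P Q. Proof. by case. Qed.

Lemma sub0 A : subring A -> A 0. Proof. by case. Qed.
Lemma sub1 A : subring A -> A 1. Proof. by case. Qed.
Lemma subB A x y : subring A -> A x -> A y -> A (x - y).
Proof. by case=> _ _ h _; apply: h. Qed.
Lemma subM A x y : subring A -> A x -> A y -> A (x * y).
Proof. by case=> _ _ _ h; apply: h. Qed.
Lemma subN A x : subring A -> A x -> A (- x).
Proof. by move=> h Ax; rewrite -sub0r; apply: subB => //; apply: sub0. Qed.
Lemma subD A x y : subring A -> A x -> A y -> A (x + y).
Proof. by move=> h Ax Ay; rewrite -[y]opprK; apply: subB => //; apply: subN. Qed.
Lemma subX A x n : subring A -> A x -> A (x ^+ n).
Proof.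
move=> h Ax; elim: n => [|n IH]; first by rewrite expr0; apply: sub1.
by rewrite exprS; apply: subM.
Qed.

Lemma idlS A I x : ideal A I -> I x -> A x. Proof. by case=> h _ _ _; apply: h. Qed.
Lemma idl0 A I : ideal A I -> I 0. Proof. by case. Qed.
Lemma idlD A I x y : ideal A I -> I x -> I y -> I (x + y).
Proof. by case=> _ _ h _; apply: h. Qed.
Lemma idlM A I a x : ideal A I -> A a -> I x -> I (a * x).
Proof. by case=> _ _ _ h; apply: h. Qed.
Lemma idlMr A I a x : ideal A I -> I x -> A a -> I (x * a).
Proof. by move=> h Ix Aa; rewrite mulrC; apply: (idlM h). Qed.
Lemma idlN A I x : subring A -> ideal A I -> I x -> I (- x).
Proof. by move=> rA h Ix; rewrite -mulN1r; apply: (idlM h) => //; apply: subN => //; apply: sub1. Qed.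
Lemma idlB A I x y : subring A -> ideal A I -> I x -> I y -> I (x - y).
Proof. by move=> rA h Ix Iy; apply: (idlD h) => //; apply: (idlN rA h). Qed.
Lemma idlX A I x n : subring A -> ideal A I -> I x -> I (x ^+ n.+1).
Proof.
move=> rA h Ix; rewrite exprS; apply: (idlMr h) => //; apply: subX => //.
exact: (idlS h).
Qed.
Lemma idl1 A I : ideal A I -> I 1 -> subp A I.
Proof. by move=> h I1 x Ax; rewrite -[x]mulr1; apply: (idlM h). Qed.

End Basics.

Ltac mem :=
  match goal with
  | |- _ => assumption
  | H : subring ?A |- ?A 0 => apply: (sub0 H)
  | H : subring ?A |- ?A 1 => apply: (sub1 H)
  | H : subring ?A |- ?A (- _) => apply: (subN H); mem
  | H : subring ?A |- ?A (_ + _) => apply: (subD H); mem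
  | H : subring ?A |- ?A (_ * _) => apply: (subM H); mem
  | H : subring ?A |- ?A (_ ^+ _) => apply: (subX _ H); mem
  | H : ideal ?A ?I |- ?I 0 => apply: (idl0 H)
  | K : subring ?A, H : ideal ?A ?I |- ?I (- _) => apply: (idlN K H); mem
  | H : ideal ?A ?I |- ?I (_ + _) => apply: (idlD H); mem
  | H : ideal ?A ?I |- ?I (_ * _) => apply: (idlMr H); solve [mem]
  | H : ideal ?A ?I |- ?I (_ * _) => apply: (idlM H); solve [mem]
  | K : subring ?A, H : ideal ?A ?I |- ?I (_ ^+ _.+1) => apply: (idlX _ K H); mem
  | H : ideal ?A ?I |- ?A _ => apply: (idlS H); solve [mem]
  end.

(** * Ideals of Noetherian domains: chain conditions, Nakayama, associated primes *)

Section Noeth.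
Variable F : fieldType.
Implicit Types (A B S V : F -> Prop) (I J P Q : F -> Prop).

Definition addid I J : F -> Prop := fun z => exists i j, [/\ I i, J j & z = i + j].
Definition mulid (x : F) I : F -> Prop := fun z => exists2 i, I i & z = x * i.
Definition zeroid : F -> Prop := fun z => z = 0.

Lemma prime_idl A P : prime_ideal A P -> ideal A P. Proof. by case. Qed.
Lemma prime_n1 A P : prime_ideal A P -> ~ P 1. Proof. by case. Qed.
Lemma prime_or A P a b : prime_ideal A P -> A a -> A b -> P (a * b) -> P a \/ P b.
Proof. by case=> _ _ h; apply: h. Qed.
Lemma primeX A P a n : subring A -> prime_ideal A P -> A a -> P (a ^+ n) -> P a.
Proof.
move=> rA hP Aa; elim: n => [|n IH]; first by rewrite expr0 => /(prime_n1 hP).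
by rewrite exprS => /(prime_or hP Aa) [] //; first by mem.
Qed.

Lemma ideal_top A : subring A -> ideal A A.
Proof. by move=> h; split=> [//||x y ? ?|a x ? ?]; mem. Qed.

Lemma ideal_zero A : subring A -> ideal A zeroid.
Proof.
move=> h; split=> [x ->|//|x y -> ->|a x _ ->]; first by mem.
  by rewrite /zeroid addr0.
by rewrite /zeroid mulr0.
Qed.

Lemma prime_zero A : subring A -> prime_ideal A zeroid.
Proof.
move=> h; split; first exact: ideal_zero.
  by move/eqP; rewrite oner_eq0.
by move=> a b _ _ /eqP; rewrite mulf_eq0 => /orP[] /eqP; [left|right].
Qed.

Lemma ideal_add A I J : subring A -> ideal A I -> ideal A J -> ideal A (addid I J).
Proof.
move=> rA hI hJ; split.
- by move=> z [i [j [Ii Jj ->]]]; mem.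
- by exists 0, 0; rewrite addr0; split=> //; mem.
- move=> z w [i [j [Ii Jj ->]]] [i' [j' [Ii' Jj' ->]]].
  by exists (i + i'), (j + j'); split; [mem|mem|ring].
- move=> a z Aa [i [j [Ii Jj ->]]].
  by exists (a * i), (a * j); split; [mem|mem|ring].
Qed.

Lemma ideal_mul A x I : subring A -> A x -> ideal A I -> ideal A (mulid x I).
Proof.
move=> rA Ax hI; split.
- by move=> z [i Ii ->]; mem.
- by exists 0; [mem|rewrite mulr0].
- by move=> z w [i Ii ->] [j Jj ->]; exists (i + j); [mem|ring].
- by move=> a z Aa [i Ii ->]; exists (a * i); [mem|ring].
Qed.

Lemma addidl A I J : subring A -> ideal A I -> ideal A J -> subp I (addid I J).
Proof. by move=> rA hI hJ x Ix; exists x, 0; rewrite addr0; split=> //; mem. Qed.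
Lemma addidr A I J : subring A -> ideal A I -> ideal A J -> subp J (addid I J).
Proof. by move=> rA hI hJ x Ix; exists 0, x; rewrite add0r; split=> //; mem. Qed.

Lemma gen_ideal_sub A (G : F -> Prop) : subp G (gen_ideal A G).
Proof. by move=> x Gx I hI h; apply: h. Qed.

Lemma ideal_gen A (G : F -> Prop) : subring A -> subp G A -> ideal A (gen_ideal A G).
Proof.
move=> rA hG; split.
- by move=> x; apply => //; apply: ideal_top.
- by move=> I hI _; mem.
- by move=> x y h k I hI hGI; apply: (idlD hI); [apply: h|apply: k].
- by move=> a x Aa h I hI hGI; apply: (idlM hI) => //; apply: h.
Qed.

(** [gen_ideal] is an intersection of ideals; this is its explicit form for a list, on which one can
    recurse. *)
Fixpoint span A (s : seq F) : F -> Prop :=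
  if s is x :: s' then addid (mulid x A) (span A s') else zeroid.

Lemma ideal_span A s : subring A -> (forall g, g \in s -> A g) -> ideal A (span A s).
Proof.
move=> rA; elim: s => [_|x s IH h] /=; first exact: ideal_zero.
apply: ideal_add => //; last by apply: IH => g gs; apply: h; rewrite inE gs orbT.
by apply: ideal_mul => //; [apply: h; rewrite inE eqxx|apply: ideal_top].
Qed.

Lemma span_mem A s g : subring A -> (forall h, h \in s -> A h) -> g \in s -> span A s g.
Proof.
move=> rA; elim: s => [//|x s IH] h /=; rewrite inE => /orP[/eqP->|gs].
  exists x, 0; split; [by exists 1; [mem|rewrite mulr1]| |by rewrite addr0].
  by apply: idl0; apply: (@ideal_span A) => // k ks; apply: h; rewrite inE ks orbT.
exists 0, g; rewrite add0r; split=> //; last first.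
  by apply: IH => // k ks; apply: h; rewrite inE ks orbT.
by exists 0; [mem|rewrite mulr0].
Qed.

Lemma span_min A I s : ideal A I -> (forall g, g \in s -> I g) -> subp (span A s) I.
Proof.
move=> hI; elim: s => [|x s IH] h z /=; first by move=> ->; mem.
move=> [_ [j [[a Aa ->] hj ->]]].
apply: (idlD hI); first by apply: (idlMr hI) => //; apply: h; rewrite inE eqxx.
by apply: IH => // g gs; apply: h; rewrite inE gs orbT.
Qed.

Lemma gen_span A s : subring A -> (forall g, g \in s -> A g) ->
  gen_ideal A (fun g => g \in s) = span A s.
Proof.
move=> rA h; apply: subp_anti.
  move=> z; apply; first exact: ideal_span.
  by move=> g gs; apply: span_mem.
by move=> z hz I hI hs; apply: (span_min hI _ hz).
Qed.

Lemma noeth_fg A I : noetherian A -> ideal A I ->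
  exists s, (forall g, g \in s -> I g) /\ I = span A s.
Proof.
move=> [rA h] hI; have [s [hs /same_setE E]] := h I hI.
rewrite gen_span // in E.
by exists s; split=> // g gs; rewrite E; apply: span_mem.
Qed.

Lemma fg_noeth A : subring A ->
  (forall I, ideal A I -> exists s, (forall g, g \in s -> I g) /\ subp I (span A s)) ->
  noetherian A.
Proof.
move=> rA h; split=> // I hI; have [s [hs E]] := h I hI; exists s.
have hsA g : g \in s -> A g by move=> gs; apply: (idlS hI); apply: hs.
split=> // x; rewrite gen_span //; split; first exact: E.
exact: (span_min hI).
Qed.

Lemma noeth_acc A (I : nat -> F -> Prop) : noetherian A ->
  (forall n, ideal A (I n)) -> (forall n, subp (I n) (I n.+1)) ->
  exists n, forall k, subp (I k) (I n).
Proof.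
move=> hA hI inc.
have mono n k : subp (I n) (I (n + k)%N).
  by elim: k => [|k IH] x Ix; rewrite ?addn0 // addnS; apply: inc; apply: IH.
have mono' n k : (n <= k)%N -> subp (I n) (I k).
  by move=> /subnKC <-; apply: mono.
pose U : F -> Prop := fun x => exists n, I n x.
have hU : ideal A U.
  split.
  - by move=> x [n hx]; apply: (idlS (hI n)).
  - by exists 0%N; apply: (idl0 (hI _)).
  - move=> x y [n hx] [k hy]; exists (maxn n k).
    apply: (idlD (hI _)); [exact: (mono' n _ (leq_maxl _ _))|exact: (mono' k _ (leq_maxr _ _))].
  - by move=> a x Aa [n hx]; exists n; apply: (idlM (hI _)).
have [s [hs E]] := noeth_fg hA hU.
have [n hn] : exists n, forall g, g \in s -> I n g.
  elim: s hs {E} => [|x s IH] hs; first by exists 0%N.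
  have [|n hn] := IH; first by move=> g gs; apply: hs; rewrite inE gs orbT.
  have [k hk] := hs x (mem_head _ _).
  exists (maxn n k) => g; rewrite inE => /orP[/eqP->|gs].
    exact: (mono' k _ (leq_maxr _ _)).
  by apply: (mono' n _ (leq_maxl _ _)); apply: hn.
exists n => k x hx; have : U x by exists k.
by rewrite E; apply: span_min.
Qed.

Lemma noeth_max A (P : (F -> Prop) -> Prop) I0 : noetherian A ->
  ideal A I0 -> P I0 ->
  exists I, [/\ ideal A I, P I, subp I0 I &
    forall J, ideal A J -> P J -> subp I J -> J = I].
Proof.
move=> hA hI0 PI0; apply: NNPP => hno.
pose G I := [/\ ideal A I, P I & subp I0 I].
have step I : G I -> exists J, G J /\ ssubp I J.
  move=> [hI PI sI]; apply: NNPP => k; apply: hno; exists I; split=> // J hJ PJ sJ.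
  apply: NNPP => ne; apply: k; exists J; split; first by split=> // x /sI /sJ.
  split=> //; apply: NNPP => k; apply: ne; apply: subp_anti => // x Jx.
  by apply: NNPP => nI; apply: k; exists x.
pose f (I : {I | G I}) : {J | G J} :=
  let e := constructive_indefinite_description _ (step _ (proj2_sig I)) in
  exist _ (proj1_sig e) (proj1 (proj2_sig e)).
have hf (I : {I | G I}) : ssubp (proj1_sig I) (proj1_sig (f I)).
  by rewrite /f /=; case: constructive_indefinite_description => J [].
have G0 : G I0 by split.
pose c n := iter n f (exist _ I0 G0).
have [n hn] := @noeth_acc A (fun n => proj1_sig (c n)) hA
  (fun n => let: And3 h _ _ := proj2_sig (c n) in h)
  (fun n => ssubpW (hf (c n))).
have [_ [x [h1 h2]]] := hf (c n).
by apply: h2; apply: (hn n.+1).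
Qed.

Lemma noeth_ind A (P : (F -> Prop) -> Prop) : noetherian A ->
  (forall I, ideal A I -> (forall J, ideal A J -> ssubp I J -> P J) -> P I) ->
  forall I, ideal A I -> P I.
Proof.
move=> hA h I0 hI0; apply: NNPP => nP.
have [I [hI nI _ mx]] := @noeth_max A (fun I => ~ P I) I0 hA hI0 nP.
apply: nI; apply: h => // J hJ [sIJ [x [Jx nIx]]]; apply: NNPP => nJ.
by apply: nIx; rewrite -(mx J hJ nJ sIJ).
Qed.

Lemma local_sub A : local A -> subring A. Proof. by case. Qed.
Lemma local_max A : local A -> ideal A (maxideal A). Proof. by case=> _ []. Qed.

Lemma maxideal_n1 A : subring A -> ~ maxideal A 1.
Proof. by move=> rA [_ []]; [move/eqP; rewrite oner_eq0|rewrite invr1; apply; mem]. Qed.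

Lemma not_max A x : A x -> ~ maxideal A x -> x != 0 /\ A x^-1.
Proof.
move=> Ax h; split; first by apply/eqP => x0; apply: h; split=> //; left.
by apply: NNPP => k; apply: h; split=> //; right.
Qed.

Lemma max_inv A x : maxideal A x -> x != 0 -> ~ A x^-1.
Proof. by move=> [_ []] // -> /eqP. Qed.

Lemma idl_unit A I x : ideal A I -> I x -> x != 0 -> A x^-1 -> I 1.
Proof. by move=> hI Ix x0 Ax; rewrite -(mulVf x0); mem. Qed.

Lemma prime_max A P : local A -> prime_ideal A P -> subp P (maxideal A).
Proof.
move=> lA hP x Px; have hI := prime_idl hP; split; first exact: (idlS hI).
case: (eqVneq x 0) => [|x0]; first by left.
by right=> Ax; apply: (prime_n1 hP); apply: (idl_unit hI Px).
Qed.

Lemma max_prime A : local A -> prime_ideal A (maxideal A).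
Proof.
move=> lA; split; [exact: local_max|exact: maxideal_n1 (local_sub lA)|].
have rA := local_sub lA.
move=> a b Aa Ab hab; apply: NNPP => /not_or_and [/(not_max Aa) [a0 ha] /(not_max Ab) [b0 hb]].
apply: (max_inv hab); first by rewrite mulf_neq0.
by rewrite invfM; mem.
Qed.

Lemma unit_1sub A m : local A -> maxideal A m -> 1 - m != 0 /\ A (1 - m)^-1.
Proof.
move=> lA hm; have rA := local_sub lA; have hM := local_max lA.
apply: not_max; first by mem.
move=> h; apply: (maxideal_n1 rA); rewrite -(subrK m 1); mem.
Qed.

(** Reduction to one generator: if L is maximal among the ideals between Q and Q + H that differ
    from Q + H, then Q + H = L + gA for any g of Q + H outside L, and the hypothesis gives g (1 - x
    a) in L with 1 - x a a unit. *)
Lemma nakayama A H Q x : local A -> noetherian A -> ideal A H -> ideal A Q ->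
  maxideal A x -> (forall h, H h -> exists q h', [/\ Q q, H h' & h = q + x * h']) ->
  subp H Q.
Proof.
move=> lA nA hH hQ mx hyp; have rA := local_sub lA; apply: NNPP => nsub.
have Ax : A x by case: mx.
have hHQ := ideal_add rA hQ hH.
have [h Hh nQh] := nsubp nsub.
have pQ : ~ subp (addid Q H) Q by move=> k; apply: nQh; apply: k; apply: (addidr rA hQ hH).
have [L [hL [sL pL] sQL mxL]] := @noeth_max A
  (fun L => subp L (addid Q H) /\ ~ subp (addid Q H) L) Q nA hQ
  (conj (addidl rA hQ hH) pQ).
have [g Hg nLg] := nsubp pL.
pose gA := mulid g A; have Ag : A g by mem.
have hgA : ideal A gA by apply: ideal_mul => //; apply: ideal_top.
have hLg := ideal_add rA hL hgA.
have sLg : subp (addid Q H) (addid L gA).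
  apply: NNPP => k; apply: nLg; rewrite -(mxL _ hLg); last exact: (addidl rA hL hgA).
    by apply: (addidr rA hL hgA); exists 1; [mem|rewrite mulr1].
  split=> // z [l [_ [Ll [a Aa ->] ->]]]; have ? := sL l Ll; mem.
have [q [h1 [Qq Hh1 eg]]] := Hg.
have [q' [h2 [Qq' Hh2 eh1]]] := hyp _ Hh1.
have [l [_ [Ll [a Aa ->] e2]]] := sLg _ (addidr rA hQ hH Hh2).
have Lq := sQL _ Qq; have Lq' := sQL _ Qq'.
have e : g * (1 - x * a) = q + q' + x * l.
  by move: eg; rewrite eh1 e2 => e; rewrite mulrBr mulr1 {1}e; ring.
have hM := local_max lA.
have [n0 Au] := @unit_1sub A (x * a) lA ltac:(mem).
apply: nLg; rewrite -(mulfK n0 g) e; mem.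
Qed.

(** A maximal annihilator among the nonzero multiples of the class of g0 in F/K is prime. K is any
    A-submodule of F, so that it can be an ideal of A or, later, the ring S[1/x]. *)
Lemma assoc_prime A (K : F -> Prop) g0 : noetherian A ->
  K 0 -> (forall x y, K x -> K y -> K (x + y)) -> (forall a x, A a -> K x -> K (a * x)) ->
  ~ K g0 ->
  exists a, [/\ A a, ~ K (a * g0) & prime_ideal A (fun b => A b /\ K (b * (a * g0)))].
Proof.
move=> nA K0 KD KM nK0; have rA : subring A by case: nA.
pose ann g : F -> Prop := fun b => A b /\ K (b * g).
have hann g : ideal A (ann g).
  split.
  - by move=> x [].
  - by split; [mem|rewrite mul0r].
  - by move=> x y [Ax Kx] [Ay Ky]; split; [mem|rewrite mulrDl; apply: KD].
  - by move=> b x Ab [Ax Kx]; split; [mem|rewrite -mulrA; apply: KM].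
have [I [hI [a [Aa nKa EI]] _ mx]] := @noeth_max A
  (fun I => exists a, [/\ A a, ~ K (a * g0) & I = ann (a * g0)])
  (ann (1 * g0)) nA (hann _) (ex_intro _ 1 (And3 (sub1 rA) (eq_rect _ (fun z => ~ K z) nK0 _ (esym (mul1r g0))) erefl)).
exists a; split=> //; rewrite -/(ann _); split=> //; first by move=> [_]; rewrite mul1r.
move=> b c Ab Ac [_ h]; apply: NNPP => /not_or_and [nb nc].
have nKba : ~ K ((b * a) * g0) by rewrite -mulrA => k; apply: nb.
apply: nc; rewrite -EI -(mx (ann ((b * a) * g0))) //.
- by split=> //; move: h; congr K; ring.
- by exists (b * a); split=> //; mem.
- rewrite EI => z [Az Kz]; split=> //.
  by have := KM b _ Ab Kz; congr K; ring.
Qed.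

Lemma prime_avoid A I y : noetherian A -> ideal A I -> A y -> (forall n, ~ I (y ^+ n)) ->
  exists P, [/\ prime_ideal A P, subp I P & ~ P y].
Proof.
move=> nA hI Ay hy; have rA : subring A by case: nA.
have [P [hP nP sP mx]] := @noeth_max A (fun J => forall n, ~ J (y ^+ n)) I nA hI hy.
exists P; split=> //; last by move=> Py; apply: (nP 1%N).
split=> //; first by move=> P1; apply: (nP 0%N); rewrite expr0.
have aux a : A a -> ~ P a -> exists n p b, [/\ P p, A b & y ^+ n = p + a * b].
  move=> Aa nPa; have hJ : ideal A (mulid a A) by apply: ideal_mul => //; apply: ideal_top.
  have hPJ := ideal_add rA hP hJ.
  apply: NNPP => k; apply: nPa; rewrite -(mx _ hPJ); last exact: (addidl rA hP hJ).
    by apply: (addidr rA hP hJ); exists 1; [mem|rewrite mulr1].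
  move=> n [p [_ [Pp [b Ab ->] e]]]; apply: k; by exists n, p, b.
move=> a b Aa Ab Pab; apply: NNPP => /not_or_and [/(aux a Aa) [n [p [c [Pp Ac e]]]]].
move=> /(aux b Ab) [k [q [d [Pq Ad e']]]].
apply: (nP (n + k)%N); rewrite exprD e e'.
have -> : (p + a * c) * (q + b * d) = p * (q + b * d) + a * c * q + a * b * (c * d) by ring.
mem.
Qed.

End Noeth.
Arguments zeroid {F} _.

(** * Krull's principal ideal theorem and primes generated by parameters *)

Section Height.
Variable F : fieldType.
Implicit Types (A B S V : F -> Prop) (I J P Q : F -> Prop).

(** A/L has finite length. Noetherian induction on L: enlarge L by an element a whose class is
    killed by the maximal ideal, and compare the chain with its image modulo a. *)
Lemma dcc_primary A L : local A -> noetherian A -> ideal A L ->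
  (forall y, maxideal A y -> exists n, L (y ^+ n)) ->
  forall D : nat -> F -> Prop, (forall n, ideal A (D n)) -> (forall n, subp L (D n)) ->
    (forall n, subp (D n.+1) (D n)) ->
  exists n, forall j, (n <= j)%N -> subp (D n) (D j).
Proof.
move=> lA nA hL; have rA := local_sub lA.
pattern L; apply: (noeth_ind nA) hL => {}L hL IH radL D hD sLD dec.
have dec' n k : (n <= k)%N -> subp (D k) (D n).
  by move=> /subnKC <-; elim: (k - n)%N => [|j IHj] x; rewrite ?addn0 // addnS => /dec /IHj.
case: (classic (L 1)) => [L1|nL1].
  by exists 0%N => j _ x /(idlS (hD _)) /(idl1 hL L1) /sLD.
have [a [Aa nLa hp]] := assoc_prime nA (idl0 hL) (fun x y => @idlD _ A L x y hL)
  (fun a x => @idlM _ A L a x hL) nL1.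
rewrite mulr1 in nLa hp.
have soc y : maxideal A y -> L (y * a).
  move=> my; have Ay : A y by case: my.
  have [n Ln] := radL y my.
  suff [] : A y /\ L (y * a) by [].
  by apply: (primeX rA hp Ay (n := n)); split; mem.
have haA : ideal A (mulid a A) by apply: ideal_mul => //; apply: ideal_top.
have hL' := ideal_add rA hL haA.
have La : addid L (mulid a A) a by apply: (addidr rA hL haA); exists 1; [mem|rewrite mulr1].
have hDa n := ideal_add rA (hD n) haA.
have [] := IH _ hL' (conj (addidl rA hL haA) (ex_intro _ a (conj La nLa))) _
  (fun n => addid (D n) (mulid a A)) hDa.
- by move=> y /radL [n Ln]; exists n; apply: (addidl rA hL haA).
- by move=> n z [l [b [Ll hb ->]]]; exists l, b; split=> //; apply: sLD.
- by move=> n z [l [b [Ll hb ->]]]; exists l, b; split=> //; apply: dec.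
move=> n1 st.
(* The chain of the [D n] + aA is stable. Either a lies in every [D n], or it is missing from some
   [D n2]; then a b in [D n2] forces b into the maximal ideal, so a b is in L. *)
case: (classic (forall n, D n a)) => [Da|/not_all_ex_not [n2 nDa]].
  exists n1 => j le z Dz; have [d [_ [Dd [b Ab ->] ->]]] := st j le _ (addidl rA (hD _) haA Dz).
  by have hDj := hD j; have ? := Da j; mem.
exists (maxn n1 n2) => j; rewrite geq_max => /andP [le1 le2] z Dz.
have Dz1 := dec' _ _ (leq_maxl n1 n2) _ Dz; have Dz2 := dec' _ _ (leq_maxr n1 n2) _ Dz.
have [d [_ [Dd [b Ab ->] e]]] := st j le1 _ (addidl rA (hD _) haA Dz1).
have hDj := hD j; have hDn := hD n2.
have Dd2 := dec' _ _ le2 _ Dd.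
suff mb : maxideal A b by have := soc b mb; rewrite mulrC => /(sLD j) Dab; rewrite e; mem.
apply: NNPP => /(not_max Ab) [b0 Ab']; apply: nDa.
have Dab : D n2 (z - d) by mem.
rewrite -(mulfK b0 a); have -> : a * b = z - d by rewrite e; ring.
mem.
Qed.

(** The claim is that c becomes a unit in (A/Q)[1/y]. The ideals [I n], contractions of c^n
    (A/Q)[1/y], descend and are stable modulo Q + yA by [dcc_primary]. Since they are saturated with
    respect to y, Nakayama makes them stable, and c^n can be cancelled from the relation that puts
    c^n in [I n.+1]. *)
Lemma principal_ideal_theorem A Q y c : local A -> noetherian A -> prime_ideal A Q ->
  maxideal A y -> A c -> ~ Q c ->
  (forall z, maxideal A z -> exists n, addid Q (mulid y A) (z ^+ n)) ->
  exists l b, A b /\ Q (y ^+ l - c * b).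
Proof.
move=> lA nA pQ my Ac nQc rad; have rA := local_sub lA; have hQ := prime_idl pQ.
have Ay : A y by case: my.
case: (classic (Q y)) => [Qy|nQy].
  by exists 1%N, 0; split; [mem|rewrite mulr0 subr0 expr1].
pose I n : F -> Prop := fun a => A a /\ exists l b, A b /\ Q (y ^+ l * a - c ^+ n * b).
have hI n : ideal A (I n).
  split.
  - by move=> x [].
  - split; first by mem.
    by exists 0%N, 0; split; [mem|rewrite !mulr0 subrr; mem].
  - move=> u v [Au [l [b [Ab Qb]]]] [Av [l' [b' [Ab' Qb']]]]; split; first by mem.
    exists (l + l')%N, (y ^+ l' * b + y ^+ l * b'); split; first by mem.
    have -> : y ^+ (l + l') * (u + v) - c ^+ n * (y ^+ l' * b + y ^+ l * b') =
      y ^+ l' * (y ^+ l * u - c ^+ n * b) + y ^+ l * (y ^+ l' * v - c ^+ n * b').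
      by rewrite exprD; ring.
    apply: (idlD hQ); apply: (idlM hQ) => //; mem.
  - move=> a u Aa [Au [l [b [Ab Qb]]]]; split; first by mem.
    exists l, (a * b); split; first by mem.
    have -> : y ^+ l * (a * u) - c ^+ n * (a * b) = a * (y ^+ l * u - c ^+ n * b) by ring.
    by apply: (idlM hQ).
have QI n : subp Q (I n).
  move=> q Qq; split; first by mem.
  by exists 0%N, 0; split; [mem|rewrite mulr0 subr0 expr0 mul1r].
have decI n : subp (I n.+1) (I n).
  move=> a [Aa [l [b [Ab Qb]]]]; split=> //; exists l, (c * b); split; first by mem.
  by move: Qb; congr Q; rewrite exprSr; ring.
have hyA : ideal A (mulid y A) by apply: ideal_mul => //; apply: ideal_top.
have hL := ideal_add rA hQ hyA.
have hD n := ideal_add rA (hI n) hL.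
have [n st] := dcc_primary lA nA hL rad hD (fun n => addidr rA (hI n) hL)
  (fun n z => fun '(ex_intro i (ex_intro j (And3 h1 h2 e))) =>
     ex_intro _ i (ex_intro _ j (And3 (decI n i h1) h2 e))).
have sI : subp (I n) (I n.+1).
  apply: (nakayama lA nA (hI n) (hI n.+1) my) => h Ih.
  have [i [_ [Ii [q [_ [Qq [a Aa ->] ->]]] e]]] := st n.+1 (leqnSn n) _ (addidl rA (hI n) hL Ih).
  have hIn := hI n; have hIn1 := hI n.+1.
  have ? := QI n.+1 _ Qq; have ? := QI n _ Qq; have ? := decI _ _ Ii.
  exists (i + q), a; split; [by mem| |by rewrite e; ring].
  have [_ [l [b [Ab Qb]]]] : I n (h - (i + q)) by mem.
  split=> //; exists l.+1, b; split=> //.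
  by move: Qb; congr Q; rewrite e exprSr; ring.
have [] : I n.+1 (c ^+ n).
  apply: sI; split; first by mem.
  by exists 0%N, 1; split; [mem|rewrite expr0 mulr1 mul1r subrr; mem].
move=> _ [l [b [Ab Qb]]]; exists l, b; split=> //.
have : Q (c ^+ n * (y ^+ l - c * b)) by move: Qb; congr Q; rewrite exprSr; ring.
have ? : A (y ^+ l - c * b) by mem.
by move=> /(prime_or pQ) [||/(primeX rA pQ Ac)|] //; mem.
Qed.

Definition ext A P I : F -> Prop := fun z => exists a b, [/\ I a, A b, ~ P b & z = a / b].

Lemma prime_n0 A P b : prime_ideal A P -> ~ P b -> b != 0.
Proof. by move=> pP nb; apply/eqP => b0; apply: nb; rewrite b0; apply: idl0 (prime_idl pP). Qed.

Lemma prime_nM A P a b : prime_ideal A P -> A a -> A b -> ~ P a -> ~ P b -> ~ P (a * b).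
Proof. by move=> pP Aa Ab na nb /(prime_or pP Aa Ab) []. Qed.

Lemma loc_sub A P : subring A -> prime_ideal A P -> subp A (loc A P).
Proof. by move=> rA pP x Ax; exists x, 1; rewrite divr1; split=> //; [mem|apply: prime_n1 pP]. Qed.

Lemma ext_sub A P I : subring A -> prime_ideal A P -> subp I (ext A P I).
Proof. by move=> rA pP x Ax; exists x, 1; rewrite divr1; split=> //; [mem|apply: prime_n1 pP]. Qed.

Lemma loc_subring A P : subring A -> prime_ideal A P -> subring (loc A P).
Proof.
move=> rA pP; split.
- by apply: loc_sub => //; mem.
- by apply: loc_sub => //; mem.
- move=> x y [a [b [Aa Ab nb ->]]] [c [d [Ac Ad nd ->]]].
  have b0 := prime_n0 pP nb; have d0 := prime_n0 pP nd.
  exists (a * d - c * b), (b * d); split; [by mem|by mem|exact: (prime_nM pP)|].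
  by field; rewrite b0 d0.
- move=> x y [a [b [Aa Ab nb ->]]] [c [d [Ac Ad nd ->]]].
  have b0 := prime_n0 pP nb; have d0 := prime_n0 pP nd.
  exists (a * c), (b * d); split; [by mem|by mem|exact: (prime_nM pP)|].
  by field; rewrite b0 d0.
Qed.

Lemma loc_inv A P b : subring A -> prime_ideal A P -> A b -> ~ P b -> loc A P b^-1.
Proof. by move=> rA pP Ab nb; exists 1, b; rewrite mul1r; split=> //; mem. Qed.

Lemma ext_ideal A P I : subring A -> prime_ideal A P -> ideal A I ->
  ideal (loc A P) (ext A P I).
Proof.
move=> rA pP hI; split.
- by move=> x [a [b [Ia Ab nb ->]]]; exists a, b; split=> //; mem.
- by apply: ext_sub => //; mem.
- move=> x y [a [b [Aa Ab nb ->]]] [c [d [Ac Ad nd ->]]].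
  have b0 := prime_n0 pP nb; have d0 := prime_n0 pP nd.
  exists (a * d + c * b), (b * d); split; [by mem|by mem|exact: (prime_nM pP)|].
  by field; rewrite b0 d0.
- move=> x y [a [b [Aa Ab nb ->]]] [c [d [Ac Ad nd ->]]].
  have b0 := prime_n0 pP nb; have d0 := prime_n0 pP nd.
  exists (a * c), (b * d); split; [by mem|by mem|exact: (prime_nM pP)|].
  by field; rewrite b0 d0.
Qed.

Lemma ext_contract A P Q a : subring A -> prime_ideal A P -> prime_ideal A Q -> subp Q P ->
  A a -> ext A P Q a -> Q a.
Proof.
move=> rA pP pQ sQP Aa [c [d [Qc Ad nd e]]]; have d0 := prime_n0 pP nd.
have : Q (a * d) by rewrite e mulfVK.
by move=> /(prime_or pQ Aa Ad) [] // /sQP.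
Qed.

Lemma ext_prime A P Q : subring A -> prime_ideal A P -> prime_ideal A Q -> subp Q P ->
  prime_ideal (loc A P) (ext A P Q).
Proof.
move=> rA pP pQ sQP; have hQ := prime_idl pQ; have hE := ext_ideal rA pP hQ.
split=> //.
  by move=> /(ext_contract rA pP pQ sQP (sub1 rA)) /(prime_n1 pQ).
move=> _ _ [a [b [Aa Ab nb ->]]] [c [d [Ac Ad nd ->]]].
have b0 := prime_n0 pP nb; have d0 := prime_n0 pP nd => h.
have : ext A P Q (a * c).
  have -> : a * c = (b * d) * ((a / b) * (c / d)) by field; rewrite b0 d0.
  by apply: (idlM hE) => //; apply: loc_sub => //; mem.
move=> /(ext_contract rA pP pQ sQP) h'; have := h' ltac:(mem).
by move=> /(prime_or pQ Aa Ac) [h1|h1]; [left; exists a, b|right; exists c, d].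
Qed.

Lemma maxideal_loc A P : subring A -> prime_ideal A P -> maxideal (loc A P) = ext A P P.
Proof.
move=> rA pP; have hP := prime_idl pP; apply: subp_anti => z.
  move=> [[a [b [Aa Ab nb e]]] h]; exists a, b; split=> //; apply: NNPP => nPa.
  have a0 := prime_n0 pP nPa; have b0 := prime_n0 pP nb.
  case: h => [z0|]; last by apply; exists b, a; split=> //; rewrite e invf_div.
  by move: z0; rewrite e => /eqP; rewrite mulf_eq0 invr_eq0 (negbTE a0) (negbTE b0).
move=> hz; split; first by apply: (idlS (ext_ideal rA pP hP)).
case: (eqVneq z 0) => [|z0]; [by left|right=> h].
by apply: (prime_n1 (ext_prime rA pP pP (fun x h => h))); apply: (idl_unit (ext_ideal rA pP hP) hz).
Qed.

Lemma loc_local A P : subring A -> prime_ideal A P -> local (loc A P).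
Proof.
move=> rA pP; have rB := loc_subring rA pP; split=> //; split; last exact: maxideal_n1.
by rewrite maxideal_loc //; apply: ext_ideal => //; apply: prime_idl.
Qed.

Lemma span_mono A B s : subp A B -> subp (span A s) (span B s).
Proof.
move=> sAB; elim: s => [//|x s IH] z /= [_ [j [[a Aa ->] hj ->]]].
by exists (x * a), j; split=> //; [exists a => //; apply: sAB|apply: IH].
Qed.

Lemma loc_noeth A P : noetherian A -> prime_ideal A P -> noetherian (loc A P).
Proof.
move=> nA pP; have rA : subring A by case: nA.
have rB := loc_subring rA pP; apply: fg_noeth => // J hJ.
have hI : ideal A (interp A J).
  split=> [x []//||x y [Ax Jx] [Ay Jy]|a x Aa [Ax Jx]]; first by split; mem.
    by split; mem.
  by have Ba := loc_sub rA pP Aa; split; mem.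
have [s [hs E]] := noeth_fg nA hI.
have hsJ g : g \in s -> J g by move=> /hs [].
exists s; split=> // z Jz.
have [a [b [Aa Ab nb e]]] := idlS hJ Jz; have b0 := prime_n0 pP nb.
have Bb := loc_sub rA pP Ab; have Bb' := loc_inv rA pP Ab nb.
have : interp A J a by split=> //; have -> : a = z * b; [rewrite e mulfVK|mem].
rewrite E => /(span_mono (loc_sub rA pP)) ha; rewrite e.
have hS : ideal (loc A P) (span (loc A P) s).
  by apply: ideal_span => // g gs; apply: (idlS hJ); apply: hsJ.
mem.
Qed.

(** Suppose x is outside P1 and P2 is the only prime between P0 and P2 that contains x. Then, in the
    localization at P2, x generates modulo P0 an ideal with radical the maximal ideal, so any c in
    P1 outside P0 divides a power of x modulo P0, and x would be in P1. *)
Lemma chain_modification A P0 P1 P2 x : noetherian A -> prime_ideal A P0 -> prime_ideal A P1 ->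
  prime_ideal A P2 -> ssubp P0 P1 -> ssubp P1 P2 -> P2 x ->
  exists P, [/\ prime_ideal A P, ssubp P0 P, ssubp P P2 & P x].
Proof.
move=> nA p0 p1 p2 [s01 [c [P1c nc]]] s12 P2x.
have rA : subring A by case: nA.
case: (classic (P1 x)) => [P1x|nP1x]; first by exists P1; split=> //; split=> //; exists c.
have nP0x : ~ P0 x by move=> /s01.
apply: NNPP => hno.
have mx P : prime_ideal A P -> subp P0 P -> P x -> subp P P2 -> subp P2 P.
  move=> pP s0P Px sP2; apply: NNPP => /nsubp [z P2z nPz]; apply: hno; exists P; split=> //.
    by split=> //; exists x.
  by split=> //; exists z.
have s02 : subp P0 P2 by move=> z /s01 /(ssubpW s12).
have Ax := idlS (prime_idl p2) P2x; have Ac := idlS (prime_idl p1) P1c.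
have lB := loc_local rA p2; have rB := local_sub lB; have nB := loc_noeth nA p2.
have q0 := ext_prime rA p2 p0 s02; have q1 := ext_prime rA p2 p1 (ssubpW s12).
have h0 := prime_idl q0; have h1 := prime_idl q1.
have Bx := loc_sub rA p2 Ax; have Bc := loc_sub rA p2 Ac.
have hx : ideal (loc A P2) (mulid x (loc A P2)) by apply: ideal_mul => //; apply: ideal_top.
have hL := ideal_add rB h0 hx.
have [] := @principal_ideal_theorem (loc A P2) (ext A P2 P0) x c lB nB q0 _ Bc.
- by rewrite maxideal_loc //; apply: ext_sub.
- by move=> /(ext_contract rA p2 p0 s02 Ac).
- move=> z mz; apply: NNPP => /not_ex_all_not hz.
  have Bz : loc A P2 z by case: mz.
  have [P [pP sP nPz]] := prime_avoid nB hL Bz hz; have hP := prime_idl pP.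
  have pC : prime_ideal A (interp A P).
    split.
    - split=> [u []//||u v [? ?] [? ?]|a u Aa [? ?]]; try by split; mem.
      by have ? := loc_sub rA p2 Aa; split; mem.
    - by move=> [_ /(prime_n1 pP)].
    - move=> a b Aa Ab [_ Pab].
      by have [] := prime_or pP (loc_sub rA p2 Aa) (loc_sub rA p2 Ab) Pab; [left|right].
  move: mz; rewrite maxideal_loc // => -[a [b [P2a Ab nb e]]]; apply: nPz.
  have [_ Pa] : interp A P a.
    apply: (mx _ pC) P2a.
    - move=> u P0u; split; first exact: (idlS (prime_idl p0)).
      by apply: sP; apply: (addidl rB h0 hx); apply: ext_sub.
    - split=> //; apply: sP; apply: (addidr rB h0 hx); exists 1; [mem|by rewrite mulr1].
    - move=> u [Au Pu]; apply: (@ext_contract A P2 P2) => //.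
      by rewrite -maxideal_loc //; apply: (prime_max lB pP).
  have ? := loc_inv rA p2 Ab nb; rewrite e; mem.
move=> l [b [Bb h]]; apply: nP1x; apply: (primeX rA p1 Ax (n := l)).
apply: (@ext_contract A P2 P1) => //; [exact: (ssubpW s12)|mem|].
rewrite -(subrK (c * b) (x ^+ l)); apply: (idlD h1).
  by case: h => u [v [h2 h3 h4 h5]]; exists u, v; split=> //; apply: s01.
by apply: (idlMr h1) => //; apply: ext_sub.
Qed.

Inductive chain A : nat -> (F -> Prop) -> (F -> Prop) -> Prop :=
| chain0 P : prime_ideal A P -> chain A 0 P P
| chainS n P P' Q : prime_ideal A P -> ssubp P P' -> chain A n P' Q -> chain A n.+1 P Q.

Lemma chain_prime A n P Q : chain A n P Q -> prime_ideal A P.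
Proof. by case. Qed.

(** The tail is moved first; then the prime between P and the moved tail is exchanged for one that
    contains x. *)
Lemma chain_move A n P Q x : noetherian A -> chain A n.+1 P Q -> Q x ->
  exists P', [/\ P' x, ssubp P P' & chain A n P' Q].
Proof.
move=> nA; elim: n P => [|n IH] P hc Qx; inversion hc as [|n' P1 P1' Q' pP sP hc' e1 e2 e3]; subst.
  by exists P1'; split=> //; inversion hc'; subst.
have [P2 [P2x s12 hc2]] := IH _ hc' Qx.
have [P' [pP' sP' s' Px']] := chain_modification nA pP (chain_prime hc') (chain_prime hc2) sP s12 P2x.
by exists P'; split=> //; apply: chainS s' hc2.
Qed.

Lemma chain_of_prime_chain A n : local A -> prime_chain A n ->
  exists P, chain A n P (maxideal A).
Proof.
move=> lA [C [pC sC]].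
case: n pC sC => [|n] pC sC; first by exists (maxideal A); apply: chain0; apply: max_prime.
suff h k : (k <= n)%N -> chain A k.+1 (C (n - k)%N) (maxideal A).
  by exists (C 0%N); have := h n (leqnn n); rewrite subnn.
elim: k => [_|k IH lk].
  rewrite subn0; apply: (@chainS A _ _ (maxideal A)); [by apply: pC| |].
    have [s1 [z [h1 h2]]] := sC n (ltnSn n).
    have s2 := prime_max lA (pC n.+1 (leqnn _)).
    by split; [move=> u /s1 /s2|exists z; split=> //; apply: s2].
  by apply: chain0; apply: max_prime.
apply: (@chainS A _ _ (C (n - k)%N)); last by apply: IH; apply: ltnW.
  by apply: pC; apply: leq_trans (leq_subr _ _) _.
by rewrite -(subnSK lk); apply: sC; rewrite ltnS leq_subr.
Qed.

(** A regular sequence on A/I all of whose successive quotients are domains. *)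
Fixpoint pseq A I (s : seq F) : Prop := prime_ideal A I /\
  if s is x :: s' then ~ I x /\ pseq A (addid I (mulid x A)) s' else True.

(** The length of the chain leaves no room. Once its second prime P' contains the first parameter x,
    induction gives P' = I + xA; as x is not in P, this yields P inside I + xP, and Nakayama gives P
    = I. *)
Lemma params_prime A s : local A -> noetherian A -> forall I P, ideal A I -> subp I P ->
  (forall g, g \in s -> maxideal A g) -> chain A (size s) P (maxideal A) ->
  subp (maxideal A) (addid I (span A s)) -> P = I /\ pseq A I s.
Proof.
move=> lA nA; have rA := local_sub lA; elim: s => [|x s IH] I P hI sIP hs hc sm /=.
  have e : P = maxideal A by inversion hc.
  have : P = I.
    apply: subp_anti => // z; rewrite e => /sm [i [_ [Ii -> ->]]]; by rewrite addr0.
  by move=> eI; rewrite -eI e; split=> //; split=> //; apply: max_prime.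
have mx : maxideal A x by apply: hs; rewrite mem_head.
have Ax : A x by case: mx.
have [P' [P'x sPP' hc']] := chain_move nA hc mx.
have hxA : ideal A (mulid x A) by apply: ideal_mul => //; apply: ideal_top.
have hI' := ideal_add rA hI hxA; have pP := chain_prime hc; have hP := prime_idl pP.
have [|||E ps] := IH _ P' hI' _ _ hc'.
- move=> z [i [_ [Ii [a Aa ->] ->]]].
  by have hP' := prime_idl (chain_prime hc'); have := ssubpW sPP' (sIP _ Ii); move=> ?; mem.
- by move=> g gs; apply: hs; rewrite inE gs orbT.
- move=> z /sm [i [_ [Ii [u [v [hu hv ->]] ->]]]].
  by exists (i + u), v; split=> //; [exists i, u|rewrite addrA].
have nPx : ~ P x.
  move=> Px; have [_ [z [P'z nPz]]] := sPP'; apply: nPz.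
  by move: P'z; rewrite E => -[i [_ [/sIP Ii [a Aa ->] ->]]]; mem.
have eP : P = I.
  apply: subp_anti => //; apply: (nakayama lA nA hP hI mx) => h Ph.
  have := ssubpW sPP' Ph; rewrite E => -[i [_ [Ii [a Aa ->] e]]]; exists i, a; split=> //.
  have Pi := sIP _ Ii; have : P (x * a) by have -> : x * a = h - i; [rewrite e; ring|mem].
  by move=> /(prime_or pP Ax Aa) [].
by rewrite -eP; split=> //; split=> //; split=> //; rewrite eP.
Qed.

(* Every ideal obtained by adjoining elements of [s] to [I] is prime. *)
Definition good A I s := forall s', perm_eq s' s -> pseq A I s'.

(** A reordered system of parameters is again one, so [params_prime] applies to every
    permutation. *)
Lemma regular_good A : regular_local A -> exists s : seq F,
  [/\ forall g, g \in s -> maxideal A g, maxideal A = span A s & good A zeroid s].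
Proof.
move=> [lA nA [d [[hc _] [s [sz [hsA /same_setE E]]]]]]; have rA := local_sub lA.
rewrite gen_span // in E; exists s.
have hs g : g \in s -> maxideal A g by move=> gs; rewrite E; apply: span_mem.
split=> // s' ps; have [P hP] := chain_of_prime_chain lA hc.
have h0 := ideal_zero rA.
have hs' g : g \in s' -> maxideal A g by rewrite (perm_mem ps); apply: hs.
apply: (proj2 (@params_prime A s' lA nA zeroid P h0 _ hs' _ _)).
- by move=> z ->; apply: idl0 (prime_idl (chain_prime hP)).
- by rewrite (perm_size ps) sz.
- have hS : ideal A (span A s') by apply: ideal_span => // g /hs' [].
  rewrite E => z hz; apply: (addidr rA h0 hS); apply: (span_min hS) hz => g.
  by rewrite -(perm_mem ps) => gs; apply: span_mem => // k /hs' [].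
Qed.

End Height.

(** * The filtration by powers of the maximal ideal: multiplicativity and separatedness *)

Section Filtration.
Variable F : fieldType.
Implicit Types (A B S V : F -> Prop) (I J P Q : F -> Prop) (s : seq F).

Lemma idl_sum A I (T : Type) (r : seq T) (P : pred T) (f : T -> F) : ideal A I ->
  (forall i, P i -> I (f i)) -> I (\sum_(i <- r | P i) f i).
Proof. by move=> hI h; elim/big_rec: _ => [|i x Pi Ix]; [mem|have ? := h i Pi; mem]. Qed.

Lemma idlMn A I x n : ideal A I -> I x -> I (x *+ n).
Proof. by move=> hI Ix; elim: n => [|n IH]; rewrite ?mulr0n ?mulrS; mem. Qed.

Lemma pseq_prime A I s : pseq A I s -> prime_ideal A I.
Proof. by case: s => [|x s] []. Qed.

Lemma pseq_cat A I s t : pseq A I (s ++ t) -> pseq A I s.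
Proof.
elim: s I => [|x s IH] I /=; first by move/pseq_prime.
by move=> [pI [nx h]]; split=> //; split=> //; apply: IH.
Qed.

Lemma addidA I J Q : addid (addid I J) Q = addid I (addid J Q).
Proof.
apply: subp_anti => z.
  by move=> [_ [q [[i [j [Ii Jj ->]]] Qq ->]]]; exists i, (j + q); rewrite addrA; split=> //; exists j, q.
by move=> [i [_ [Ii [j [q [Jj Qq ->]]] ->]]]; exists (i + j), q; rewrite addrA; split=> //; exists i, j.
Qed.

Lemma addidC I J : addid I J = addid J I.
Proof. by apply: subp_anti => z [i [j [Ii Jj ->]]]; exists j, i; rewrite addrC. Qed.

Lemma pseq_last A I s x : pseq A I (s ++ [:: x]) -> ~ addid I (span A s) x.
Proof.
elim: s I => [|y s IH] I /=.
  by move=> [_ [nx _]] [i [_ [Ii -> e]]]; apply: nx; rewrite e addr0.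
by move=> [_ [_ /IH]]; rewrite addidA.
Qed.

Lemma good_prime A I s : good A I s -> prime_ideal A I.
Proof. by move=> h; apply: (@pseq_prime A I s); apply: h. Qed.

Lemma good_add A I x s : good A I (x :: s) -> good A (addid I (mulid x A)) s.
Proof. by move=> h s' ps; have /= [_ []] := h (x :: s') ltac:(by rewrite perm_cons). Qed.

Lemma good_tail A I x s : good A I (x :: s) -> good A I s.
Proof.
move=> h s' ps; apply: (@pseq_cat A I s' [:: x]); apply: h.
by rewrite -cat1s perm_catC perm_cat2l.
Qed.

Lemma good_notin A I x s : good A I (x :: s) -> ~ addid I (span A s) x.
Proof.
move=> h; apply: pseq_last; apply: h.
by rewrite -[x :: s]cat1s perm_catC.
Qed.

(** Adjoins x to the filtration G as a new element of degree one: when [G 0] is A, the v-th term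
    unfolds to the sum of the x^j G_(v-j). *)
Fixpoint filx A (G : nat -> F -> Prop) (x : F) (v : nat) : F -> Prop :=
  if v is v'.+1 then addid (G v) (mulid x (filx A G x v')) else A.

(* [fil A I s v] is the ideal [(s)^v + I]. *)
Fixpoint fil A I s : nat -> F -> Prop :=
  if s is x :: s' then filx A (fil A I s') x else fun v => if v is 0 then A else I.

Definition filtr A (G : nat -> F -> Prop) :=
  [/\ G 0%N = A, forall v, ideal A (G v), forall v, subp (G v.+1) (G v) &
      forall v w a b, G v a -> G w b -> G (v + w)%N (a * b)].

Lemma filtr_le A G v w : filtr A G -> (v <= w)%N -> subp (G w) (G v).
Proof.
move=> [_ _ dec _] /subnKC <-.
by elim: (w - v)%N => [|j IHj] x; rewrite ?addn0 // addnS => /dec /IHj.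
Qed.

Lemma filx_sub A G x v : subring A -> filtr A G -> A x ->
  ideal A (filx A G x v) /\ subp (G v) (filx A G x v).
Proof.
move=> rA [G0 hG dec mul] Ax; elim: v => [|v [IH1 IH2]] /=.
  by rewrite G0; split=> //; apply: ideal_top.
have hm := ideal_mul rA Ax IH1.
by split; [apply: ideal_add|apply: (addidl rA (hG _) hm)].
Qed.

Lemma filx_filtr A G x : subring A -> filtr A G -> A x -> filtr A (filx A G x).
Proof.
move=> rA fG Ax; have [G0 hG dec mul] := fG.
have hI v := proj1 (filx_sub v rA fG Ax); have sG v := proj2 (filx_sub v rA fG Ax).
have decx v : subp (filx A G x v.+1) (filx A G x v).
  elim: v => [|v IH] z; first by move=> [i [_ [Gi [b Ab ->] ->]]]; have hG1 := hG 1%N; mem.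
  by move=> [i [_ [Gi [b Gb ->] ->]]]; exists i, (x * b); split; [exact: dec|exists b => //; apply: IH|].
split=> // v w; move: {2}(v + w)%N (leqnn (v + w)) => n.
elim: n v w => [|n IH] [|v] [|w] //= le a b Ha Hb.
- by have h := hI 0%N; mem.
- by have h := hI 0%N; mem.
- by have h := hI w.+1; rewrite ?add0n; apply: (idlM h).
- by have h := hI v.+1; rewrite ?addn0; apply: (idlMr h).
have [a0 [_ [Ga0 [a1 Ga1 ->] ea]]] := Ha; have [b0 [_ [Gb0 [b1 Gb1 ->] eb]]] := Hb.
rewrite addnS; exists (a0 * b0), (x * (a1 * b + a0 * b1)); split; last by rewrite ea eb; ring.
  by have := mul _ _ _ _ Ga0 Gb0; rewrite addSn addnS.
eexists; last by [].
have h := hI (v + w).+1; apply: (idlD h).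
  by rewrite -addnS; apply: IH => //; rewrite -ltnS.
by rewrite -addSn; apply: IH => //; [rewrite addSn -addnS -ltnS|apply: sG].
Qed.

Lemma fil_filtr A I s : subring A -> ideal A I -> (forall g, g \in s -> A g) -> filtr A (fil A I s).
Proof.
move=> rA hI; elim: s => [_|x s IH hs] /=.
  split=> //.
  - by case=> [|v] //; apply: ideal_top.
  - by case=> [|v] z //= Iz; mem.
  - by case=> [|v] [|w] a b /= ha hb; mem.
apply: filx_filtr => //; last by apply: hs; rewrite mem_head.
by apply: IH => g gs; apply: hs; rewrite inE gs orbT.
Qed.

Lemma fil_subI A I s v : subring A -> ideal A I -> (forall g, g \in s -> A g) ->
  subp I (fil A I s v).
Proof.
move=> rA hI; elim: s => [_|x s IH hs] z Iz; first by case: v => //=; mem.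
have hs' g : g \in s -> A g by move=> gs; apply: hs; rewrite inE gs orbT.
have Ax : A x by apply: hs; rewrite mem_head.
exact: (proj2 (filx_sub v rA (fil_filtr rA hI hs') Ax)) _ (IH hs' _ Iz).
Qed.

Lemma fil1 A I s : fil A I s 1 = addid I (span A s).
Proof.
elim: s => [|x s IH] /=.
  apply: subp_anti => z; first by move=> Iz; exists z, 0; rewrite addr0.
  by move=> [i [_ [Ii -> ->]]]; rewrite addr0.
by rewrite IH addidA; congr (addid I _); rewrite addidC.
Qed.

Lemma fil_addI A I x s v : subring A -> A x -> (forall g, g \in s -> A g) ->
  fil A (addid I (mulid x A)) s v = addid (fil A I s v) (mulid x A).
Proof.
move=> rA Ax; have hA0 : subp A (addid A (mulid x A)).
  by move=> z Az; exists z, 0; rewrite addr0; split=> //; exists 0; [mem|rewrite mulr0].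
have hA1 : subp (addid A (mulid x A)) A by move=> z [i [_ [Ai [a Aa ->] ->]]]; mem.
elim: s v => [|y s IH] v hs /=.
  by case: v => [|v] //; apply: subp_anti.
have Ay : A y by apply: hs; rewrite mem_head.
have {}IH v' := IH v' (fun g gs => hs g ltac:(by rewrite inE gs orbT)).
elim: v => [|v IHv] /=; first exact: subp_anti.
rewrite IH IHv; apply: subp_anti => z.
  move=> [_ [_ [[f [_ [Ff [a Aa ->] ->]]] [_ [g [_ [Gg [b Ab ->] ->]]] ->] ->]]].
  exists (f + y * g), (x * (a + y * b)); split; last by ring.
    by exists f, (y * g); split=> //; exists g.
  by exists (a + y * b) => //; mem.
move=> [_ [_ [[f [_ [Ff [g Gg ->] ->]]] [a Aa ->] ->]]].
exists (f + x * a), (y * g); split; last by ring.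
  by exists f, (x * a); split=> //; exists a.
exists g => //; exists g, 0; rewrite addr0; split=> //; by exists 0; [mem|rewrite mulr0].
Qed.

(** In other words, the associated graded ring of G is a domain. *)
Definition mord (G : nat -> F -> Prop) := forall n k a b,
  G n a -> ~ G n.+1 a -> G k b -> ~ G k.+1 b -> ~ G (n + k).+1 (a * b).

Lemma filtr_ord A G z v : filtr A G -> A z -> ~ G v z ->
  exists u, [/\ (u < v)%N, G u z & ~ G u.+1 z].
Proof.
move=> [G0 _ _ _] Az; elim: v => [|v IH] h; first by rewrite G0 in h.
case: (classic (G v z)) => [Gv|/IH [u [lu h1 h2]]]; first by exists v.
by exists u; split=> //; apply: ltnW.
Qed.

Lemma filtr_regular A G x z v : filtr A G -> mord G -> A x -> ~ G 1%N x -> A z ->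
  G v (x * z) -> G v z.
Proof.
move=> fG mG Ax nx Az h; apply: NNPP => /(filtr_ord fG Az) [u [lu h1 h2]].
have G0x : G 0%N x by case: fG => ->.
by have := mG 0%N u x z G0x nx h1 h2; rewrite add0n; apply; apply: (filtr_le fG lu).
Qed.

(** From x z = p + x q with p in [G v.+1], the element x of G-order 0 cancels, so z - q is in
    [G v.+1]. *)
Lemma filx_regular A G x z v : subring A -> filtr A G -> mord G -> A x -> ~ G 1%N x -> A z ->
  filx A G x v.+1 (x * z) -> filx A G x v z.
Proof.
move=> rA fG mG Ax nx Az [p [_ [Gp [q Gq ->] e]]].
have [hI sG] := filx_sub v rA fG Ax; have [_ _ dec _] := fG.
rewrite -(subrK q z); apply: (idlD hI) => //; apply: sG; apply: dec.
have Aq := idlS hI Gq.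
apply: (filtr_regular fG mG Ax nx); first by mem.
by move: Gp; congr (G _ _); rewrite mulrBr e; ring.
Qed.

(** Leading forms behave like polynomials in x. The induction on n + k strips a factor x from a
    leading form that is divisible by it; when neither is, both survive modulo x, where the
    hypothesis on G + xA applies. *)
Lemma filx_mord A G x : subring A -> filtr A G -> mord G -> A x -> ~ G 1%N x ->
  mord (fun v => addid (G v) (mulid x A)) -> mord (filx A G x).
Proof.
move=> rA fG mG Ax nx m2; have [G0 hG dec mul] := fG.
have fX := filx_filtr rA fG Ax; have [_ hX decX mulX] := fX.
have sG v := proj2 (filx_sub v rA fG Ax).
have GA v z : filx A G x v z -> A z by move=> h; apply: (idlS (hX v)).
have toA v : subp (filx A G x v) (addid (G v) (mulid x A)).
  case: v => [|v] z /=; first by rewrite G0 => Az; exists z, 0; rewrite addr0; split=> //; exists 0; [mem|rewrite mulr0].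
  by move=> [i [_ [Gi [b /GA Ab ->] ->]]]; exists i, (x * b); split=> //; exists b.
(* either the leading form of [a] is divisible by [x], or it survives modulo [x] *)
have dich n a : filx A G x n a -> ~ filx A G x n.+1 a ->
    (exists n' a', [/\ n = n'.+1, filx A G x n' a', ~ filx A G x n'.+1 a' &
       filx A G x n.+1 (a - x * a')]) \/
    (exists a0 a1, [/\ G n a0, A a1, a = a0 + x * a1 & ~ addid (G n.+1) (mulid x A) a0]).
  case: n => [|n] Xa nXa.
    right; exists a, 0; split; [by rewrite G0|by mem|by ring|].
    by move=> [i [_ [Gi [b Ab ->] e]]]; apply: nXa; exists i, (x * b); split=> //; exists b.
  have [a0 [_ [Ga0 [a1 Xa1 ->] e]]] := Xa.
  case: (classic (addid (G n.+2) (mulid x A) a0)) => h; last first.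
    by right; exists a0, a1; split=> //; apply: GA Xa1.
  left; have [i [_ [Gi [c Ac ->] e0]]] := h; exists n, (a1 + c).
  have Gc : G n.+1 c.
    apply: (filtr_regular fG mG Ax nx Ac); have hG1 := hG n.+1.
    have -> : x * c = a0 - i by rewrite e0; ring.
    by have ? := dec _ _ Gi; mem.
  have X1 : filx A G x n.+2 (a - x * (a1 + c)).
    by have -> : a - x * (a1 + c) = i; [rewrite e e0; ring|apply: sG].
  split=> //; first by have h1 := hX n; have ? := sG _ _ (dec _ _ Gc); mem.
  move=> h1; apply: nXa; rewrite -(subrK (x * (a1 + c)) a).
  have h2 := hX n.+2; apply: (idlD h2) => //.
  by exists 0, (x * (a1 + c)); rewrite add0r; split=> //; [apply: idl0 (hG _)|exists (a1 + c)].
move=> n k; move: {2}(n + k)%N (leqnn (n + k)) => l.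
elim: l n k => [|l IH] n k le a b Xa nXa Xb nXb Xab.
all: have [[n' [a' [en Xa' nXa' Xr]]]|[a0 [a1 [Ga0 Aa1 ea na]]]] := dich n a Xa nXa.
- by rewrite en in le.
- have [[k' [b' [ek _ _ _]]]|[b0 [b1 [Gb0 Ab1 eb nb]]]] := dich k b Xb nXb.
    by rewrite ek addnS in le.
  have Ga : addid (G n) (mulid x A) a0 by exists a0, 0; rewrite addr0; split=> //; exists 0; [mem|rewrite mulr0].
  have Gb : addid (G k) (mulid x A) b0 by exists b0, 0; rewrite addr0; split=> //; exists 0; [mem|rewrite mulr0].
  apply: (m2 _ _ _ _ Ga na Gb nb); have [i [_ [Gi [c Ac ->] e]]] := toA _ _ Xab.
  have Aa0 := idlS (hG _) Ga0; have Ab0 := idlS (hG _) Gb0.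
  exists i, (x * (c - a0 * b1 - a1 * b0 - x * a1 * b1)); split=> //; last first.
    by have -> : i = a * b - x * c; [rewrite e; ring|rewrite ea eb; ring].
  eexists; last by []. mem.
- apply: (IH n' k _ a' b Xa' nXa' Xb nXb); first by rewrite -ltnS -addSn -en.
  have Ab := GA _ _ Xb; have Aa' := GA _ _ Xa'.
  apply: (filx_regular rA fG mG Ax nx); first by mem.
  have h := hX (n' + k).+2.
  have -> : x * (a' * b) = a * b - (a - x * a') * b by ring.
  rewrite en addSn in Xab.
  apply: (idlB rA h) => //.
  by have := mulX _ _ _ _ Xr Xb; rewrite en !addSn.
have [[k' [b' [ek Xb' nXb' Xr]]]|[b0 [b1 [Gb0 Ab1 eb nb]]]] := dich k b Xb nXb.
  apply: (IH n k' _ a b' Xa nXa Xb' nXb'); first by rewrite -ltnS -addnS -ek.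
  have Aa := GA _ _ Xa; have Ab' := GA _ _ Xb'.
  apply: (filx_regular rA fG mG Ax nx); first by mem.
  have h := hX (n + k').+2.
  have -> : x * (a * b') = a * b - a * (b - x * b') by ring.
  rewrite ek addnS in Xab.
  apply: (idlB rA h) => //.
  by have := mulX _ _ _ _ Xa Xr; rewrite ek !addnS.
have Ga : addid (G n) (mulid x A) a0 by exists a0, 0; rewrite addr0; split=> //; exists 0; [mem|rewrite mulr0].
have Gb : addid (G k) (mulid x A) b0 by exists b0, 0; rewrite addr0; split=> //; exists 0; [mem|rewrite mulr0].
apply: (m2 _ _ _ _ Ga na Gb nb); have [i [_ [Gi [c Ac ->] e]]] := toA _ _ Xab.
have Aa0 := idlS (hG _) Ga0; have Ab0 := idlS (hG _) Gb0.
exists i, (x * (c - a0 * b1 - a1 * b0 - x * a1 * b1)); split=> //; last first.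
  by have -> : i = a * b - x * c; [rewrite e; ring|rewrite ea eb; ring].
eexists; last by []. mem.
Qed.

(** Splitting off x needs the claim for the tail over I and over I + xA; [good] passes to both
    because it is stable under reordering. *)
Lemma fil_mord A s : subring A -> (forall g, g \in s -> A g) ->
  forall I, good A I s -> mord (fil A I s).
Proof.
move=> rA; elim: s => [_|x s IH hs] I gI.
  have pI := good_prime gI; have hI := prime_idl pI.
  case=> [|n] [|k] a b //=; rewrite ?addn0 ?add0n /=.
  by move=> Aa na Ab nb /(prime_or pI Aa Ab) [].
have hs' g : g \in s -> A g by move=> gs; apply: hs; rewrite inE gs orbT.
have Ax : A x by apply: hs; rewrite mem_head.
have hI := prime_idl (good_prime gI).
apply: (@filx_mord A (fil A I s) x) => //; first exact: fil_filtr.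
- by apply: IH => //; apply: good_tail gI.
- by rewrite fil1; apply: good_notin gI.
- have := IH hs' _ (good_add gI).
  by move=> h n k a b; rewrite -!fil_addI //; apply: h.
Qed.

(** By induction modulo x the intersection H lies in I + xA, and x cancels by [filx_regular]; so H
    is inside I + xH, and Nakayama applies. *)
Lemma fil_cap A s : local A -> noetherian A -> (forall g, g \in s -> maxideal A g) ->
  forall I, good A I s -> forall z, (forall v, fil A I s v z) -> I z.
Proof.
move=> lA nA; have rA := local_sub lA; elim: s => [_|x s IH hs] I gI z hz.
  exact: (hz 1%N).
have hs' g : g \in s -> maxideal A g by move=> gs; apply: hs; rewrite inE gs orbT.
have hsA g : g \in s -> A g by move=> /hs' [].
have mx : maxideal A x by apply: hs; rewrite mem_head.
have Ax : A x by case: mx.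
have hI := prime_idl (good_prime gI).
have fG := fil_filtr rA hI hsA; have fX := filx_filtr rA fG Ax.
have [_ hX decX _] := fX; have [_ hG _ _] := fG.
pose H : F -> Prop := fun z => forall v, fil A I (x :: s) v z.
have hH : ideal A H.
  split.
  - by move=> u hu; exact: (hu 0%N).
  - by move=> v; apply: idl0 (hX v).
  - by move=> u w hu hw v; apply: (idlD (hX v)); [apply: hu|apply: hw].
  - by move=> a u Aa hu v; apply: (idlM (hX v) Aa); apply: hu.
have IX v : subp I (filx A (fil A I s) x v).
  by move=> i Ii; apply: (proj2 (filx_sub v rA fG Ax)); apply: fil_subI.
apply: (nakayama lA nA hH hI mx) hz => h Hh.
have [] : addid I (mulid x A) h.
  apply: (IH hs' _ (good_add gI)) => v; rewrite fil_addI //.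
  have := Hh v; case: v => [|v] /=.
    have [-> _ _ _] := fG; move=> Ah.
    by exists h, 0; rewrite addr0; split=> //; exists 0; [mem|rewrite mulr0].
  move=> [i [_ [Gi [b Xb ->] ->]]]; exists i, (x * b); split=> //; exists b => //.
  exact: (idlS (hX v)).
move=> i [_ [Ii [a Aa ->] e]]; exists i, a; split=> // v.
apply: (filx_regular rA fG _ Ax _ Aa).
- by apply: fil_mord => //; apply: good_tail gI.
- by rewrite fil1; apply: good_notin gI.
have h1 := hX v.+1; have -> : x * a = h - i by rewrite e; ring.
by have ? := IX v.+1 _ Ii; have ? := Hh v.+1; apply: (idlB rA h1).
Qed.

Lemma pow_id A n : local A -> ideal A (pow_ideal A (maxideal A) n).
Proof.
move=> lA; have rA := local_sub lA; have hM := local_max lA.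
elim: n => [|n IH] /=; first exact: ideal_top.
by apply: ideal_gen => // z [a [b [ha hb ->]]]; mem.
Qed.

Lemma powS A n x b : local A -> pow_ideal A (maxideal A) n b -> maxideal A x ->
  pow_ideal A (maxideal A) n.+1 (b * x).
Proof. by move=> lA hb hx; apply: gen_ideal_sub; exists b, x. Qed.

Lemma pow_fil A s : local A -> (forall g, g \in s -> maxideal A g) -> maxideal A = span A s ->
  forall n, pow_ideal A (maxideal A) n = fil A zeroid s n.
Proof.
move=> lA hs E n; have rA := local_sub lA; have h0 := ideal_zero rA.
have hsA g : g \in s -> A g by move=> /hs [].
have [f0 fI _ fM] := fil_filtr rA h0 hsA.
have f1 : fil A zeroid s 1 = maxideal A.
  rewrite fil1 E; apply: subp_anti; first by move=> z [_ [j [-> hj ->]]]; rewrite add0r.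
  by move=> z hz; exists 0, z; rewrite add0r.
apply: subp_anti.
  elim: n => [|n IH] z /=; first by rewrite f0.
  apply; first exact: fI.
  by move=> _ [a [b [/IH ha hb ->]]]; rewrite -addn1; apply: fM => //; rewrite f1.
elim: s {E f0 fI fM f1} hs hsA n => [|x s IH] hs hsA n.
  by case: n => [|n] z //= ->; apply: idl0 (pow_id n.+1 lA).
have hs' g : g \in s -> maxideal A g by move=> gs; apply: hs; rewrite inE gs orbT.
have hsA' g : g \in s -> A g by move=> /hs' [].
have mx : maxideal A x by apply: hs; rewrite mem_head.
elim: n => [|n IHn] z //= [i [_ [hi [b /IHn hb ->] ->]]].
have hp := pow_id n.+1 lA; apply: (idlD hp).
  exact: (IH hs' hsA').
by rewrite mulrC; apply: powS.
Qed.

Lemma regular_mord A : regular_local A -> mord (pow_ideal A (maxideal A)).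
Proof.
move=> rg; have [lA nA _] := rg; have rA := local_sub lA.
have [s [hs E g]] := regular_good rg.
move=> n k a b; rewrite !(pow_fil lA hs E); apply: fil_mord => //.
by move=> u /hs [].
Qed.

Lemma regular_filtr A : regular_local A -> filtr A (pow_ideal A (maxideal A)).
Proof.
move=> rg; have [lA nA _] := rg; have rA := local_sub lA.
have [s [hs E g]] := regular_good rg.
have -> : pow_ideal A (maxideal A) = fil A zeroid s.
  by apply: functional_extensionality => n; apply: pow_fil.
by apply: fil_filtr => //; [exact: ideal_zero|move=> u /hs []].
Qed.

Lemma regular_cap A z : regular_local A -> (forall n, pow_ideal A (maxideal A) n z) -> z = 0.
Proof.
move=> rg; have [lA nA _] := rg.
have [s [hs E g]] := regular_good rg.
by move=> h; apply: (fil_cap lA nA hs g) => v; rewrite -(pow_fil lA hs E).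
Qed.

End Filtration.

(** * Regular local rings are completely integrally closed *)

Section Normal.
Variable F : fieldType.
Implicit Types (A B S V : F -> Prop) (I J P Q : F -> Prop) (s : seq F).

(* [f / g] is almost integral over [A / I], with common denominator [d]. *)
Definition almost A I d g : F -> Prop :=
  fun f => forall k, exists2 a, A a & I (d * f ^+ k - a * g ^+ k).

(* [A / I] is completely integrally closed. *)
Definition cic A I := forall f g d, A f -> A g -> A d -> ~ I g -> ~ I d ->
  almost A I d g f -> exists2 h, A h & I (f - g * h).

(** Binomial expansion of (f - g h)^k, using the witnesses for the powers of f; the denominator d
    does not change. *)
Lemma almost_shift A I d g f h : subring A -> ideal A I -> A d -> A g -> A f -> A h ->
  almost A I d g f -> almost A I d g (f - g * h).
Proof.
move=> rA hI Ad Ag Af Ah hf k.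
have hw j : exists a, A a /\ I (d * f ^+ j - a * g ^+ j) by have [a] := hf j; exists a.
pose a j := proj1_sig (constructive_indefinite_description _ (hw j)).
have Aa j : A (a j) by rewrite /a; case: constructive_indefinite_description => ? [].
have Ia j : I (d * f ^+ j - a j * g ^+ j).
  by rewrite /a; case: constructive_indefinite_description => ? [].
have hA := ideal_top rA.
exists (\sum_(i < k.+1) (a (k - i)%N * (- h) ^+ i) *+ 'C(k, i)).
  by apply: (idl_sum _ hA) => i _; apply: (idlMn _ hA); have ? := Aa (k - i)%N; mem.
rewrite exprDn mulr_sumr mulr_suml -sumrB; apply: (idl_sum _ hI) => i _.
have e : g ^+ k = g ^+ (k - i) * g ^+ i by rewrite -exprD subnK // -ltnS.
rewrite mulrnAr mulrnAl -mulrnBl; apply: (idlMn _ hI).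
have -> : d * (f ^+ (k - i) * (- (g * h)) ^+ i) - a (k - i)%N * (- h) ^+ i * g ^+ k =
  (d * f ^+ (k - i) - a (k - i)%N * g ^+ (k - i)) * (g ^+ i * (- h) ^+ i).
  by rewrite e -mulrN exprMn; ring.
by apply: (idlMr hI) => //; mem.
Qed.

(** When g is nonzero modulo x, f is approximated by multiples of g modulo every power of x, and an
    intersection argument removes the error. A general g is first divided by its power of x, and f
    turns out to be divisible along with it. *)
Lemma cic_step A I x : local A -> noetherian A -> maxideal A x -> prime_ideal A I -> ~ I x ->
  prime_ideal A (addid I (mulid x A)) -> cic A (addid I (mulid x A)) -> cic A I.
Proof.
move=> lA nA mx pI nx pI' cI'; have rA := local_sub lA; have hI := prime_idl pI.
have Ax : A x by case: mx.
set I' := addid I (mulid x A) in pI' cI' *; have hI' := prime_idl pI'.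
pose X n := addid I (mulid (x ^+ n) A).
have hX n : ideal A (X n) by apply: ideal_add => //; apply: ideal_mul; [|mem|apply: ideal_top].
have X1 : X 1%N = I' by [].
have XI n : subp I (X n) by move=> i Ii; exists i, 0; rewrite addr0; split=> //; exists 0; [mem|rewrite mulr0].
have decX n : subp (X n.+1) (X n).
  by move=> z [i [_ [Ii [a Aa ->] ->]]]; exists i, (x ^+ n * (x * a)); split=> //;
     [exists (x * a) => //; mem|rewrite exprSr mulrA].
have decX' n k : (n <= k)%N -> subp (X k) (X n).
  by move=> /subnKC <-; elim: (k - n)%N => [|j IHj] z; rewrite ?addn0 // addnS => /decX /IHj.
have XnI z n : A z -> I (x ^+ n * z) -> I z.
  by move=> Az /(prime_or pI) [||/(primeX rA pI Ax)|] //; mem.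
have Xcan z n : A z -> X n.+1 (x * z) -> X n z.
  move=> Az [i [_ [Ii [a Aa ->] e]]].
  have : I (x ^+ 1 * (z - x ^+ n * a)).
    by have -> : x ^+ 1 * (z - x ^+ n * a) = i; [rewrite expr1 mulrBr e exprS; ring|].
  move=> /XnI h; exists (z - x ^+ n * a), (x ^+ n * a); split; last by rewrite subrK.
    by apply: h; mem.
  by exists a.
have capX z : (forall n, X n z) -> I z.
  pose H : F -> Prop := fun z => forall n, X n z.
  have hH : ideal A H.
    split=> [u hu|n|u w hu hw n|a u Aa hu n].
    - exact: (idlS (hX 0%N)).
    - exact: idl0 (hX n).
    - by apply: (idlD (hX n)).
    - by apply: (idlM (hX n)).
  apply: (nakayama lA nA hH hI mx) => h Hh.
  have [i [_ [Ii [a Aa ->] e]]] := Hh 1%N; rewrite expr1 in e; exists i, a; split=> // n.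
  apply: Xcan => //; have -> : x * a = h - i by rewrite e; ring.
  by have ? := XI n.+1 i Ii; have ? := Hh n.+1; have hXn := hX n.+1; mem.
have Xord z : A z -> ~ I z -> exists n, X n z /\ ~ X n.+1 z.
  move=> Az nz; apply: NNPP => hno; apply: nz; apply: capX; elim=> [|n IH].
    by exists 0, z; rewrite add0r; split=> //; [mem|exists z; rewrite ?mul1r].
  by apply: NNPP => h; apply: hno; exists n.
have Xdec n z : A z -> X n z -> ~ X n.+1 z -> exists i w, [/\ I i, A w, z = i + x ^+ n * w & ~ I' w].
  move=> Az [i [_ [Ii [w Aw ->] e]]] nz; exists i, w; split=> //.
  move=> [j [_ [Ij [a Aa ->] ew]]]; apply: nz.
  exists (i + x ^+ n * j), (x ^+ n.+1 * a); split; [mem|by exists a|].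
  by rewrite e ew exprSr; ring.
have Xg g k a n : A g -> ~ I' g -> A a -> X n (a * g ^+ k) -> X n a.
  move=> Ag ng; elim: n a => [|n IH] a Aa.
    by move=> _; exists 0, a; rewrite add0r; split=> //; [mem|exists a; rewrite ?mul1r].
  move=> h; have : I' (a * g ^+ k) by rewrite -X1; apply: (decX' 1%N n.+1).
  move=> /(prime_or pI' Aa) [|[i [_ [Ii [b Ab ->] e]]]|/(primeX rA pI' Ag)] //; first by mem.
  have : X n b.
    apply: IH => //; apply: Xcan; first by mem.
    have -> : x * (b * g ^+ k) = a * g ^+ k - i * g ^+ k by rewrite e; ring.
    have hXn := hX n.+1; have Xi := XI n.+1 i Ii; have ? : A (g ^+ k) by mem.
    by apply: (idlB rA hXn) => //; apply: (idlMr hXn).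
  move=> [j [_ [Ij [c Ac ->] eb]]]; exists (i + x * j), (x ^+ n.+1 * c); split.
  - mem.
  - by exists c.
  - by rewrite e eb exprS; ring.
(* A factor x^n on the left can be cancelled, since by [Xg] it also divides a modulo I. *)
have divx d f g a k n : A d -> A f -> A g -> ~ I' g -> A a -> I (x ^+ n * (d * f ^+ k) - a * g ^+ k) ->
    exists2 b, A b & I (d * f ^+ k - b * g ^+ k).
  move=> Ad Af Ag ng Aa h.
  have : X n (a * g ^+ k).
    exists (- (x ^+ n * (d * f ^+ k) - a * g ^+ k)), (x ^+ n * (d * f ^+ k)); split; [|by exists (d * f ^+ k) => //; mem|by ring].
    exact: (idlN rA hI).
  move=> /(Xg _ _ _ _ Ag ng Aa) [i [_ [Ii [b Ab ->] e]]]; exists b => //.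
  apply: (XnI _ n); first by mem.
  have -> : x ^+ n * (d * f ^+ k - b * g ^+ k) = (x ^+ n * (d * f ^+ k) - a * g ^+ k) + i * g ^+ k.
    by rewrite e; ring.
  by apply: (idlD hI) => //; mem.
have case0 f g d : A f -> A g -> A d -> ~ I' g -> ~ I d -> almost A I d g f ->
    exists2 h, A h & I (f - g * h).
  move=> Af Ag Ad ng nd hf.
  (* Dividing d by its power of x gives a denominator d' that stays nonzero modulo x, as closedness
     of A/I' requires. *)
  have [n [Xd nXd]] := Xord d Ad nd.
  have [i [d' [Ii Ad' ed nd']]] := Xdec n d Ad Xd nXd.
  have {}hf : almost A I d' g f.
    move=> k; have [a Aa h] := hf k; apply: (divx d' f g a k n) => //.
    have -> : x ^+ n * (d' * f ^+ k) - a * g ^+ k = (d * f ^+ k - a * g ^+ k) - i * f ^+ k.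
      by rewrite ed; ring.
    by have ? : A (f ^+ k) by [mem]; apply: (idlB rA hI) => //; mem.
  (* If f - g h is x f1 modulo I, then f1 is almost integral with the same d', because [divx]
     removes x^k from its k-th relation; so the approximation can be continued with f1. *)
  have approx m : forall f, A f -> almost A I d' g f -> exists2 h, A h & X m (f - g * h).
    elim: m => [|m IH] {Af hf}f Af hf.
      exists 0; first by mem.
      rewrite mulr0 subr0; exists 0, f; rewrite add0r; split=> //; [mem|by exists f; rewrite ?mul1r].
    have [h Ah [j [_ [Ij [f1 Af1 ->] e]]]] : exists2 h, A h & I' (f - g * h).
      apply: (cI' f g d') => // k; have [a Aa Ia] := hf k; exists a => //.
      by rewrite -X1; apply: XI.
    have hf1 : almost A I d' g f1.
      move=> k; have [a Aa Ia] := almost_shift rA hI Ad' Ag Af Ah hf k.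
      apply: (divx d' f1 g a k k) => //.
      have [c Ac ec] : exists2 c, A c & (j + x * f1) ^+ k = x ^+ k * f1 ^+ k + j * c.
        elim: {Ia} k => [|k [c Ac ec]]; first by exists 0; [mem|rewrite !expr0; ring].
        exists ((j + x * f1) ^+ k + x * f1 * c); first by have ? := idlS hI Ij; mem.
        by rewrite exprS mulrDl {2}ec !exprS; ring.
      have -> : x ^+ k * (d' * f1 ^+ k) - a * g ^+ k =
        (d' * (f - g * h) ^+ k - a * g ^+ k) - j * (d' * c).
        by rewrite e ec; ring.
      by apply: (idlB rA hI) => //; mem.
    have [h1 Ah1 [j1 [_ [Ij1 [b Ab ->] e1]]]] := IH f1 Af1 hf1.
    exists (h + x * h1); first by mem.
    exists (j + x * j1), (x ^+ m.+1 * b); split; [mem|by exists b|].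
    have -> : f - g * (h + x * h1) = j + x * (f1 - g * h1) by rewrite mulrDr opprD addrA e; ring.
    by rewrite e1 exprS; ring.
  have hgA : ideal A (mulid g A) by apply: ideal_mul => //; apply: ideal_top.
  have hL := ideal_add rA hI hgA; set L := addid I (mulid g A) in hL.
  (* Since x may be a zero divisor modulo L, the colon ideals L : x^n are needed: they stop growing
     at n0, and this turns h = l + x^(n0+1) a in the intersection H into h in L + xH. *)
  have [n0 st] := @noeth_acc F A (fun n z => A z /\ L (x ^+ n * z)) nA
    ltac:(move=> q; split=> [u []//||u w [Au Lu] [Aw Lw]|a u Aa [Au Lu]];
      [by split; [mem|rewrite mulr0; mem] | by split; [mem|rewrite mulrDr; mem]
      |by split; [mem|rewrite mulrCA; mem]])
    ltac:(by move=> q u [Au Lu]; split=> //; rewrite exprS -mulrA; mem).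
  pose H : F -> Prop := fun z => forall n, addid L (mulid (x ^+ n) A) z.
  have hLx q : ideal A (addid L (mulid (x ^+ q) A)).
    by apply: ideal_add => //; apply: ideal_mul; [|mem|apply: ideal_top].
  have hH : ideal A H.
    split=> [u hu|q|u w hu hw q|a u Aa hu q].
    - exact: (idlS (hLx 0%N)).
    - exact: idl0 (hLx q).
    - by apply: (idlD (hLx q)).
    - by apply: (idlM (hLx q)).
  have : L f.
    apply: (nakayama lA nA hH hL mx); last first.
      move=> q; have [h Ah [j [_ [Ij [b Ab ->] e]]]] := approx q f Af hf.
      exists (j + g * h), (x ^+ q * b); split; [by exists j, (g * h); split=> //; exists h|by exists b|].
      by have -> : f = (f - g * h) + g * h; [ring|rewrite e; ring].
    move=> h Hh; have [l [_ [Ll [a Aa ->] e]]] := Hh n0.+1.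
    exists l, (x ^+ n0 * a); split=> //; last by rewrite e exprS; ring.
    move=> q; have [l' [_ [Ll' [a' Aa' ->] e']]] := Hh (n0.+1 + q)%N.
    have [_ Lz] : A (a - x ^+ q * a') /\ L (x ^+ n0 * (a - x ^+ q * a')).
      apply: (st n0.+1); split; first by mem.
      have -> : x ^+ n0.+1 * (a - x ^+ q * a') = l' - l.
        have -> : l' = h - x ^+ (n0.+1 + q) * a' by rewrite e'; ring.
        by rewrite e exprD; ring.
      mem.
    exists (x ^+ n0 * (a - x ^+ q * a')), (x ^+ q * (x ^+ n0 * a')); split=> //; last by ring.
    by exists (x ^+ n0 * a') => //; mem.
  move=> [j [_ [Ij [h Ah ->] e]]]; exists h => //.
  by have -> : f - g * h = j by rewrite e; ring.
have main n : forall f g d, A f -> A g -> A d -> X n g -> ~ X n.+1 g -> ~ I d -> almost A I d g f ->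
    exists2 h, A h & I (f - g * h).
  elim: n => [|n IH] f g d Af Ag Ad Xn nXn nd hf; first by apply: (case0 f g d).
  have [i [w [Ii Aw eg nw]]] := Xdec _ _ Ag Xn nXn.
  (* All d f^k are congruent modulo I to multiples of g^k, which is divisible by x^k modulo I. If f
     were regular modulo x, then d would be divisible by all powers of x, hence in I. *)
  have : I' f.
    apply: NNPP => nf; apply: nd; apply: capX => k.
    have [a Aa Ia] := hf k.
    have Xgk : X k (g ^+ k).
      elim: {hf Ia} k => [|k IHk]; first by exists 0, 1; split; [mem|exists 1; [mem|rewrite mul1r]|rewrite add0r].
      have [u [_ [Iu [b Ab ->] e]]] := IHk.
      have := decX' 1%N n.+1 isT _ Xn; rewrite X1 => -[v [_ [Iv [c Ac ->] ev]]].
      exists (u * g + x ^+ k * b * v), (x ^+ k.+1 * (b * c)); split; [by mem|by exists (b * c); [mem|]|].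
      by rewrite exprSr e {2}ev exprSr {1}ev; ring.
    apply: (Xg f k) => //.
    have -> : d * f ^+ k = (d * f ^+ k - a * g ^+ k) + a * g ^+ k by ring.
    have h := hX k; have h1 := XI k _ Ia.
    by apply: (idlD h) => //; apply: (idlM h).
  move=> [j [_ [Ij [f1 Af1 ->] ef]]].
  pose g1 := x ^+ n * w; have Ag1 : A g1 by rewrite /g1; mem.
  have eg1 : g = i + x * g1 by rewrite eg exprS; rewrite /g1; ring.
  have pw u b k : I u -> A b -> exists2 c, I c & (u + x * b) ^+ k = x ^+ k * b ^+ k + c.
    move=> Iu Ab; elim: k => [|k [c Ic ec]]; first by exists 0; [mem|rewrite !expr0; ring].
    exists (u * (u + x * b) ^+ k + x * b * c); last by rewrite exprS mulrDl {2}ec !exprS; ring.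
    have ? := idlS hI Iu; have ? : A ((u + x * b) ^+ k) by mem.
    have ? : A (x * b) by mem.
    by apply: (idlD hI); [apply: (idlMr hI)|apply: (idlM hI)].
  have [|||h Ah Ih] := IH f1 g1 d Af1 Ag1 Ad _ _ nd.
  - by exists 0, g1; rewrite add0r; split=> //; [mem|exists w].
  - move=> [u [_ [Iu [b Ab ->] e]]]; apply: nXn; exists (i + x * u), (x ^+ n.+2 * b).
    by split; [mem|exists b|rewrite eg1 e !exprS; ring].
  - move=> k; have [a Aa Ia] := hf k; exists a => //.
    have [c Ic ec] := pw j f1 k Ij Af1; have [c' Ic' ec'] := pw i g1 k Ii Ag1.
    apply: (XnI _ k); first by mem.
    have -> : x ^+ k * (d * f1 ^+ k - a * g1 ^+ k) = (d * f ^+ k - a * g ^+ k) - d * c + a * c'.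
      by rewrite ef eg1 ec ec'; ring.
    by apply: (idlD hI); [apply: (idlB rA hI) => //|]; mem.
  exists h => //; have -> : f - g * h = j - i * h + x * (f1 - g1 * h) by rewrite ef eg1; ring.
  by apply: (idlD hI); [apply: (idlB rA hI) => //|apply: (idlM hI)]; mem.
move=> f g d Af Ag Ad ng nd hf.
have [n [Xn nXn]] := Xord g Ag ng.
by apply: (main n f g d).
Qed.

(** At the end of the sequence A/I is the residue field; [cic_step] goes back one parameter at a
    time. *)
Lemma cic_pseq A s : local A -> noetherian A -> (forall g, g \in s -> maxideal A g) ->
  forall I, pseq A I s -> subp (maxideal A) (addid I (span A s)) -> cic A I.
Proof.
move=> lA nA; have rA := local_sub lA; elim: s => [_|x s IH hs] I /=.
  move=> [pI _] sm f g d Af Ag Ad ng _ _.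
  have nm : ~ maxideal A g by move=> /sm [i [_ [Ii -> e]]]; apply: ng; rewrite e addr0.
  have [g0 Ag'] := not_max Ag nm; exists (f / g); first by mem.
  by rewrite mulrC divfK // subrr; apply: idl0 (prime_idl pI).
move=> [pI [nx ps]] sm; apply: (@cic_step A I x) => //.
- by apply: hs; rewrite mem_head.
- exact: pseq_prime ps.
apply: IH => //; first by move=> g gs; apply: hs; rewrite inE gs orbT.
by rewrite addidA.
Qed.

Lemma regular_cic A f g d : regular_local A -> A f -> A g -> A d -> g != 0 -> d != 0 ->
  (forall k, A (d * (f / g) ^+ k)) -> A (f / g).
Proof.
move=> rg Af Ag Ad g0 d0 h; have [lA nA _] := rg; have rA := local_sub lA.
have [s [hs E gd]] := regular_good rg.
have hc : cic A zeroid.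
  apply: (cic_pseq lA nA hs (gd s (perm_refl s))) => z; rewrite E => hz.
  by exists 0, z; rewrite add0r.
have [||k|q Aq e] := hc f g d Af Ag Ad; [exact/eqP|exact/eqP| |].
  exists (d * (f / g) ^+ k) => //.
  by rewrite /zeroid exprMn exprVn -!mulrA mulVf ?expf_neq0 // mulr1 subrr.
by have -> : f / g = q; [apply: (mulIf g0); rewrite divfK // mulrC; apply/eqP; rewrite -subr_eq0; apply/eqP|].
Qed.

End Normal.

(** * Forms in the parameters and their independence over the residue field *)

Section Forms.
Variables (F : fieldType) (d : nat).
Implicit Types (A B : F -> Prop) (I J P Q : F -> Prop) (p q : {mpoly F[d]}) (x t : 'I_d -> F).

Definition addcl (C : F -> Prop) := C 0 /\ forall a b, C a -> C b -> C (a + b).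

Lemma idl_addcl A I : ideal A I -> addcl I. Proof. by case. Qed.

Lemma sub_addcl A : subring A -> addcl A.
Proof. by move=> rA; split=> [|a b ? ?]; mem. Qed.

Lemma addcl_sum (C : F -> Prop) (T : Type) (r : seq T) (P : pred T) (f : T -> F) : addcl C ->
  (forall i, P i -> C (f i)) -> C (\sum_(i <- r | P i) f i).
Proof. by move=> [C0 CD] h; elim/big_rec: _ => // i a Pi Ca; apply: CD => //; apply: h. Qed.

(** The condition may depend on the degree of the monomial, so that degree bounds and orders of
    vanishing are instances as well as [over]. *)
Definition coefs (c : nat -> F -> Prop) p := forall m, c (mdeg m) p@_m.
Definition over (C : F -> Prop) := coefs (fun _ => C).

Lemma coefs_0 c : (forall n, c n 0) -> coefs c 0.
Proof. by move=> h m; rewrite mcoeff0. Qed.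

Lemma coefs_D c p q : (forall n, addcl (c n)) -> coefs c p -> coefs c q -> coefs c (p + q).
Proof. by move=> h hp hq m; rewrite mcoeffD; apply: (proj2 (h _)). Qed.

Lemma coefs_sum c (T : Type) (r : seq T) (P : pred T) (f : T -> {mpoly F[d]}) :
  (forall n, addcl (c n)) -> (forall i, P i -> coefs c (f i)) -> coefs c (\sum_(i <- r | P i) f i).
Proof.
move=> h hf; elim/big_rec: _ => [|i q Pi hq]; first by apply: coefs_0 => n; case: (h n).
by apply: coefs_D => //; apply: hf.
Qed.

Lemma coefs_M (c1 c2 c3 : nat -> F -> Prop) p q : (forall n, addcl (c3 n)) ->
  (forall n1 n2 a b, c1 n1 a -> c2 n2 b -> c3 (n1 + n2)%N (a * b)) ->
  coefs c1 p -> coefs c2 q -> coefs c3 (p * q).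
Proof.
move=> h hM hp hq m; rewrite mcoeffM; apply: addcl_sum => // -[k1 k2] /= /eqP em.
by have := hM _ _ _ _ (hp k1) (hq k2); rewrite -mdegD -em.
Qed.

Lemma coefs_Z (c1 c2 : nat -> F -> Prop) a p : (forall n b, c1 n b -> c2 n (a * b)) ->
  coefs c1 p -> coefs c2 (a *: p).
Proof. by move=> h hp m; rewrite mcoeffZ; apply: h. Qed.

Lemma over_M A C p q : ideal A C -> over C p -> over A q -> over C (p * q).
Proof.
move=> hC hp hq; apply: (coefs_M (c1 := fun _ => C) (c2 := fun _ => A)) => //.
  by move=> _; apply: (idl_addcl hC).
by move=> _ _ a b Ca Ab; mem.
Qed.

Lemma over_sub (C D : F -> Prop) p : subp C D -> over C p -> over D p.
Proof. by move=> s h m; apply: s; apply: h. Qed.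

Lemma over_X A m : subring A -> over A 'X_[m].
Proof. by move=> rA k; rewrite mcoeffX; case: (m == k); rewrite ?mulr1n ?mulr0n; mem. Qed.

Lemma over_C A c : subring A -> A c -> over A c%:MP.
Proof. by move=> rA Ac m; rewrite mcoeffC; case: (m == 0%MM); rewrite ?mulr1 ?mulr0; mem. Qed.

Lemma over_D A p q : subring A -> over A p -> over A q -> over A (p + q).
Proof. by move=> rA; apply: coefs_D => _; apply: sub_addcl. Qed.

Lemma over_N A p : subring A -> over A p -> over A (- p).
Proof. by move=> rA hp m; rewrite mcoeffN; have ? := hp m; mem. Qed.

Lemma over_Mr A p q : subring A -> over A p -> over A q -> over A (p * q).
Proof. by move=> rA; apply: over_M; apply: ideal_top. Qed.

Lemma over_Xn A p n : subring A -> over A p -> over A (p ^+ n).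
Proof.
move=> rA hp; elim: n => [|n IH]; last by rewrite exprS; apply: over_Mr.
by rewrite expr0 -mpolyC1; apply: over_C => //; mem.
Qed.

Definition form A n p := over A p /\ p \is n.-homog.

Lemma formM A n k p q : subring A -> form A n p -> form A k q -> form A (n + k) (p * q).
Proof. by move=> rA [op hp] [oq hq]; split; [apply: over_Mr|apply: dhomogM]. Qed.

Lemma formX A n k p : subring A -> form A n p -> form A (n * k) (p ^+ k).
Proof. by move=> rA [op hp]; split; [apply: over_Xn|apply: dhomogMn]. Qed.

Lemma formX1 A k p : subring A -> form A 1 p -> form A k (p ^+ k).
Proof. by move=> rA h; have := formX k rA h; rewrite mul1n. Qed.

Lemma formD A n p q : subring A -> form A n p -> form A n q -> form A n (p + q).
Proof. by move=> rA [op hp] [oq hq]; split; [apply: over_D|apply: dhomogD]. Qed.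

Lemma formN A n p : subring A -> form A n p -> form A n (- p).
Proof. by move=> rA [op hp]; split; [apply: over_N|rewrite dhomogN]. Qed.

Lemma formC A c : subring A -> A c -> form A 0 c%:MP.
Proof.
move=> rA Ac; split; first exact: over_C.
by rewrite -[c%:MP]mulr1 mul_mpolyC; apply: dhomogZ; apply: dhomog1.
Qed.

Lemma formXU A i : subring A -> form A 1 'X_i.
Proof. by move=> rA; split; [apply: over_X|rewrite dhomogX; apply/eqP; apply: mdeg1]. Qed.

Lemma form_scale n p y t : p \is n.-homog -> p.@[fun i => y * t i] = y ^+ n * p.@[t].
Proof.
move=> /dhomogP hp; rewrite !mevalE mulr_sumr; apply: eq_big_seq => m /hp hm.
rewrite mulrCA; congr (_ * _).
rewrite (eq_bigr (fun i => y ^+ m i * t i ^+ m i)); last by move=> i _; rewrite exprMn.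
by rewrite big_split /= prodrXr -mdegE [mdeg m]hm.
Qed.

Lemma monom_filtr A (G : nat -> F -> Prop) x (m : 'X_{1..d}) : filtr A G -> subring A ->
  (forall i, m i != 0%N -> G 1%N (x i)) -> G (mdeg m) (\prod_i x i ^+ m i).
Proof.
move=> [G0 _ _ GM] rA h; rewrite mdegE.
elim/big_rec2: _ => [|i k z _ IH]; first by rewrite G0; mem.
apply: (GM _ _ _ _ _ IH); case E: (m i) => [|j]; first by rewrite G0 expr0; mem.
have xi : G 1%N (x i) by apply: h; rewrite E.
elim: j {E} => [|j IHj]; first by rewrite expr1.
by rewrite exprS -add1n; apply: GM.
Qed.

Lemma form_filtr A (G : nat -> F -> Prop) x p n k : filtr A G -> subring A ->
  (forall i m, m \in msupp p -> m i != 0%N -> G 1%N (x i)) -> p \is n.-homog -> over (G k) p ->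
  G (k + n)%N p.@[x].
Proof.
move=> fG rA h /dhomogP hp op; have [_ hG _ GM] := fG; rewrite mevalE big_seq.
apply: (idl_sum _ (hG _)) => m mp; apply: (GM _ _ _ _ (op m)).
rewrite -[n](hp m mp); apply: (monom_filtr fG) => // i; exact: h.
Qed.

Lemma form_split A n p (i : 'I_d) u : subring A -> form A n p ->
  (forall m j, m \in msupp p -> j \notin i :: u -> m j = 0%N) ->
  exists p0 p1, [/\ p = p0 + 'X_i * p1, form A n p0, form A n.-1 p1 /\ (n = 0%N -> p1 = 0),
    (forall m j, m \in msupp p0 -> j \notin u -> m j = 0%N) &
    (forall m j, m \in msupp p1 -> j \notin i :: u -> m j = 0%N)].
Proof.
move=> rA [op /dhomogP hp] sp.
have oZ m m' : over A (p@_m *: 'X_[m']).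
  apply: (coefs_Z (c1 := fun _ => A)); last exact: over_X.
  by move=> _ b Ab; have ? := op m; mem.
have memX m m' (c : F) : m' \in msupp (c *: 'X_[m] : {mpoly F[d]}) -> m' = m.
  by move=> /msuppZ_le; rewrite msuppX inE => /eqP.
exists (\sum_(m <- msupp p | m i == 0%N) p@_m *: 'X_[m]).
exists (\sum_(m <- msupp p | m i != 0%N) p@_m *: 'X_[m - U_(i)]).
have supp_sum (P : pred 'X_{1..d}) (f : 'X_{1..d} -> 'X_{1..d}) m' :
    m' \in msupp (\sum_(m <- msupp p | P m) p@_m *: 'X_[f m] : {mpoly F[d]}) ->
    exists m, [/\ m \in msupp p, P m & m' = f m].
  move=> /msupp_sum_le /flatten_mapP [m]; rewrite mem_filter => /andP [Pm mp] /memX ->.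
  by exists m.
split.
- rewrite {1}[p]mpolyE (bigID (fun m : 'X_{1..d} => m i == 0%N)) /=; congr (_ + _).
  rewrite mulr_sumr; apply: eq_bigr => m mi; rewrite -scalerAr; congr (_ *: _).
  rewrite -mpolyXD addmC submK //; apply/mnm_lepP => j; rewrite mnm1E.
  by case: eqP => // <-; rewrite lt0n.
- split; first by apply: coefs_sum => [_|m _]; [exact: sub_addcl|exact: oZ].
  by apply/dhomogP => m' /(supp_sum _ id) [m [mp _ ->]]; apply: hp.
- have hd m : m \in msupp p -> m i != 0%N -> (mdeg (m - U_(i))).+1 = n.
    move=> mp mi; have le : (U_(i) <= m)%MM.
      by apply/mnm_lepP => j; rewrite mnm1E; case: eqP => // <-; rewrite lt0n.
    by rewrite -(hp m mp) /= -{2}(submK le) mdegD mdeg1 addn1.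
  split; last first.
    move=> n0; rewrite big_seq_cond big1 // => m /andP [mp mi].
    by have := hd m mp mi; rewrite n0.
  split; first by apply: coefs_sum => [_|m _]; [exact: sub_addcl|exact: oZ].
  by apply/dhomogP => m' /(supp_sum _ (fun m => m - U_(i))%MM) [m [mp mi ->]]; rewrite -(hd m mp mi).
- move=> m' j /(supp_sum _ id) [m [mp /eqP mi ->]] ju.
  by case: (eqVneq j i) => [->//|ne]; apply: (sp m j mp); rewrite inE negb_or ne.
- move=> m' j /(supp_sum _ (fun m => m - U_(i))%MM) [m [mp mi ->]] ju.
  by rewrite mnmBE (sp m j mp ju).
Qed.

(** The graded ring is a polynomial ring in the parameters. With p = p0 + X_i p1, only p0 survives
    modulo x_i, which settles p0 by induction on the variables; then x_i cancels and p1 has smaller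
    degree. *)
Lemma forms_indep A x u : local A -> noetherian A -> (forall i, i \in u -> maxideal A (x i)) ->
  forall I, good A I (map x u) -> maxideal A = addid I (span A (map x u)) ->
  forall n p, over A p -> p \is n.-homog ->
    (forall m i, m \in msupp p -> i \notin u -> m i = 0%N) ->
    fil A I (map x u) n.+1 p.@[x] -> over (maxideal A) p.
Proof.
move=> lA nA; have rA := local_sub lA; have hM := local_max lA.
elim: u => [_|i u IHu hu] I gI eM.
  move=> n p op /dhomogP hp sp.
  have m0 m : m \in msupp p -> m = 0%MM by move=> mp; apply/mnmP => i; rewrite mnm0E (sp m i).
  have -> : p = (p@_0)%:MP.
    apply/mpolyP => m; rewrite mcoeffC; case: (eqVneq m 0%MM) => [->|nm]; first by rewrite mulr1.
    by rewrite mulr0; apply: memN_msupp_eq0; apply: contra nm => /m0 ->.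
  rewrite mevalC /= => Ip m; rewrite mcoeffC.
  have ? : maxideal A p@_0 by rewrite eM; exists p@_0, 0; rewrite addr0.
  by case: (m == 0%MM); rewrite ?mulr1 ?mulr0; mem.
have hu' j : j \in u -> maxideal A (x j) by move=> ju; apply: hu; rewrite inE ju orbT.
have huA j : j \in map x u -> A j by move=> /mapP [k /hu' [h _] ->].
have hxm : maxideal A (x i) by apply: hu; rewrite mem_head.
have Ax : A (x i) by case: hxm.
have hI := prime_idl (good_prime gI).
have fG := fil_filtr rA hI huA; have fX := filx_filtr rA fG Ax.
have eM' : maxideal A = addid (addid I (mulid (x i) A)) (span A (map x u)) by rewrite addidA.
have XA v z : filx A (fil A I (map x u)) (x i) v z -> A z.
  by have [_ hX _ _] := fX; apply: (idlS (hX v)).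
have G1M : subp (maxideal A) (filx A (fil A I (map x u)) (x i) 1).
  by move=> z; rewrite eM -fil1; apply.
have G1m j : j \in i :: u -> filx A (fil A I (map x u)) (x i) 1 (x j).
  by move=> ju; apply: G1M; apply: hu.
have toA v z : filx A (fil A I (map x u)) (x i) v.+1 z -> addid (fil A I (map x u) v.+1) (mulid (x i) A) z.
  by move=> [f [_ [hf [g Xg ->] ->]]]; exists f, (x i * g); split=> //; exists g => //; apply: (XA v).
elim=> [|n IHn] p op hp sp hv.
all: have [p0 [p1 [ep [op0 hp0] [[op1 hp1] p1n] sp0 sp1]]] := form_split rA (conj op hp) sp.
all: have ov : p.@[x] = p0.@[x] + x i * p1.@[x] by rewrite {1}ep mevalD mevalM mevalXU.
all: have Ap1 : A p1.@[x] by
  have := @form_filtr A _ x p1 _ 0 fX rA (fun j m mp mj => G1m j (contraNT (fun nj => introT eqP (sp1 m j mp nj)) mj)) hp1 op1 => /XA.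
all: have m0 : over (maxideal A) p0.
1,3: apply: (IHu hu' _ (good_add gI) eM' _ p0 op0 hp0 sp0); rewrite fil_addI //.
1,2: have [f [_ [hf [g hg ->] e]]] := toA _ _ hv; exists f, (x i * (g - p1.@[x])); split=> //.
1,3: by eexists; last by []; mem.
1,2: by have -> : p0.@[x] = p.@[x] - x i * p1.@[x]; [rewrite ov; ring|rewrite e; ring].
- by rewrite ep p1n // mulr0 addr0.
have m1 : over (maxideal A) p1.
  apply: IHn => //; apply: (filx_regular rA fG _ Ax _ Ap1).
  - by apply: fil_mord => //; apply: good_tail gI.
  - by rewrite fil1; apply: good_notin gI.
  have [_ hX _ _] := fX; have -> : x i * p1.@[x] = p.@[x] - p0.@[x] by rewrite ov; ring.
  apply: (idlB rA (hX _)) => //; rewrite -[n.+2]add1n.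
  apply: (form_filtr fX rA) hp0 _; last by apply: over_sub m0.
  by move=> j m mp mj; apply: G1m; apply: contraNT mj => /negP nj; apply/eqP; apply: (sp0 m j mp);
     apply/negP => ju; apply: nj; rewrite inE ju orbT.
rewrite ep; apply: coefs_D => //; first by move=> _; apply: idl_addcl hM.
by rewrite mulrC; apply: (over_M hM) => //; apply: over_X.
Qed.

End Forms.

(** * Orders under a quadratic transform *)

Section Transform.
Variable F : fieldType.
Implicit Types (A B : F -> Prop) (I J P Q : F -> Prop).

Lemma pow1 A : local A -> pow_ideal A (maxideal A) 1 = maxideal A.
Proof.
move=> lA; have rA := local_sub lA; have hM := local_max lA; apply: subp_anti => z.
  by move=> /=; apply => // _ [a [b [ha hb ->]]]; mem.
by move=> hz; rewrite -[z]mul1r; apply: powS => //=; mem.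
Qed.

(** The dictionary between powers of the maximal ideal and values of forms at the parameters. *)
Lemma regular_params A : regular_local A -> exists d (x : 'I_d -> F),
  [/\ forall i, maxideal A (x i),
      forall n z, pow_ideal A (maxideal A) n z -> exists2 p, form A n p & z = p.@[x],
      forall n p, form A n p -> p.@[x] = 0 -> over (maxideal A) p &
      forall n (p : {mpoly F[d]}), over (maxideal A) p -> p \is n.-homog ->
        pow_ideal A (maxideal A) n.+1 p.@[x]].
Proof.
move=> rg; have [lA nA _] := rg; have rA := local_sub lA; have hM := local_max lA.
have [s [hs E gd]] := regular_good rg; have fP := regular_filtr rg.
exists (size s), (fun i => s`_i).
have es : map (fun i : 'I_(size s) => s`_i) (enum 'I_(size s)) = s.
  by rewrite -[RHS](mkseq_nth 0) /mkseq -val_enum_ord -map_comp.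
have mx (i : 'I_(size s)) : maxideal A s`_i by apply: hs; apply: mem_nth; apply: ltn_ord.
have valA n (p : {mpoly F[size s]}) : form A n p -> pow_ideal A (maxideal A) n p.@[fun i => s`_i].
  move=> [op hp]; apply: (@form_filtr _ _ A _ _ p n 0 fP rA) => // i _ _ _.
  by rewrite pow1.
split=> //.
- elim=> [|n IH] z; first by move=> Az; exists z%:MP; [apply: formC|rewrite mevalC].
  move=> hz; apply: (hz (fun z => exists2 p, form A n.+1 p & z = p.@[fun i => s`_i])).
    split.
    + by move=> _ [p hp ->]; apply: (idlS (pow_id n.+1 lA)); apply: valA.
    + by exists 0; [split; [apply: coefs_0 => _; mem|apply: dhomog0]|rewrite meval0].
    + by move=> _ _ [p hp ->] [q hq ->]; exists (p + q); [apply: formD|rewrite mevalD].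
    + move=> a _ Aa [p hp ->]; exists (a%:MP * p); last by rewrite mevalM mevalC.
      by have := formM rA (formC _ rA Aa) hp; apply.
  move=> _ [a [b [/IH [p hp ->] mb ->]]].
  have [q hq ->] : exists2 q : {mpoly F[size s]}, form A 1 q & b = q.@[fun i => s`_i].
    move: mb; rewrite E -[in span _ _]es; elim: (enum _) b => [|i u IHu] b /=.
      by move=> ->; exists 0; [split; [apply: coefs_0 => _; mem|apply: dhomog0]|rewrite meval0].
    move=> [_ [j [[c Ac ->] /IHu [q hq ->] ->]]]; exists (c%:MP * 'X_i + q).
      by apply: formD => //; apply: (formM rA (formC _ rA Ac) (formXU _ rA)).
    by rewrite mevalD mevalM mevalC mevalXU mulrC.
  by exists (p * q); [rewrite -addn1; apply: formM|rewrite mevalM].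
- move=> n p [op hp] e0.
  apply: (@forms_indep _ _ A (fun i : 'I_(size s) => s`_i) (enum 'I_(size s)) lA nA _ zeroid _ _ n) => //.
  + by rewrite es.
  + rewrite es -E; apply: subp_anti => z; last by move=> [_ [j [-> hj ->]]]; rewrite add0r.
    by move=> hz; exists 0, z; rewrite add0r.
  + by move=> m i _; rewrite mem_enum.
  + rewrite e0 es; have h0 := ideal_zero rA.
    by have [_ h _ _] := fil_filtr rA h0 (fun g gs => proj1 (hs g gs)); apply: idl0 (h _).
- move=> n p op hp; rewrite -add1n; apply: (@form_filtr _ _ A _ _ p n 1 fP rA) => //.
    by move=> i _ _ _; rewrite pow1.
  by rewrite pow1.
Qed.

Section Shift.
Variables (d : nat) (t : 'I_d -> F).
Implicit Types p q : {mpoly F[d]}.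

(** Expansion of p at the point t; its low-degree coefficients record the multiplicity there. *)
Definition shift p : {mpoly F[d]} := p \mPo [tuple 'X_i + (t i)%:MP | i < d].

Lemma shiftM p q : shift (p * q) = shift p * shift q.
Proof. exact: rmorphM. Qed.
Lemma shiftD p q : shift (p + q) = shift p + shift q.
Proof. exact: rmorphD. Qed.

Lemma shift_coef0 p : (shift p)@_0 = p.@[t].
Proof.
have e0 q : q@_0 = q.@[fun=> 0].
  rewrite mevalE {1}[q]mpolyE raddf_sum /=; apply: eq_bigr => m _.
  rewrite mcoeffZ mcoeffX; congr (_ * _); case: eqP => [->|/eqP nm].
    by rewrite big1 // => i _; rewrite mnm0E.
  suff /existsP [i ni] : [exists i, m i != 0%N] by rewrite (bigD1 i) //= expr0n (negbTE ni) mul0r.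
  apply: contraR nm; rewrite negb_exists => /forallP h0.
  by apply/eqP/mnmP => i; rewrite mnm0E; apply/eqP; have := h0 i; rewrite negbK.
rewrite e0 comp_mpoly_meval; apply: meval_eq => i.
by rewrite tnth_mktuple mevalD mevalXU mevalC add0r.
Qed.

Lemma shiftE p : shift p = \sum_(m <- msupp p) p@_m *: \prod_i ('X_i + (t i)%:MP) ^+ m i.
Proof.
rewrite /shift comp_mpolyE; apply: eq_bigr => m _; congr (_ *: _).
by apply: eq_bigr => i _; rewrite tnth_mktuple.
Qed.

Lemma over_prodX B (m : 'X_{1..d}) : subring B -> (forall i, B (t i)) ->
  over B (\prod_i ('X_i + (t i)%:MP) ^+ m i).
Proof.
move=> rB Bt; elim/big_rec: _ => [|i q _ IH]; first by rewrite -mpolyC1; apply: over_C => //; mem.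
by apply: over_Mr => //; apply: over_Xn => //; apply: over_D => //; [apply: over_X|apply: over_C].
Qed.

Lemma over_shift B C p : subring B -> ideal B C -> (forall i, B (t i)) -> over C p ->
  over C (shift p).
Proof.
move=> rB hC Bt op; rewrite shiftE; apply: coefs_sum => [_|m _]; first exact: idl_addcl hC.
apply: (coefs_Z (c1 := fun _ => B)); last exact: over_prodX.
by move=> _ b Bb; have ? := op m; mem.
Qed.

Definition deg_le n p := coefs (fun k a => (n < k)%N -> a = 0) p.

Lemma deg_le_addcl n k : addcl (fun a : F => (n < k)%N -> a = 0).
Proof. by split=> [//|a b ha hb h]; rewrite ha // hb // addr0. Qed.

Lemma deg_leM n k p q : deg_le n p -> deg_le k q -> deg_le (n + k) (p * q).
Proof.
apply: coefs_M => [j|n1 n2 a b ha hb h]; first exact: deg_le_addcl.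
case: (ltnP n n1) => h1; first by rewrite ha // mul0r.
rewrite hb ?mulr0 //; rewrite ltnNge; apply: contraL h => h2; rewrite -leqNgt; exact: leq_add.
Qed.

Lemma deg_le_shift n p : p \is n.-homog -> deg_le n (shift p).
Proof.
move=> /dhomogP hp; rewrite shiftE big_seq; apply: coefs_sum => [k|m mp]; first exact: deg_le_addcl.
apply: (coefs_Z (c1 := fun k a => (n < k)%N -> a = 0)); first by move=> k b hb /hb ->; rewrite mulr0.
rewrite -[n](hp m mp) /= mdegE.
elim/big_rec2: _ => [|i k q _ IH].
  by move=> m'; rewrite mcoeff1 -mdeg_eq0; case: (mdeg m').
apply: deg_leM => //; elim: (m i) => [|j IHj].
  by rewrite expr0 => m'; rewrite mcoeff1 -mdeg_eq0; case: (mdeg m').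
rewrite exprS -add1n; apply: deg_leM => // m'; rewrite mcoeffD mcoeffX mcoeffC -mdeg_eq0 => h.
case: eqP => [e|_]; first by move: h; rewrite -e mdeg1.
by case: (mdeg m') h => [//|k'] _; rewrite mulr0 addr0.
Qed.

End Shift.

Lemma shiftK d (t : 'I_d -> F) p : shift (fun i => - t i) (shift t p) = p.
Proof.
rewrite [shift t p]shiftE /shift raddf_sum /= [RHS]mpolyE; apply: eq_bigr => m _.
rewrite comp_mpolyZ; congr (_ *: _); rewrite rmorph_prod mpolyXE_id; apply: eq_bigr => i _.
by rewrite rmorphXn /= comp_mpolyD comp_mpolyC comp_mpolyXU -tnth_nth tnth_mktuple mpolyCN addrNK.
Qed.

Lemma blowup_subring A y : subring (blowup A y).
Proof.
split.
- by move=> B rB _; mem.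
- by move=> B rB _; mem.
- by move=> u v hu hv B rB sB; have ? := hu B rB sB; have ? := hv B rB sB; mem.
- by move=> u v hu hv B rB sB; have ? := hu B rB sB; have ? := hv B rB sB; mem.
Qed.

Lemma blowup_sub A y : subp A (blowup A y).
Proof. by move=> a Aa B rB; apply; left. Qed.

Lemma blowup_div A y w : maxideal A w -> blowup A y (w / y).
Proof. by move=> mw B rB; apply; right; exists w. Qed.

Lemma meval_sub d A p (t : 'I_d -> F) : subring A -> over A p -> (forall i, A (t i)) -> A p.@[t].
Proof.
move=> rA op At; have hA := ideal_top rA; rewrite mevalE; apply: (idl_sum _ hA) => m _.
apply: (subM rA) => //; elim/big_rec: _ => [|i z _ Az]; first by mem.
by have ? := At i; mem.
Qed.

(* Multiplicity does not increase under a quadratic transform: a form of degree [r] whose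
   dehomogenization, expanded at the center of [B], has order above [r] vanishes. *)
Lemma transform_order A B y Q r f : regular_local A -> local B -> maxideal A y -> y != 0 ->
  prime_ideal (blowup A y) Q -> subp (maxideal A) Q -> B = loc (blowup A y) Q ->
  pow_ideal A (maxideal A) r f -> pow_ideal B (maxideal B) r.+1 (f / y ^+ r) ->
  pow_ideal A (maxideal A) r.+1 f.
Proof.
move=> rgA lB my y0 pQ sQ eB.
have [lA nA _] := rgA; have rA := local_sub lA; have hMA := local_max lA.
have rB := local_sub lB; have hMB := local_max lB; have rK := blowup_subring A y.
have [d [x [mx fm ind val]]] := regular_params rgA.
pose t i := x i / y.
have ext_t (p : {mpoly F[d]}) n : p \is n.-homog -> p.@[x] = y ^+ n * p.@[t].
  move=> hp; rewrite -(form_scale _ _ hp); apply: meval_eq => i.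
  by rewrite /t mulrC divfK.
have Kt i : blowup A y (t i) by apply: blowup_div.
have AK : subp A (blowup A y) by exact: blowup_sub.
have KB : subp (blowup A y) B by rewrite eB; apply: loc_sub.
have Bt i : B (t i) by apply: KB.
have AB : subp A B by move=> a /AK /KB.
have mAB : subp (maxideal A) (maxideal B).
  by move=> a /sQ Qa; rewrite eB maxideal_loc //; apply: ext_sub.
(* The linear form of y itself. Multiplying by its powers brings forms to a common degree without
   changing their values at t. *)
have [Y fY eY] : exists2 Y : {mpoly F[d]}, form A 1 Y & Y.@[t] = 1.
  have [] := fm 1%N y; first by rewrite pow1.
  move=> Y fY eY; exists Y => //; have [_ hY] := fY.
  by apply: (mulfI y0); rewrite mulr1 -{1}[y]expr1 -ext_t.
have rep_K z : blowup A y z -> exists n (p : {mpoly F[d]}), form A n p /\ z = p.@[t].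
  move=> hz; apply: (hz (fun z => exists n (p : {mpoly F[d]}), form A n p /\ z = p.@[t])).
    split.
    - exists 0%N, 0; rewrite meval0; split=> //.
      by split; [apply: coefs_0 => _; mem|apply: dhomog0].
    - by exists 0%N, 1%:MP; rewrite mevalC; split=> //; apply: formC => //; mem.
    - move=> _ _ [n [p [hp ->]]] [k [q [hq ->]]].
      exists (n + k)%N, (p * Y ^+ k - q * Y ^+ n); split; last first.
        by rewrite mevalB !mevalM !rmorphXn /= eY !expr1n !mulr1.
      apply: formD => //; first by apply: formM => //; apply: formX1.
      by apply: formN => //; rewrite addnC; apply: formM => //; apply: formX1.
    - move=> _ _ [n [p [hp ->]]] [k [q [hq ->]]].
      by exists (n + k)%N, (p * q); rewrite mevalM; split=> //; apply: formM.
  move=> w [Aw|[u [mu ->]]].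
    by exists 0%N, w%:MP; rewrite mevalC; split=> //; apply: formC.
  have [] := fm 1%N u; first by rewrite pow1.
  move=> p hp eu; exists 1%N, p; split=> //; have [_ hp1] := hp.
  by rewrite eu (ext_t _ _ hp1) expr1 mulrAC divff // mul1r.
have formK n (p : {mpoly F[d]}) : form A n p -> blowup A y p.@[t].
  by move=> [op _]; apply: meval_sub => //; apply: over_sub op.
(* As a coefficient condition: over the residue field of B, no terms of degree below e. *)
pose c e n z := B z /\ ((n < e)%N -> maxideal B z).
have cD e n : addcl (c e n).
  split; first by split; [mem|move=> _; mem].
  move=> a b [Ba ha] [Bb hb]; split; first by mem.
  by move=> h; have ? := ha h; have ? := hb h; mem.
have cM e1 e2 n1 n2 a b : c e1 n1 a -> c e2 n2 b -> c (e1 + e2)%N (n1 + n2)%N (a * b).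
  move=> [Ba ha] [Bb hb]; split; first by mem.
  move=> h; case: (ltnP n1 e1) => h1; first by have ? := ha h1; mem.
  have ? : maxideal B b; last by mem.
  by apply: hb; rewrite ltnNge; apply: contraL h => h2; rewrite -leqNgt leq_add.
have oAB (p : {mpoly F[d]}) : over A p -> over B (shift t p).
  by move=> op; apply: (over_shift rB (ideal_top rB) Bt); apply: over_sub op.
have c0 (p : {mpoly F[d]}) : over B p -> coefs (c 0%N) p.
  by move=> op m; split; [exact: op|].
have cM0 e (p q : {mpoly F[d]}) : coefs (c e) p -> over B q -> coefs (c e) (p * q).
  by move=> hp /c0 hq; rewrite -[e]addn0; apply: (coefs_M (cD _) (cM e 0%N) hp hq).
(* Fractions whose numerator has order at least e at the center of B. They form an ideal of B that
   contains the e-th power of the maximal ideal. *)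
pose H e z := exists n (s k : {mpoly F[d]}), [/\ form A n s, form A n k, ~ maxideal B s.@[t],
  coefs (c e) (shift t k) & z = k.@[t] / s.@[t]].
have Hu n (s : {mpoly F[d]}) : form A n s -> ~ maxideal B s.@[t] ->
    [/\ B s.@[t], s.@[t] != 0 & B (s.@[t])^-1].
  by move=> fs ns; have Bs := KB _ (formK _ _ fs); have [] := not_max Bs ns.
have HM e1 e2 u v : H e1 u -> H e2 v -> H (e1 + e2)%N (u * v).
  move=> [n [s [k [fs fk ns ck ->]]]] [n' [s' [k' [fs' fk' ns' ck' ->]]]].
  exists (n + n')%N, (s * s'), (k * k'); split.
  - exact: formM.
  - exact: formM.
  - rewrite mevalM; have [Bs _ _] := Hu _ _ fs ns; have [Bs' _ _] := Hu _ _ fs' ns'.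
    exact: (prime_nM (max_prime lB)).
  - by rewrite shiftM; apply: (coefs_M (cD _) (cM e1 e2) ck ck').
  - by rewrite !mevalM invfM mulrACA.
have HD e u v : H e u -> H e v -> H e (u + v).
  move=> [n [s [k [fs fk ns ck ->]]]] [n' [s' [k' [fs' fk' ns' ck' ->]]]].
  have [Bs s0 _] := Hu _ _ fs ns; have [Bs' s0' _] := Hu _ _ fs' ns'.
  exists (n + n')%N, (s * s'), (k * s' + k' * s); split.
  - exact: formM.
  - by apply: formD => //; [apply: formM|rewrite addnC; apply: formM].
  - by rewrite mevalM; apply: (prime_nM (max_prime lB)).
  - rewrite shiftD !shiftM; have [os _] := fs; have [os' _] := fs'.
    by apply: coefs_D => //; apply: cM0 => //; apply: oAB.
  - by rewrite mevalD !mevalM; field; rewrite s0 s0'.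
have HB z : B z -> H 0%N z.
  rewrite {1}eB => -[a [b [Ka Kb nQb ez]]].
  have [n [k [fk ek]]] := rep_K _ Ka; have [n' [s [fs es]]] := rep_K _ Kb.
  exists (n + n')%N, (s * Y ^+ n), (k * Y ^+ n').
  have e1 : (s * Y ^+ n).@[t] = b by rewrite mevalM rmorphXn /= eY expr1n mulr1.
  have fk' : form A (n + n') (k * Y ^+ n') by apply: formM => //; apply: formX1.
  split=> //.
  - by rewrite addnC; apply: formM => //; apply: formX1.
  - rewrite e1 eB maxideal_loc // => h; apply: nQb.
    exact: (@ext_contract _ (blowup A y) Q Q).
  - by apply: c0; apply: oAB; case: fk'.
  - by rewrite e1 mevalM rmorphXn /= eY expr1n mulr1 -ek.
have Hm z : maxideal B z -> H 1%N z.
  move=> mz; have Bz : B z by case: mz.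
  have [n [s [k [fs fk ns ck e]]]] := HB z Bz; exists n, s, k; split=> //.
  have [Bs s0 _] := Hu _ _ fs ns.
  move=> m; split; first by case: (ck m).
  rewrite ltnS leqn0 mdeg_eq0 => /eqP ->; rewrite shift_coef0.
  by have -> : k.@[t] = z * s.@[t]; [rewrite e divfK|mem].
have Hid e : ideal B (H e).
  split.
  - move=> _ [n [s [k [fs fk ns ck ->]]]]; have [Bs s0 Bs'] := Hu _ _ fs ns.
    by have ? := KB _ (formK _ _ fk); mem.
  - exists 0%N, 1%:MP, 0; split.
    + by apply: formC => //; mem.
    + by split; [apply: coefs_0 => _; mem|apply: dhomog0].
    + by rewrite mevalC; apply: maxideal_n1.
    + by rewrite /shift comp_mpoly0; apply: coefs_0 => n; split; [mem|move=> _; mem].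
    + by rewrite meval0 mul0r.
  - exact: HD.
  - by move=> a z Ba Hz; have := HM _ _ _ _ (HB _ Ba) Hz; rewrite add0n.
have powH e : subp (pow_ideal B (maxideal B) e) (H e).
  elim: e => [|e IH] z; first exact: HB.
  move=> hz; apply: (hz (H e.+1)) => // _ [a [b [/IH Ha /Hm Hb ->]]].
  by have := HM _ _ _ _ Ha Hb; rewrite addn1.
move=> hf /powH [n [s [k [fs fk ns ck e]]]].
have [v fv ev] := fm r f hf; have [ov hv] := fv.
have [Bs s0 Bs'] := Hu _ _ fs ns.
have evt : v.@[t] = f / y ^+ r.
  by rewrite ev (ext_t _ _ hv) mulrAC divff ?mul1r // expf_neq0.
(* The forms v s and k Y^r take the same value at the parameters, so by independence their
   difference vanishes modulo the maximal ideal of A; hence v s inherits the order r.+1 of k. *)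
have fE : form A (r + n) (v * s - k * Y ^+ r).
  apply: formD => //; first exact: formM.
  by apply: formN => //; rewrite addnC; apply: formM => //; apply: formX1.
have E0 : (v * s - k * Y ^+ r).@[x] = 0.
  have [_ hE] := fE; rewrite (ext_t _ _ hE) mevalB !mevalM rmorphXn /= eY expr1n mulr1.
  by rewrite evt e divfK // subrr mulr0.
have oE := ind _ _ fE E0.
have oEs : over (maxideal B) (shift t (v * s - k * Y ^+ r)).
  by apply: (over_shift rB hMB Bt); apply: over_sub oE.
have prod : coefs (c r.+1) (shift t v * shift t s).
  have -> : shift t v * shift t s = shift t (v * s - k * Y ^+ r) + shift t k * shift t (Y ^+ r).
    by rewrite -!shiftM -shiftD subrK.
  apply: coefs_D => //; first by move=> m; have h := oEs m; split; [case: h|].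
  by apply: cM0 => //; apply: oAB; apply: over_Xn => //; case: fY.
have osv : over B (shift t v) by apply: oAB.
have oss : over B (shift t s) by apply: oAB; case: fs.
(* The expansion of s has the unit s(t) as constant term, so the factor s is cancelled one order at
   a time. *)
have key l : (l <= r.+1)%N -> coefs (c l) (shift t v).
  elim: l => [_|l IH hl]; first exact: c0.
  pose s1 := shift t s - (s.@[t])%:MP.
  have cs1 : coefs (c 1%N) s1.
    have os1 : over B s1 by apply: over_D => //; apply: over_N => //; apply: over_C.
    move=> m; split; first exact: os1.
    rewrite ltnS leqn0 mdeg_eq0 => /eqP ->.
    by rewrite mcoeffB shift_coef0 mcoeffC eqxx mulr1 subrr; mem.
  have -> : shift t v = (s.@[t])^-1 *: (shift t v * shift t s + - 1 *: (shift t v * s1)).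
    have -> : shift t v * shift t s + - 1 *: (shift t v * s1) = s.@[t] *: shift t v.
      by rewrite scaleN1r /s1 mulrBr opprB addrCA subrr addr0 mulrC mul_mpolyC.
    by rewrite scalerA mulVf // scale1r.
  have cZ e' a n0 b : B a -> c e' n0 b -> c e' n0 (a * b).
    by move=> Ba [Bb hb]; split; [mem|move=> /hb ?; mem].
  apply: (coefs_Z (c1 := c l.+1)); first by move=> n0 b; apply: cZ.
  apply: coefs_D => //.
    by move=> m; have [h1 h2] := prod m; split=> // h; apply: h2; apply: leq_trans hl.
  apply: (coefs_Z (c1 := c l.+1)); first by move=> n0 b; apply: cZ; mem.
  by rewrite -addn1; apply: (coefs_M (cD _) (cM l 1%N) (IH (ltnW hl)) cs1).
(* Degree at most r and order above r leave nothing; shifting back by -t carries this to v. *)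
have ov' : over (maxideal B) (shift t v).
  move=> m; case: (ltnP r (mdeg m)) => hm; last by have [_ h] := key _ (leqnn _) m; apply: h.
  by rewrite (deg_le_shift t hv hm); mem.
rewrite ev; apply: val => // m; have Am : A v@_m by exact: ov.
have mBm : maxideal B v@_m.
  have BtN i : B (- t i) by have ? := Bt i; mem.
  by have := over_shift rB hMB BtN ov'; rewrite shiftK; apply.
apply: NNPP => /(not_max Am) [nz Ai]; apply: (max_inv mBm nz); exact: AB.
Qed.

End Transform.

(** * The order valuation of a regular local ring *)

Section Order.
Variables (F : fieldType) (A : F -> Prop).
Hypothesis rgA : regular_local A.
Let lA : local A. Proof. by case: rgA. Qed.
Let rA : subring A. Proof. exact: local_sub lA. Qed.
Let fP := regular_filtr rgA.
Local Notation pw := (pow_ideal A (maxideal A)).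

Lemma pow_mul n k a b : pw n a -> pw k b -> pw (n + k) (a * b).
Proof. by case: fP => _ _ _ h; apply: h. Qed.

Lemma pow_le n k : (n <= k)%N -> subp (pw k) (pw n).
Proof. exact: filtr_le fP. Qed.

Lemma ord_ex a : A a -> a != 0 -> exists n, ord_val A a n.
Proof.
move=> Aa a0; have /not_all_ex_not [n hn] : ~ forall n, pw n a.
  by move=> h; move/eqP: a0; apply; apply: regular_cap h.
by have [u [_ h1 h2]] := filtr_ord fP Aa hn; exists u.
Qed.

Lemma ord_mul a b n k : ord_val A a n -> ord_val A b k -> ord_val A (a * b) (n + k).
Proof.
move=> [Aa a0 h1 h2] [Ab b0 h3 h4]; split; [mem|by rewrite mulf_neq0|exact: pow_mul|].
exact: (regular_mord rgA).
Qed.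

Lemma ord_pow a n k : ord_val A a n -> pw k a -> (k <= n)%N.
Proof. by move=> [_ _ _ h] hk; rewrite leqNgt; apply/negP => lt; apply: h; apply: pow_le hk. Qed.

Lemma ord_uniq a n k : ord_val A a n -> ord_val A a k -> n = k.
Proof.
move=> h1 h2; apply/eqP; rewrite eqn_leq; have [_ _ p1 _] := h1; have [_ _ p2 _] := h2.
by rewrite (ord_pow h2 p1) (ord_pow h1 p2).
Qed.

Lemma ord_unit a : A a -> a != 0 -> A a^-1 -> ord_val A a 0.
Proof. by move=> Aa a0 Ai; split=> //; rewrite pow1 // => h; apply: (max_inv h). Qed.

Lemma ord1 : ord_val A 1 0.
Proof. by apply: ord_unit; rewrite ?invr1 ?oner_eq0 //; mem. Qed.

(** A lower bound on the order of the numerator replaces its exact value, which also covers q =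
    0. *)
Lemma ord_ringP q : ord_ring A q <-> exists a b k, [/\ pw k a, ord_val A b k & q = a / b].
Proof.
split.
  move=> [->|[a [b [n [k [h1 h2 le ->]]]]]].
    by exists 0, 1, 0%N; split; [rewrite /=; mem|exact: ord1|rewrite mul0r].
  by exists a, b, k; split=> //; have [_ _ p1 _] := h1; apply: pow_le p1.
move=> [a [b [k [h1 h2 ->]]]]; have Aa : A a by apply: (idlS (pow_id k lA)).
case: (eqVneq a 0) => [->|a0]; first by left; rewrite mul0r.
right; have [n hn] := ord_ex Aa a0; exists a, b, n, k; split=> //.
exact: ord_pow hn h1.
Qed.

Lemma ord_ring_pow a b k : A a -> ord_val A b k -> ord_ring A (a / b) -> pw k a.
Proof.
move=> Aa hb /ord_ringP [c [d [j [hc hd e]]]].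
have [_ b0 _ _] := hb; have [_ d0 _ _] := hd.
case: (eqVneq a 0) => [->|a0]; first exact: idl0 (pow_id k lA).
have [n hn] := ord_ex Aa a0; have [_ _ pn _] := hn; apply: (pow_le _ pn).
have e1 : a * d = c * b.
  by apply: (mulIf (invr_neq0 b0)); rewrite mulrAC e mulfK // divfK.
have := ord_pow (ord_mul hn hd); rewrite e1 => /(_ (k + j)%N).
by rewrite leq_add2r; apply; rewrite addnC; apply: pow_mul => //; case: hb.
Qed.

Lemma ord_ring_subring : subring (ord_ring A).
Proof.
have hp n := pow_id n lA.
split.
- by left.
- by apply/ord_ringP; exists 1, 1, 0%N; split; [rewrite /=; mem|exact: ord1|rewrite divr1].
- move=> u v /ord_ringP [a [b [k [ha hb ->]]]] /ord_ringP [c [d [l [hc hd ->]]]].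
  have [_ b0 hb1 _] := hb; have [_ d0 hd1 _] := hd.
  apply/ord_ringP; exists (a * d - c * b), (b * d), (k + l)%N; split.
  + apply: (idlB rA (hp _)); first exact: pow_mul.
    by rewrite addnC; apply: pow_mul.
  + exact: ord_mul.
  + by field; rewrite b0 d0.
- move=> u v /ord_ringP [a [b [k [ha hb ->]]]] /ord_ringP [c [d [l [hc hd ->]]]].
  have [_ b0 hb1 _] := hb; have [_ d0 hd1 _] := hd.
  apply/ord_ringP; exists (a * c), (b * d), (k + l)%N; split; [exact: pow_mul|exact: ord_mul|].
  by field; rewrite b0 d0.
Qed.

Lemma ord_ring_sub : subp A (ord_ring A).
Proof.
move=> a Aa; apply/ord_ringP; exists a, 1, 0%N; rewrite divr1; split=> //.
exact: ord1.
Qed.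

Lemma ord_ring_max a : maxideal A a -> a != 0 -> ~ ord_ring A a^-1.
Proof.
move=> ma a0 h; have Aa : A a by case: ma.
have [n hn] := ord_ex Aa a0.
have := @ord_ring_pow 1 a n (sub1 rA) hn; rewrite mul1r => /(_ h).
have n1 : (0 < n)%N by apply: (ord_pow hn); rewrite pow1.
by move=> /(pow_le n1); rewrite pow1 //; apply: maxideal_n1.
Qed.

End Order.

(** * What a single quadratic transform provides *)

Section Step.
Variable F : fieldType.
Implicit Types (A B : F -> Prop).

(** The sequel works only with these properties. In [qs_frac] the denominator c has order exactly n
    and transform c / y^n a unit of B, which makes c exceptional in the sense of [excp]. *)
Record qstep A B (y : F) : Prop := Qstep {
  qs_max : maxideal A y;
  qs_n0 : y != 0;
  qs_n2 : ~ pow_ideal A (maxideal A) 2 y;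
  qs_sub : subp A B;
  qs_dom : subp (maxideal A) (maxideal B);
  qs_div : forall n w, pow_ideal A (maxideal A) n w -> B (w / y ^+ n);
  qs_frac : forall b, B b -> exists n a c, [/\ pow_ideal A (maxideal A) n a, ord_val A c n,
              B (c / y ^+ n)^-1 & b = a / c];
  qs_ord : forall r f, pow_ideal A (maxideal A) r f ->
             pow_ideal B (maxideal B) r.+1 (f / y ^+ r) -> pow_ideal A (maxideal A) r.+1 f }.

Lemma lqt_qstep A B : regular_local A -> regular_local B -> local_quadratic_transform A B ->
  exists y, qstep A B y.
Proof.
move=> rgA rgB [y [my ny [Q [pQ sQ /same_setE eB]]]]; exists y.
have [lA nA _] := rgA; have rA := local_sub lA; have hMA := local_max lA.
have [lB nB _] := rgB; have rB := local_sub lB; have hMB := local_max lB.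
have rK := blowup_subring A y; have hQ := prime_idl pQ.
have y0 : y != 0 by apply/eqP => y0; apply: ny; rewrite y0; apply: idl0 (pow_id 2 lA).
have KB : subp (blowup A y) B by rewrite eB; apply: loc_sub.
have AK := @blowup_sub _ A y.
have mB : maxideal B = ext (blowup A y) Q Q by rewrite eB maxideal_loc.
have Ky n w : pow_ideal A (maxideal A) n w -> blowup A y (w / y ^+ n).
  elim: n w => [|n IH] w; first by rewrite expr0 divr1; apply: AK.
  move=> hw; suff [] : A w /\ blowup A y (w / y ^+ n.+1) by [].
  apply: (hw (fun w => A w /\ blowup A y (w / y ^+ n.+1))).
    split.
    - by move=> z [].
    - by rewrite mul0r; split; mem.
    - by move=> u v [? ?] [? ?]; rewrite mulrDl; split; mem.
    - by move=> a u Aa [? ?]; have ? := AK a Aa; rewrite -mulrA; split; mem.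
  move=> _ [a [b [ha mb ->]]]; have Ab : A b by case: mb.
  have ? := idlS (pow_id n lA) ha; split; first by mem.
  have -> : a * b / y ^+ n.+1 = (a / y ^+ n) * (b / y) by rewrite exprSr invfM; ring.
  by have ? := IH _ ha; have ? := @blowup_div _ A y b mb; mem.
have repK z : blowup A y z -> exists n a, pow_ideal A (maxideal A) n a /\ z = a / y ^+ n.
  move=> hz; apply: (hz (fun z => exists n a, pow_ideal A (maxideal A) n a /\ z = a / y ^+ n)).
    have py n : pow_ideal A (maxideal A) n (y ^+ n).
      elim: n => [|n IH]; first by rewrite /= expr0; mem.
      by rewrite exprSr; apply: powS.
    have yn n := expf_neq0 n y0.
    split.
    - by exists 0%N, 0; rewrite mul0r /=; split=> //; mem.
    - by exists 0%N, 1; rewrite expr0 divr1 /=; split=> //; mem.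
    - move=> _ _ [n [a [ha ->]]] [k [b [hb ->]]].
      exists (n + k)%N, (a * y ^+ k - b * y ^+ n); split.
        apply: (idlB rA (pow_id _ lA)); first exact: pow_mul.
        by rewrite addnC; apply: pow_mul.
      by rewrite exprD; field; rewrite !yn.
    - move=> _ _ [n [a [ha ->]]] [k [b [hb ->]]].
      exists (n + k)%N, (a * b); split; first exact: pow_mul.
      by rewrite exprD; field; rewrite !yn.
  move=> w [Aw|[u [mu ->]]]; first by exists 0%N, w; rewrite expr0 divr1.
  by exists 1%N, u; rewrite pow1 // expr1.
have Qy : Q y by apply: sQ.
split=> //.
- by move=> a /AK /KB.
- by move=> a /sQ h; rewrite mB; apply: ext_sub.
- by move=> n w /Ky /KB.
- move=> b; rewrite eB => -[k [s [Kk Ks nQs ->]]].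
  have [n [a [ha ek]]] := repK _ Kk; have [l [c [hc es]]] := repK _ Ks.
  have s0 := prime_n0 pQ nQs; have yn j := expf_neq0 j y0.
  have c0 : c != 0 by apply: contra s0; rewrite es => /eqP ->; rewrite mul0r.
  have py j : pow_ideal A (maxideal A) j (y ^+ j).
    elim: j => [|j IH]; first by rewrite /= expr0; mem.
    by rewrite exprSr; apply: powS.
  have ec : c * y ^+ n / y ^+ (l + n) = s by rewrite es exprD; field; rewrite !yn.
  have hc' : pow_ideal A (maxideal A) (l + n) (c * y ^+ n) by apply: pow_mul.
  (* Powers of y equalize the exponents. The order of c y^n is exactly l + n, since otherwise c y^n
     / y^(l+n), which is outside Q, would be a multiple of y in the blowup. *)
  exists (l + n)%N, (a * y ^+ l), (c * y ^+ n); split.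
  + by rewrite addnC; apply: pow_mul.
  + split=> //; first exact: (idlS (pow_id _ lA) hc').
      by rewrite mulf_neq0.
    move=> /Ky h; apply: nQs; rewrite -ec.
    have -> : c * y ^+ n / y ^+ (l + n) = y * (c * y ^+ n / y ^+ (l + n).+1).
      by rewrite (exprS _ (l + n)); field; rewrite y0 yn.
    mem.
  + by rewrite ec; apply: loc_inv.
  + by rewrite ek es; field; rewrite !yn c0.
- by move=> r f; apply: (transform_order rgA lB my y0 pQ sQ eB).
Qed.

End Step.

(** * Recognizing discrete valuation rings *)

Section Dvr.
Variable F : fieldType.
Implicit Types (L S : F -> Prop).

(** The ideals generated by the s / p^n increase; where they become stationary, p would be
    invertible unless s = 0. *)
Lemma noeth_cap L p s : noetherian L -> L p -> p != 0 -> ~ L p^-1 ->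
  (forall n, L (s / p ^+ n)) -> s = 0.
Proof.
move=> nL Lp p0 np h; have rL : subring L by case: nL.
have hI n : ideal L (mulid (s / p ^+ n) L) by apply: ideal_mul => //; apply: ideal_top.
have [I [_ [n ->] _ mx]] := @noeth_max _ L (fun I => exists n, I = mulid (s / p ^+ n) L)
  _ nL (hI 0%N) (ex_intro _ 0%N erefl).
case: (eqVneq s 0) => // s0.
have : mulid (s / p ^+ n) L (s / p ^+ n.+1).
  rewrite -(mx _ (hI n.+1) (ex_intro _ n.+1 erefl)); first by exists 1; [mem|rewrite mulr1].
  by move=> _ [v Lv ->]; exists (p * v); [mem|rewrite exprSr invfM; field; rewrite p0 expf_neq0].
move=> [v Lv e]; case: np; suff -> : p^-1 = v by [].
have sn : s / p ^+ n != 0 by rewrite mulf_neq0 // invr_eq0 expf_neq0.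
by apply: (mulfI sn); rewrite -e exprS invfM; ring.
Qed.

(** Every nonzero element is a unit times a power of p, so a nonzero ideal is generated by an
    element of least exponent. *)
Lemma dvr_principal S p : subring S -> frac_field S -> S p -> p != 0 -> ~ S p^-1 ->
  (forall s, S s -> s != 0 -> S s^-1 \/ S (s / p)) ->
  (forall s, S s -> (forall n, S (s / p ^+ n)) -> s = 0) -> DVR S.
Proof.
move=> rS fS Sp p0 np hs cap; have pn n := expf_neq0 n p0.
have hord s : S s -> s != 0 -> exists n, S (s / p ^+ n) /\ S (p ^+ n / s).
  move=> Ss s0; have /not_all_ex_not [n hn] : ~ forall n, S (s / p ^+ n).
    by move=> h; move/eqP: s0; apply; apply: cap.
  elim: n hn => [|n IH]; first by rewrite expr0 divr1.
  case: (classic (S (s / p ^+ n))) => [h1 h2|/IH //].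
  exists n; split=> //; have u0 : s / p ^+ n != 0 by rewrite mulf_neq0 // invr_neq0.
  have [|h3] := hs _ h1 u0; first by rewrite invf_div.
  by case: h2; move: h3; rewrite exprSr invfM; congr S; ring.
split; last by exists p^-1.
  split=> // q q0; have [a [b [Sa Sb b0 e]]] := fS q.
  have a0 : a != 0 by apply: contra q0; rewrite e => /eqP ->; rewrite mul0r.
  have [n [h1 h2]] := hord a Sa a0; have [k [h3 h4]] := hord b Sb b0.
  case: (leqP k n) => [le|/ltnW le]; [left|right].
    have -> : q = (a / p ^+ n) * (p ^+ (n - k)) * (p ^+ k / b); last by mem.
    by rewrite e -{1}(subnK le) exprD; field; rewrite b0 !pn.
  have -> : q^-1 = (b / p ^+ k) * (p ^+ (k - n)) * (p ^+ n / a); last by mem.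
  by rewrite e -{1}(subnK le) exprD; field; rewrite a0 b0 !pn.
apply: fg_noeth => // I hI.
case: (classic (exists z, I z /\ z != 0)) => [[z [Iz z0]]|hno]; last first.
  exists [::]; split=> // z Iz /=; apply: NNPP => nz; apply: hno; exists z; split=> //.
  exact/eqP.
pose G n := exists z, [/\ I z, z != 0, S (z / p ^+ n) & S (p ^+ n / z)].
have [n [Gn mn]] : exists n, G n /\ forall k, G k -> (n <= k)%N.
  have [m Gm] : exists n, G n.
    by have [n [h1 h2]] := hord z (idlS hI Iz) z0; exists n, z.
  apply: NNPP => hno; elim/ltn_ind: m Gm => m IH Gm.
  apply: hno; exists m; split=> // k Gk; rewrite leqNgt; apply/negP => lt; exact: (IH k).
have [w [Iw w0 h1 h2]] := Gn; exists [:: w]; split; first by move=> g; rewrite inE => /eqP ->.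
move=> u Iu; have Su := idlS hI Iu; exists u, 0; rewrite addr0; split=> //.
exists (u / w); last by field.
case: (eqVneq u 0) => [->|u0]; first by rewrite mul0r; mem.
have [k [h3 h4]] := hord u Su u0.
have le : (n <= k)%N by apply: mn; exists u.
have -> : u / w = (u / p ^+ k) * (p ^+ (k - n)) * (p ^+ n / w); last by mem.
by rewrite -{1}(subnK le) exprD; field; rewrite w0 !pn.
Qed.

End Dvr.

(** * The union S of the sequence, exceptional elements, and the boundary valuation ring *)

Section Union.
Variables (F : fieldType) (Rs : nat -> F -> Prop) (y : nat -> F).
Hypothesis rg : forall i, regular_local (Rs i).
Hypothesis fr : forall i, frac_field (Rs i).
Hypothesis st : forall i, qstep (Rs i) (Rs i.+1) (y i).
Local Notation S := (union_seq Rs).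
Local Notation N := (union_max Rs).
Local Notation V := (boundary_valuation_ring Rs).

Let rR i : subring (Rs i). Proof. by case: (rg i) => lA _ _; exact: local_sub. Qed.
Let lR i : local (Rs i). Proof. by case: (rg i). Qed.
Let y0 i : y i != 0. Proof. exact: qs_n0 (st i). Qed.
Let yn i k : y i ^+ k != 0. Proof. exact: expf_neq0. Qed.

Lemma Rs_le i j : (i <= j)%N -> subp (Rs i) (Rs j).
Proof.
move=> /subnKC <-; elim: (j - i)%N => [|k IH] z; rewrite ?addn0 // addnS => /IH.
exact: (qs_sub (st _)).
Qed.

Lemma max_le i j : (i <= j)%N -> subp (maxideal (Rs i)) (maxideal (Rs j)).
Proof.
move=> /subnKC <-; elim: (j - i)%N => [|k IH] z; rewrite ?addn0 // addnS => /IH.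
exact: (qs_dom (st _)).
Qed.

Lemma union_subring : subring S.
Proof.
have two u v : S u -> S v -> exists i, Rs i u /\ Rs i v.
  move=> [i hi] [j hj]; exists (maxn i j).
  by split; [apply: (Rs_le (leq_maxl i j))|apply: (Rs_le (leq_maxr i j))].
split.
- by exists 0%N; have h := rR 0; mem.
- by exists 0%N; have h := rR 0; mem.
- by move=> u v hu hv; have [i [? ?]] := two u v hu hv; exists i; have h := rR i; mem.
- by move=> u v hu hv; have [i [? ?]] := two u v hu hv; exists i; have h := rR i; mem.
Qed.
Let rS := union_subring.

Lemma union_max_sub : subp N S. Proof. by move=> z [i []]; exists i. Qed.

Lemma union_max_ideal : ideal S N.
Proof.
split.
- exact: union_max_sub.
- by exists 0%N; apply: idl0 (local_max (lR 0)).
- move=> u v [i hi] [j hj]; exists (maxn i j); apply: (idlD (local_max (lR _))).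
    exact: (max_le (leq_maxl i j)).
  exact: (max_le (leq_maxr i j)).
- move=> a u [i hi] [j hj]; exists (maxn i j); apply: (idlM (local_max (lR _))).
    exact: (Rs_le (leq_maxl i j)).
  exact: (max_le (leq_maxr i j)).
Qed.
Let hN := union_max_ideal.

Lemma union_unit s : S s -> ~ N s -> s != 0 /\ S s^-1.
Proof.
move=> [i hs] ns; have [|s0 h] := @not_max _ (Rs i) s hs; first by move=> h; apply: ns; exists i.
by split=> //; exists i.
Qed.

Lemma union_max_inv z : N z -> z != 0 -> ~ S z^-1.
Proof.
move=> [i hz] z0 [j hj]; apply: (max_inv (max_le (leq_maxl i j) hz) z0).
exact: (Rs_le (leq_maxr i j)).
Qed.

Lemma maxideal_union : maxideal S = N.
Proof.
apply: subp_anti => z.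
  move=> [Sz h]; apply: NNPP => nz; have [z0 h'] := union_unit Sz nz.
  by case: h => // e; rewrite e eqxx in z0.
move=> Nz; split; first exact: union_max_sub.
by case: (eqVneq z 0) => [|z0]; [left|right; apply: union_max_inv].
Qed.

Lemma y_max i : maxideal (Rs i) (y i). Proof. exact: qs_max (st i). Qed.

Lemma union_max_y i : N (y i). Proof. by exists i; apply: y_max. Qed.

Lemma max_div_y i z : maxideal (Rs i) z -> Rs i.+1 (z / y i).
Proof. by move=> h; have := @qs_div _ _ _ _ (st i) 1 z; rewrite expr1 pow1 //; apply. Qed.

Lemma union_div_y z : N z -> exists i0, forall i, (i0 <= i)%N -> S (z / y i).
Proof.
move=> [i0 hz]; exists i0 => i le; exists i.+1; apply: max_div_y; exact: (max_le le).
Qed.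

Lemma ord_y i : ord_val (Rs i) (y i) 1.
Proof.
have h := y_max i; split; [by case: h|exact: y0| |exact: qs_n2 (st i)].
by rewrite pow1.
Qed.

(** * Elements whose iterated transform becomes a unit *)

Inductive excp : nat -> F -> Prop :=
| excp_unit n d : Rs n d -> d != 0 -> Rs n d^-1 -> excp n d
| excp_step n d k : ord_val (Rs n) d k -> excp n.+1 (d / y n ^+ k) -> excp n d.

Lemma excp_sub n d : excp n d -> Rs n d /\ d != 0.
Proof. by case=> // {}n {}d k [h1 h2 _ _] _. Qed.

Lemma ord_div n d k : ord_val (Rs n) d k -> Rs n.+1 (d / y n ^+ k).
Proof. by move=> [_ _ h _]; apply: (qs_div (st n)). Qed.

(** Orders add, so the transform of a product is the product of the transforms, until it becomes a
    unit and so do its factors. *)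
Lemma excp_dvd n c : excp n c -> forall a b, Rs n a -> Rs n b -> c = a * b -> excp n a /\ excp n b.
Proof.
elim=> {n c} [n d Rd d0 Rd'|n d k od _ IH] a b Ra Rb e.
  have h := rR n; move: (d0); rewrite e mulf_eq0 negb_or => /andP [a0 b0].
  split; apply: excp_unit => //.
    by have -> : a^-1 = b * d^-1; [rewrite e; field; rewrite a0 b0|mem].
  by have -> : b^-1 = a * d^-1; [rewrite e; field; rewrite a0 b0|mem].
have [_ d0 _ _] := od; move: (d0); rewrite e mulf_eq0 negb_or => /andP [a0 b0].
have [i oa] := ord_ex (rg n) Ra a0; have [j ob] := ord_ex (rg n) Rb b0.
have ek : k = (i + j)%N by apply: (ord_uniq (rg n) od); rewrite e; apply: (ord_mul (rg n)).
have [] := IH (a / y n ^+ i) (b / y n ^+ j) (ord_div oa) (ord_div ob).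
  by rewrite e ek exprD; field; rewrite !yn.
by move=> ha hb; split; [apply: excp_step ha|apply: excp_step hb].
Qed.

Lemma excp_next n d k : excp n d -> ord_val (Rs n) d k -> excp n.+1 (d / y n ^+ k).
Proof.
case=> {n d} [n d Rd d0 Rd'|n d j od h] ok; last by rewrite (ord_uniq (rg n) ok od).
rewrite (ord_uniq (rg n) ok (ord_unit (rg n) Rd d0 Rd')) expr0 divr1.
by apply: excp_unit => //; apply: (qs_sub (st n)).
Qed.

Lemma excp_mul_unit n b : excp n b -> forall a, Rs n a -> a != 0 -> Rs n a^-1 -> excp n (a * b).
Proof.
elim=> {n b} [n d Rd d0 Rd'|n d k od _ IH] a Ra a0 Ra'; have h := rR n.
  by apply: excp_unit; [mem|rewrite mulf_neq0|rewrite invfM; mem].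
apply: (@excp_step n _ k); last by rewrite -mulrA; apply: IH => //; apply: (qs_sub (st n)).
by rewrite -[k]add0n; apply: (ord_mul (rg n)) => //; apply: ord_unit.
Qed.

Lemma excp_mul n a b : excp n a -> excp n b -> excp n (a * b).
Proof.
move=> ha; elim: ha b => {n a} [n d Rd d0 Rd'|n d k od _ IH] b hb; first exact: excp_mul_unit.
have [Rb b0] := excp_sub hb; have [j ob] := ord_ex (rg n) Rb b0.
apply: (excp_step (ord_mul (rg n) od ob)).
have -> : d * b / y n ^+ (k + j) = (d / y n ^+ k) * (b / y n ^+ j).
  by rewrite exprD; field; rewrite !yn.
by apply: IH; apply: excp_next.
Qed.

Lemma excp1 n : excp n 1.
Proof. by have h := rR n; apply: excp_unit; rewrite ?oner_eq0 ?invr1 //; mem. Qed.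

Lemma excpX n a k : excp n a -> excp n (a ^+ k).
Proof.
move=> h; elim: k => [|k IH]; first by rewrite expr0; apply: excp1.
by rewrite exprS; apply: excp_mul.
Qed.

Lemma excp_y n : excp n (y n).
Proof. by apply: (excp_step (ord_y n)); rewrite expr1 divff //; apply: excp1. Qed.

Lemma excp_frac n b : Rs n.+1 b -> exists k a c, [/\ pow_ideal (Rs n) (maxideal (Rs n)) k a,
  ord_val (Rs n) c k, Rs n.+1 (c / y n ^+ k)^-1, excp n c & b = a / c].
Proof.
move=> /(qs_frac (st n)) [k [a [c [ha hc hu ->]]]]; exists k, a, c; split=> //.
apply: (excp_step hc); apply: excp_unit => //; first exact: ord_div.
by have [_ c0 _ _] := hc; rewrite mulf_neq0 // invr_neq0.
Qed.

(** For d = a / c as in [excp_frac], the transform of a divides d times the unit c / y^k, so a is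
    exceptional too. *)
Lemma excp_pull n d : excp n.+1 d -> exists d' e, [/\ excp n d', excp n e & d = d' / e].
Proof.
move=> hd; have [Rd d0] := excp_sub hd.
have [k [a [c [ha oc hu hc e]]]] := excp_frac Rd.
exists a, c; split=> //; have [_ c0 _ _] := oc.
have a0 : a != 0 by apply: contra d0; rewrite e => /eqP ->; rewrite mul0r.
have Ra := idlS (pow_id _ (lR n)) ha; have [l oa] := ord_ex (rg n) Ra a0.
apply: (excp_step oa).
have u0 : c / y n ^+ k != 0 by rewrite mulf_neq0 // invr_neq0.
have := excp_mul_unit hd (ord_div oc) u0 hu.
have le := ord_pow (rg n) oa ha.
have Ry : Rs n.+1 (y n ^+ (l - k)).
  have h := rR n.+1; apply: (subX _ h); apply: (qs_sub (st n)); by case: (ord_y n).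
move=> /excp_dvd /(_ _ _ (ord_div oa) Ry) [] //.
by rewrite e -{1}(subnK le) exprD; field; rewrite c0 !yn.
Qed.

Lemma excp_loc m n s : Rs (n + m) s -> exists a c, [/\ Rs n a, excp n c & s = a / c].
Proof.
elim: m n s => [|m IH] n s.
  by rewrite addn0 => Rs_s; exists s, 1; rewrite divr1; split=> //; apply: excp1.
rewrite addnS -addSn => /IH [a [c [/excp_frac [k [a' [e [ha' _ _ he ->]]]] hc ->]]].
have [c' [e' [hc' he' ->]]] := excp_pull hc.
have Ra' := idlS (pow_id _ (lR n)) ha'.
have [Re e0] := excp_sub he; have [Re' e0'] := excp_sub he'; have [_ c0] := excp_sub hc'.
exists (a' * e'), (e * c'); split; [by have h := rR n; mem|exact: excp_mul|].
by field; rewrite e0 e0' c0.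
Qed.

Lemma union_loc n s : S s -> exists a c, [/\ Rs n a, excp n c & s = a / c].
Proof.
by move=> [i hi]; apply: (@excp_loc i n); apply: Rs_le hi; rewrite leq_addl.
Qed.

(** Writing s = a / c brings the relation down to f a = y^k c in [Rs n], where the right side is
    exceptional. *)
Lemma excp_of_dvd n f s k : Rs n f -> S s -> y n ^+ k = f * s -> excp n f.
Proof.
move=> Rf /(@union_loc n) [a [c [Ra hc ->]]] e; have [_ c0] := excp_sub hc.
have := excp_mul hc (excpX k (excp_y n)).
move=> /excp_dvd /(_ f a Rf Ra) [] //.
by rewrite e; field.
Qed.

(** At stage n the order of a is at least that of h, so both can be divided by the same power of y
    n; this continues until h has become a unit. *)
Lemma excp_boundary n h : excp n h -> forall a, Rs n a ->
  (forall i, (n <= i)%N -> ord_ring (Rs i) (a / h)) -> S (a / h).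
Proof.
elim=> {n h} [n d Rd d0 Rd'|n d k od _ IH] a Ra hq; first by exists n; have h := rR n; mem.
have [_ d0 _ _] := od.
have := ord_ring_pow (rg n) Ra od (hq n (leqnn n)) => /(qs_div (st n)) Ra'.
have e : a / d = (a / y n ^+ k) / (d / y n ^+ k) by field; rewrite d0 yn.
rewrite e; apply: IH => // i le; rewrite -e; apply: hq; exact: ltnW.
Qed.

(** * The boundary valuation ring *)

Lemma boundary_subring : subring V.
Proof.
have two u v : V u -> V v -> exists i0, forall i, (i0 <= i)%N -> ord_ring (Rs i) u /\ ord_ring (Rs i) v.
  move=> [i hi] [j hj]; exists (maxn i j) => k; rewrite geq_max => /andP [h1 h2].
  by split; [apply: hi|apply: hj].
split.
- by exists 0%N => i _; have h := ord_ring_subring (rg i); mem.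
- by exists 0%N => i _; have h := ord_ring_subring (rg i); mem.
- move=> u v hu hv; have [i0 h0] := two u v hu hv; exists i0 => i /h0 [? ?].
  by have h := ord_ring_subring (rg i); mem.
- move=> u v hu hv; have [i0 h0] := two u v hu hv; exists i0 => i /h0 [? ?].
  by have h := ord_ring_subring (rg i); mem.
Qed.
Let rV := boundary_subring.

Lemma boundary_sub : subp S V.
Proof. by move=> s [i hs]; exists i => j le; apply: ord_ring_sub => //; apply: Rs_le hs. Qed.

Lemma boundary_max z : N z -> z != 0 -> ~ V z^-1.
Proof.
move=> [i hz] z0 [j hj].
apply: (ord_ring_max (rg (maxn i j)) (max_le (leq_maxl i j) hz) z0); apply: hj; exact: leq_maxr.
Qed.

(* The minimum of the orders of [f] and [g] cannot increase when both are divided by the same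
   power of [y n]; once it is stable, the element attaining it attains it forever. *)
Lemma boundary_total_aux r : forall n f g k, f != 0 -> (k <= r)%N -> ord_val (Rs n) g k ->
  pow_ideal (Rs n) (maxideal (Rs n)) k f -> V (f / g) \/ V (g / f).
Proof.
elim/ltn_ind: r => r IHr n f g k f0 le og pf; apply: NNPP => hno.
have [_ g0 _ _] := og.
suff good m : exists f' g', [/\ ord_val (Rs (n + m)) g' k,
    pow_ideal (Rs (n + m)) (maxideal (Rs (n + m))) k f' & f' / g' = f / g].
  apply: hno; left; exists n => i /subnKC <-; have [f' [g' [og' pf' <-]]] := good (i - n)%N.
  by apply/ord_ringP => //; exists f', g', k.
elim: m => [|m [f' [g' [og' pf' e]]]]; first by exists f, g; rewrite addn0.
rewrite addnS; set i := (n + m)%N in og' pf' *.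
have [_ g0' pg' ng'] := og'.
have f0' : f' != 0.
  by apply: contra_neq f0 => e0; move: e; rewrite e0 mul0r => /esym/eqP;
     rewrite mulf_eq0 invr_eq0 (negbTE g0) orbF => /eqP.
pose f1 := f' / y i ^+ k; pose g1 := g' / y i ^+ k.
have Rf1 : Rs i.+1 f1 by apply: (qs_div (st i)).
have Rg1 : Rs i.+1 g1 by apply: (qs_div (st i)).
have f10 : f1 != 0 by rewrite mulf_neq0 // invr_neq0.
have g10 : g1 != 0 by rewrite mulf_neq0 // invr_neq0.
have e1 : f1 / g1 = f / g by rewrite -e /f1 /g1; field; rewrite g0' yn.
have e2 : g1 / f1 = g / f by rewrite -[LHS]invf_div e1 invf_div.
have [k1 og1] := ord_ex (rg i.+1) Rg1 g10; have [l1 of1] := ord_ex (rg i.+1) Rf1 f10.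
have lek : (k1 <= k)%N.
  rewrite leqNgt; apply/negP => lt; apply: ng'; apply: (qs_ord (st i) pg').
  by have [_ _ h _] := og1; apply: (pow_le (rg i.+1) lt h).
case: (leqP k1 l1) => hl.
  have pf1 : pow_ideal (Rs i.+1) (maxideal (Rs i.+1)) k1 f1.
    by have [_ _ h _] := of1; apply: (pow_le (rg i.+1) hl h).
  case: (ltngtP k1 k) lek => // [lt _|ek _]; last by rewrite -ek; exists f1, g1.
  case: hno; rewrite -e1 -e2.
  by apply: (IHr k1 (leq_trans lt le) i.+1 f1 g1 k1).
case: hno; rewrite -e1 -e2 or_comm.
apply: (IHr l1 _ i.+1 g1 f1 l1) => //; first exact: leq_trans hl (leq_trans lek le).
by have [_ _ h _] := og1; apply: (pow_le (rg i.+1) (ltnW hl) h).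
Qed.

Lemma boundary_total q : q != 0 -> V q \/ V q^-1.
Proof.
move=> q0; have [a [b [Ra Rb b0 e]]] := fr 0 q.
have a0 : a != 0 by apply: contra q0; rewrite e => /eqP ->; rewrite mul0r.
have [i oa] := ord_ex (rg 0) Ra a0; have [j ob] := ord_ex (rg 0) Rb b0.
have [_ _ pa _] := oa; have [_ _ pb _] := ob.
rewrite e invf_div; case: (leqP j i) => h.
  by apply: (boundary_total_aux a0 (leqnn j) ob); apply: (pow_le (rg 0) h).
apply/or_comm; apply: (boundary_total_aux b0 (leqnn i) oa).
by apply: (pow_le (rg 0) (ltnW h)).
Qed.

End Union.

(** * Archimedean unions: N = N^2, the hull, and the rank one valuation ring *)

Section Archimedean.
Variables (F : fieldType) (Rs : nat -> F -> Prop) (y : nat -> F) (x : F).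
Hypothesis rg : forall i, regular_local (Rs i).
Hypothesis fr : forall i, frac_field (Rs i).
Hypothesis st : forall i, qstep (Rs i) (Rs i.+1) (y i).
Local Notation S := (union_seq Rs).
Local Notation N := (union_max Rs).
Local Notation V := (boundary_valuation_ring Rs).
Local Notation T := (noetherian_hull S).
Hypothesis Sx : S x.
Hypothesis radx : same_set (radical S (principal S x)) N.
Hypothesis arch : archimedean S.
Hypothesis ndvr : ~ DVR S.

Let rR i : subring (Rs i). Proof. by case: (rg i) => lA _ _; exact: local_sub. Qed.
Let rS : subring S := union_subring rg st.
Let hN : ideal S N := union_max_ideal rg st.
Let rV : subring V := boundary_subring rg.
Let SV : subp S V := boundary_sub rg st.
Let y0 i : y i != 0. Proof. exact: qs_n0 (st i). Qed.

Lemma Nx : N x.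
Proof. by apply/radx; split=> //; exists 1%N, 1; split; [mem|rewrite mulr1]. Qed.

Lemma rad_x z : N z -> exists k s, S s /\ z ^+ k = x * s.
Proof. by move=> /radx [_ [k [s [Ss e]]]]; exists k, s. Qed.

Lemma x0 : x != 0.
Proof.
apply/eqP => ex; have [k [s [_]]] := rad_x (union_max_y st 0).
by rewrite ex mul0r => /eqP; rewrite expf_eq0 (negbTE (y0 0)) andbF.
Qed.
Let xn k : x ^+ k != 0. Proof. exact: expf_neq0 x0. Qed.

(** In S, x divides a power of each y n, and y n is exceptional. *)
Lemma excp_x : exists n0, forall n, (n0 <= n)%N -> maxideal (Rs n) x /\ excp Rs y n x.
Proof.
have [n0 h0] := Nx; exists n0 => n le; have hn := max_le st le h0; split=> //.
have [k [s [Ss e]]] := rad_x (union_max_y st n).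
by apply: (excp_of_dvd rg st _ Ss e); case: hn.
Qed.

(** Each transform removes a power of some y n, and y n divides x in S as soon as x lies in the
    maximal ideal of that stage. *)
Lemma excp_dvd_x n d : maxideal (Rs n) x -> excp Rs y n d -> exists k s, S s /\ x ^+ k = d * s.
Proof.
move=> mx hd; elim: hd mx => {n d} [n d Rd d0 Rd'|n d k od _ IH] mx.
  by exists 0%N, d^-1; rewrite expr0 divff //; split=> //; exists n.
have [j [s [Ss e]]] := IH (qs_dom (st n) mx).
have Sq : S (x / y n) by exists n.+1; apply: (max_div_y rg st).
exists (k + j)%N, ((x / y n) ^+ k * s); split; first by mem.
rewrite exprD e exprMn exprVn; field; exact: expf_neq0.
Qed.

(** V meets S[1/x] in S: at a late stage q has a power of x as denominator, which is exceptional,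
    and [excp_boundary] applies. *)
Lemma boundary_cap_inv q k : V q -> S (x ^+ k * q) -> S q.
Proof.
move=> [i0 hq] [j hj]; have [n0 h0] := excp_x.
pose n := (maxn i0 (maxn j n0)).
have [l1 l2 l3] : [/\ (i0 <= n)%N, (j <= n)%N & (n0 <= n)%N].
  by split; rewrite /n ?leq_maxl // !leq_max leqnn ?orbT.
have [_ hx] := h0 n l3.
have e : q = (x ^+ k * q) / x ^+ k by rewrite mulrC mulKf.
rewrite e; apply: (excp_boundary rg st (excpX rg st k hx)); first exact: (Rs_le st l2).
by move=> i le; rewrite -e; apply: hq; apply: leq_trans le.
Qed.

Lemma union_frac : frac_field S.
Proof. by move=> q; have [a [b [Ra Rb b0 e]]] := fr 0 q; exists a, b; split=> //; exists 0%N. Qed.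

(* If all late [y j] were associates then [N] would be principal and [S] a DVR. *)
Lemma y_not_associate i0 : exists2 j, (i0 <= j)%N & N (y j / y j.+1).
Proof.
apply: NNPP => hno.
have Sq j : S (y j / y j.+1).
  by exists j.+2; apply: (max_div_y rg st); apply: (qs_dom (st j)); apply: (y_max st).
have un j : (i0 <= j)%N -> S (y j.+1 / y j).
  move=> le; have [|_] := union_unit (Sq j); last by rewrite invf_div.
  by move=> h; apply: hno; exists j.
have un' k : S (y (i0 + k)%N / y i0).
  elim: k => [|k IH]; first by rewrite addn0 divff //; mem.
  rewrite addnS; have -> : y (i0 + k).+1 / y i0 =
    (y (i0 + k).+1 / y (i0 + k)%N) * (y (i0 + k)%N / y i0) by field; rewrite !y0.
  by have ? := un (i0 + k)%N (leq_addr _ _); mem.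
have Nd z : N z -> S (z / y i0).
  move=> /(union_div_y rg st) [i1 h1]; have h := h1 _ (leq_addl i0 i1).
  have -> : z / y i0 = (z / y (i0 + i1)%N) * (y (i0 + i1)%N / y i0) by field; rewrite !y0.
  by have ? := un' i1; mem.
apply: ndvr; have Ny := union_max_y st i0.
apply: (@dvr_principal _ S (y i0)) => //.
- exact: union_frac.
- exact: union_max_sub.
- exact: (union_max_inv st Ny).
- move=> s Ss s0; case: (classic (N s)) => [/Nd|/(union_unit Ss) []]; [by right|by left].
- move=> s Ss h; apply: (arch (a := y i0)); first by rewrite (maxideal_union st).
  by move=> n _; exists (s / y i0 ^+ n); split=> //; field; exact: expf_neq0.
Qed.

(** This is N = N^2 with one element w. For a suitable j, z is a multiple of y j, which is the
    product of y j / y j.+1 and y j.+1, both in N; a late y i divides both factors. *)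
Lemma N_square z : N z -> exists w, [/\ N w, w != 0 & S (z / w ^+ 2)].
Proof.
move=> /(union_div_y rg st) [i1 h1]; have [j le Nj] := y_not_associate i1.
have [i2 h2] := union_div_y rg st Nj; have [i3 h3] := union_div_y rg st (union_max_y st j.+1).
exists (y (i2 + i3)%N); split; [exact: (union_max_y st)|exact: y0|].
have H1 := h1 j le; have H2 := h2 _ (leq_addr i3 i2); have H3 := h3 _ (leq_addl i2 i3).
have -> : z / y (i2 + i3)%N ^+ 2 = (z / y j) * (y j / y j.+1 / y (i2 + i3)%N) * (y j.+1 / y (i2 + i3)%N).
  by field; rewrite !y0.
mem.
Qed.

Lemma hull_subring : subring T.
Proof.
split.
- by move=> B [[rB _] _ _] _; mem.
- by move=> B [[rB _] _ _] _; mem.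
- by move=> u v hu hv B dB sB; have ? := hu B dB sB; have ? := hv B dB sB; case: dB => [[rB _] _ _]; mem.
- by move=> u v hu hv B dB sB; have ? := hu B dB sB; have ? := hv B dB sB; case: dB => [[rB _] _ _]; mem.
Qed.

Lemma hull_sub : subp S T.
Proof. by move=> s Ss B _ [sB _]; apply: sB. Qed.

(* By [N = N^2], the values of [N] in a discrete valuation ring have no positive minimum. *)
Lemma hull_inv_x : T x^-1.
Proof.
move=> B [[rB vB] nB _] [sSB _]; apply: NNPP => nx.
have nz z : N z -> z != 0 -> ~ B z^-1.
  move=> Nz z0 Bz; have [k [s [Ss e]]] := rad_x Nz; apply: nx.
  have -> : x^-1 = s * z^-1 ^+ k.
    by rewrite exprVn e invfM mulrCA divff ?mulr1 //; apply: contraTneq (expf_neq0 k z0) => s0; rewrite e s0 mulr0 eqxx.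
  by have ? := sSB _ Ss; mem.
have BN z : N z -> B z by move=> /union_max_sub /sSB.
have hI z : N z -> ideal B (mulid z B) by move=> Nz; apply: ideal_mul => //; [exact: BN|exact: ideal_top].
have [I [_ [z [Nz z0 ->]] _ mx]] := @noeth_max _ B (fun I => exists z, [/\ N z, z != 0 & I = mulid z B])
  _ nB (hI x Nx) (ex_intro _ x (And3 Nx x0 erefl)).
have [w [Nw w0 /sSB Bs]] := N_square Nz.
have : mulid z B w.
  rewrite -(mx _ (hI w Nw)); [by exists 1; [mem|rewrite mulr1]|by exists w|].
  move=> _ [v Bv ->]; exists (w * (z / w ^+ 2) * v); last by field.
  by have ? := BN w Nw; mem.
move=> [v Bv e]; apply: (nz w Nw w0).
have -> : w^-1 = (z / w ^+ 2) * v; last by mem.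
by rewrite mulrAC -e; field.
Qed.

(** A power of w is a multiple of x, so otherwise all a / x^n would be in V, hence in S by
    [boundary_cap_inv], contradicting the archimedean property. *)
Lemma not_inf_divisible a w : S a -> a != 0 -> N w -> w != 0 -> exists k, ~ V (a / w ^+ k).
Proof.
move=> Sa a0 Nw w0; apply: NNPP => /not_ex_all_not hno.
have hV k : V (a / w ^+ k) by apply: NNPP; apply: hno.
move/eqP: a0; apply; apply: (arch (a := x)); first by rewrite (maxideal_union st); exact: Nx.
move=> n _; exists (a / x ^+ n); split; last by rewrite mulrC divfK.
apply: (@boundary_cap_inv _ n); last by rewrite mulrC divfK.
have [j [s [Ss e]]] := rad_x Nw; have Vs := SV Ss.
have s0 : s != 0 by apply: contraTneq (expf_neq0 j w0) => s0; rewrite e s0 mulr0 eqxx.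
have -> : a / x ^+ n = (a / w ^+ (j * n)) * s ^+ n.
  by rewrite exprM e exprMn; field; rewrite xn expf_neq0.
by have ? := hV (j * n)%N; mem.
Qed.

Lemma not_inf_divisibleF q w : q != 0 -> N w -> w != 0 -> exists k, ~ V (q / w ^+ k).
Proof.
move=> q0 Nw w0; have [a [b [Sa Sb b0 e]]] := union_frac q.
have a0 : a != 0 by apply: contra q0; rewrite e => /eqP ->; rewrite mul0r.
have [k hk] := not_inf_divisible Sa a0 Nw w0; exists k => h; apply: hk.
have -> : a / w ^+ k = (q / w ^+ k) * b by rewrite e; field; rewrite b0 expf_neq0.
by have ? := SV Sb; mem.
Qed.

(** * The Noetherian hull is [S[1/x]] *)

Definition Sx1 : F -> Prop := fun q => exists k, S (x ^+ k * q).

Lemma Sx1_subring : subring Sx1.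
Proof.
split.
- by exists 0%N; rewrite mulr0; mem.
- by exists 0%N; rewrite mulr1 expr0; mem.
- move=> u v [k hu] [l hv]; exists (k + l)%N.
  have -> : x ^+ (k + l) * (u - v) = x ^+ l * (x ^+ k * u) - x ^+ k * (x ^+ l * v).
    by rewrite exprD; ring.
  mem.
- move=> u v [k hu] [l hv]; exists (k + l)%N.
  have -> : x ^+ (k + l) * (u * v) = (x ^+ k * u) * (x ^+ l * v) by rewrite exprD; ring.
  mem.
Qed.

Lemma Sx1_sub : subp S Sx1. Proof. by move=> s Ss; exists 0%N; rewrite expr0 mul1r. Qed.

(* Otherwise [1/b] has an associated prime [p] in the complement of the exceptional elements,
   and the localization at [p] is a DVR properly containing [S] in which [b] is not a unit. *)
Lemma hull_unit b : S b -> b != 0 -> T b^-1 -> Sx1 b^-1.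
Proof.
move=> [ib Rb] b0 Tb; apply: NNPP => nSb; have rT' := Sx1_subring.
have [n0 h0] := excp_x; pose n := maxn ib n0.
have [mx hx] := h0 n (leq_maxr _ _); have {}Rb : Rs n b := Rs_le st (leq_maxl _ _) Rb.
pose A := Rs n; have rA : subring A := rR n; have [lA nA _] := rg n.
have AS : subp A S by move=> a Aa; exists n.
have ST' := Sx1_sub.
have [a [Aa nt pP]] := @assoc_prime _ A Sx1 b^-1 nA (sub0 rT') (fun u v => @subD _ _ u v rT')
  (fun c u Ac hu => subM rT' (ST' _ (AS _ Ac)) hu) nSb.
set th := a * b^-1 in nt pP; set p := (fun b0 : F => _) in pP.
have hp := prime_idl pP; pose L := loc A p.
have rL : subring L := loc_subring rA pP; have nL : noetherian L := loc_noeth nA pP.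
have lL : local L := loc_local rA pP.
have AL : subp A L := loc_sub rA pP.
have pb : p b by split=> //; rewrite /th mulrCA divff // mulr1; apply: ST'; apply: AS.
(* Exceptional elements divide powers of x in S, so they are units of S[1/x] and cannot kill the
   nonzero class of [th]. *)
have np d : excp Rs y n d -> ~ p d.
  move=> hd [_ hT]; apply: nt; have [k [s [Ss e]]] := excp_dvd_x mx hd.
  have [j Sj] := hT; exists (k + j)%N.
  have -> : x ^+ (k + j) * th = s * (x ^+ j * (d * th)) by rewrite exprD e; ring.
  mem.
have SL : subp S L.
  move=> s /(union_loc rg st n) [c [d [Rc hd ->]]]; have [Rd d0] := excp_sub hd.
  by exists c, d; split=> //; apply: np.
have Lx : L x^-1 by apply: loc_inv => //; [case: mx|apply: np].
have T'L : subp Sx1 L.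
  move=> q [k /SL Lq]; have -> : q = (x^-1) ^+ k * (x ^+ k * q) by rewrite exprVn mulKf.
  mem.
have th0 : th != 0 by apply/eqP => e; apply: nt; rewrite e; mem.
have Lpth u : p u -> L (u * th) by move=> [_ /T'L].
have nLth : ~ L th.
  move=> [g [e [Ag Ae ne eth]]]; apply: ne; split=> //.
  have e0 : e != 0 by apply/eqP => e0; apply: nt; rewrite eth e0 invr0 mulr0; mem.
  by rewrite eth mulrCA divff // mulr1; apply: ST'; apply: AS.
(* Otherwise, clearing denominators on generators of p gives e outside p with e th p inside p. Then
   e th is almost integral over A, with b as common denominator, so it is in A, which puts e in
   p. *)
have [u pu nu] : exists2 u, p u & ~ maxideal L (u * th).
  apply: NNPP => hno.
  have hm u : p u -> maxideal L (u * th) by move=> pu; apply: NNPP => nu; apply: hno; exists u.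
  have [s [hs E]] := noeth_fg nA hp.
  have [e [Ae ne he]] : exists e, [/\ A e, ~ p e & forall u, u \in s -> p (e * th * u)].
    elim: s hs {E} => [|u s IH] hs; first by exists 1; split=> //; [mem|exact: prime_n1 pP].
    have [|e [Ae ne he]] := IH; first by move=> v vs; apply: hs; rewrite inE vs orbT.
    have := hm u (hs u (mem_head _ _)); rewrite maxideal_loc // => -[c [f [pc Af nf ec]]].
    have f0 := prime_n0 pP nf.
    exists (e * f); split; [mem|exact: (prime_nM pP)|].
    move=> v; rewrite inE => /orP [/eqP ->|vs].
      have -> : e * f * th * u = e * c.
        by have -> : c = u * th * f; [rewrite ec divfK|ring].
      mem.
    have -> : e * f * th * v = f * (e * th * v) by ring.
    by have ? := he v vs; apply: (idlM hp).
  have hall v : p v -> p (e * th * v).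
    rewrite E; suff hK : ideal A (fun v => A v /\ span A s (e * th * v)).
      move=> /(span_min hK) h; apply: (proj2 (h _)) => w ws.
      by split; [apply: (idlS hp); apply: hs|rewrite -E; apply: he].
    have hS : ideal A (span A s) by rewrite -E.
    split.
    - by move=> z [].
    - by rewrite mulr0; split; mem.
    - by move=> z w [? ?] [? ?]; rewrite mulrDr; split; mem.
    - by move=> c z Ac [? ?]; split; [mem|rewrite mulrCA; mem].
  have hk k : p (b * (e * a / b) ^+ k).
    elim: k => [|k IH]; first by rewrite expr0 mulr1.
    have -> : b * (e * a / b) ^+ k.+1 = e * th * (b * (e * a / b) ^+ k).
      by rewrite exprS /th; ring.
    exact: hall.
  have : A (e * a / b).
    apply: (@regular_cic _ A (e * a) b b (rg n)) => //; first by mem.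
    by move=> k; apply: (idlS hp).
  move=> h; apply: ne; split=> //; apply: ST'; apply: AS.
  by move: h; rewrite /th mulrA.
(* Since u th is a unit, 1/th lies in L; it generates the maximal ideal because th carries that
   ideal into L. *)
have Lu := Lpth u pu; have [w0 Lw] := not_max Lu nu.
have u0 : u != 0 by move: w0; rewrite mulf_eq0 negb_or => /andP [].
have eth : th^-1 = u * (u * th)^-1 by field; rewrite u0 th0.
have Au := idlS hp pu; have Lth : L th^-1 by rewrite eth; have ? := AL _ Au; mem.
have dL : DVR L.
  apply: (@dvr_principal _ L th^-1) => //.
  - move=> q; have [c [d [Rc Rd d0 e]]] := fr n q.
    by exists c, d; split=> //; apply: AL.
  - by rewrite invr_neq0.
  - by rewrite invrK.
  - move=> s Ls s0; case: (classic (maxideal L s)) => [|/(not_max Ls) [_ h]]; last by left.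
    rewrite maxideal_loc // => -[c [e [pc Ae ne es]]]; right.
    have Lc := Lpth c pc; have Le := loc_inv rA pP Ae ne.
    by have -> : s / th^-1 = (c * th) * e^-1; [rewrite invrK es; ring|mem].
  - by move=> s Ls h; apply: (noeth_cap nL Lth _ _ h); rewrite ?invr_neq0 ?invrK.
have : L b^-1.
  apply: Tb => //; split=> //; exists x^-1; split=> //.
  by apply: (union_max_inv st Nx x0).
by apply: max_inv => //; rewrite maxideal_loc //; apply: ext_sub.
Qed.

(** * The rank one valuation ring *)

Hypothesis hull_Sx1 : subp T Sx1.
Local Notation NV := (gen_ideal V N).
Local Notation W := (loc V NV).

Lemma boundary_hull q : V q -> T q -> S q.
Proof. by move=> Vq /hull_Sx1 [k]; apply: boundary_cap_inv. Qed.

Let total q : q != 0 -> V q \/ V q^-1. Proof. exact: boundary_total rg fr st q. Qed.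

(** Of two elements of N one divides the other in V, so a single generator suffices. *)
Lemma NVP q : NV q <-> exists n, [/\ N n, n != 0 & V (q / n)].
Proof.
split=> [h|[n [Nn n0 h]]].
  apply: (h (fun q => exists n, [/\ N n, n != 0 & V (q / n)])).
    split.
    - move=> z [n [Nn n0 h']]; have -> : z = (z / n) * n by rewrite divfK.
      by have ? := SV (union_max_sub Nn); mem.
    - by exists x; split; [exact: Nx|exact: x0|rewrite mul0r; mem].
    - move=> u v [n [Nn n0 hu]] [k [Nk k0 hv]].
      have nk0 : n / k != 0 by rewrite mulf_neq0 // invr_neq0.
      have [h'|] := total nk0; [exists k|rewrite invf_div => h'; exists n]; split=> //.
        have -> : (u + v) / k = (u / n) * (n / k) + v / k by field; rewrite n0 k0.
        mem.
      have -> : (u + v) / n = u / n + (v / k) * (k / n) by field; rewrite n0 k0.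
      mem.
    - by move=> a z Va [n [Nn n0 h']]; exists n; split=> //; rewrite -mulrA; mem.
  move=> z Nz; case: (eqVneq z 0) => [->|z0].
    by exists x; split; [exact: Nx|exact: x0|rewrite mul0r; mem].
  by exists z; split=> //; rewrite divff //; mem.
have -> : q = (q / n) * n by rewrite divfK.
move=> I hI sI; have ? := sI _ Nn; mem.
Qed.

Lemma NV_ideal : ideal V NV.
Proof. by apply: ideal_gen => // z /union_max_sub /SV. Qed.
Let hNV := NV_ideal.

Lemma NV_sub : subp N NV. Proof. by move=> z; apply: gen_ideal_sub. Qed.

Lemma NV_n1 : ~ NV 1.
Proof. by move=> /NVP [n [Nn n0]]; rewrite mul1r; apply: (boundary_max rg st). Qed.

(** If n divides z^2 in V and w^2 divides n, then (z / w)^2 is in V, hence so is z / w. *)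
Lemma NV_sq z : V z -> NV (z ^+ 2) -> NV z.
Proof.
move=> Vz; case: (eqVneq z 0) => [->|z0]; first by move=> _; mem.
move=> /NVP [n [Nn n0 h]]; have [w [Nw w0 /SV hw]] := N_square Nn.
apply/NVP; exists w; split=> //.
have zw0 : z / w != 0 by rewrite mulf_neq0 // invr_neq0.
have [//|h'] := total zw0; have -> : z / w = (z ^+ 2 / n) * (n / w ^+ 2) * (z / w)^-1; last by mem.
by field; rewrite z0 n0 w0.
Qed.

(** If b divides a in V, then a^2 is a multiple of a b, and [NV_sq] applies. *)
Lemma NV_prime : prime_ideal V NV.
Proof.
split=> //; first exact: NV_n1.
move=> a b Va Vb hab.
case: (eqVneq a 0) => [->|a0]; first by left; mem.
case: (eqVneq b 0) => [->|b0]; first by right; mem.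
have ab0 : a / b != 0 by rewrite mulf_neq0 // invr_neq0.
have [h|h] := total ab0; [left|right]; apply: NV_sq => //.
  by have -> : a ^+ 2 = (a / b) * (a * b); [field|mem].
by have -> : b ^+ 2 = (a / b)^-1 * (a * b); [field; rewrite a0 b0|mem].
Qed.
Let pNV := NV_prime.

(** A nonzero prime with an element c contains a power of every nonzero n in N, since c / n^k leaves
    V for large k; so no nonzero prime lies strictly inside NV. *)
Lemma NV_height_one : height_one_prime V NV.
Proof.
split=> //.
  exists zeroid; split; first exact: prime_zero.
  split; first by move=> z ->; mem.
  by exists x; split; [apply: NV_sub; exact: Nx|apply/eqP; exact: x0].
move=> [Q1 [Q2 [p1 p2 [_ [c [Q2c nQ1c]]] [_ [z [/NVP [n [Nn n0 hz]] nQ2z]]]]]].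
have h2 := prime_idl p2.
have c0 : c != 0 by apply/eqP => c0; apply: nQ1c; rewrite c0; apply: idl0 (prime_idl p1).
have nQn : ~ Q2 n by move=> h; apply: nQ2z; have -> : z = (z / n) * n; [rewrite divfK|mem].
have [k hk] := not_inf_divisibleF c0 Nn n0; apply: nQn.
have ck0 : c / n ^+ k != 0 by rewrite mulf_neq0 // invr_neq0 // expf_neq0.
have [//|] := total ck0; rewrite invf_div => h.
apply: (primeX rV p2 (n := k)); first exact: SV (union_max_sub Nn).
by have -> : n ^+ k = (n ^+ k / c) * c; [rewrite divfK|mem].
Qed.

Let rW : subring W := loc_subring rV pNV.
Let VW : subp V W := loc_sub rV pNV.

Lemma W_inv q : q != 0 -> ~ W q -> NV q^-1.
Proof.
move=> q0 nW; have [/VW //|Vq] := total q0; apply: NNPP => nN; apply: nW.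
by rewrite -[q]invrK; apply: loc_inv.
Qed.

Lemma W_valuation : valuation_ring W.
Proof.
by split=> // q q0; have [/VW|/VW] := total q0; [left|right].
Qed.

(** NV is also an ideal of W, because in a valuation ring every element outside a prime divides all
    elements of the prime. *)
Lemma W_mul_NV q z : W q -> NV z -> NV (q * z).
Proof.
move=> [a [b [Va Vb nb ->]]] hz; have b0 := prime_n0 pNV nb.
case: (eqVneq z 0) => [->|z0]; first by rewrite mulr0; mem.
have Vz : V (z / b).
  have zb0 : z / b != 0 by rewrite mulf_neq0 // invr_neq0.
  have [//|] := total zb0; rewrite invf_div => h; case: nb.
  by have -> : b = (b / z) * z; [rewrite divfK|mem].
have : NV (b * (z / b)) by rewrite mulrC divfK.
move=> /(prime_or pNV Vb Vz) [//|h].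
by have -> : a / b * z = a * (z / b); [ring|mem].
Qed.

Lemma NV_inv z : NV z -> z != 0 -> ~ W z^-1.
Proof. by move=> hz z0 h; apply: NV_n1; rewrite -(mulVf z0); apply: W_mul_NV. Qed.

Lemma W_arch c z : c != 0 -> NV z -> z != 0 -> exists k, ~ W (c / z ^+ k).
Proof.
move=> c0 hz z0; have [n [Nn n0 hn]] : exists n, [/\ N n, n != 0 & V (z / n)] by apply/NVP.
have [k hk] := not_inf_divisibleF c0 Nn n0; exists k.+1 => h; apply: hk; apply: (idlS hNV).
have -> : c / n ^+ k = (c / z ^+ k.+1) * ((z / n) ^+ k * z).
  by rewrite exprS exprMn exprVn; field; rewrite z0 !expf_neq0.
by apply: W_mul_NV => //; have ? : V ((z / n) ^+ k) by [mem]; mem.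
Qed.

(** By [W_arch] each nonunit of W has a power in every nonzero prime. *)
Lemma W_rank_one : rank_one_valuation_ring W.
Proof.
split; first exact: W_valuation.
split.
  exists (fun k => if k is 0 then zeroid else NV); split=> [[|k] _|[|k] //= _].
  - exact: prime_zero.
  - split.
    + split.
      * by move=> z hz; apply: VW; mem.
      * by mem.
      * by move=> u v hu hv; mem.
      * exact: W_mul_NV.
    + exact: NV_n1.
    + move=> a b Wa Wb hab; apply: NNPP => /not_or_and [na nb]; apply: nb.
      have a0 : a != 0 by apply/eqP => a0; apply: na; rewrite a0; mem.
      have Wa' : W a^-1.
        by apply: NNPP => h; apply: na; rewrite -[a]invrK; apply: W_inv => //; rewrite invr_neq0.
      by rewrite -(mulKf a0 b); apply: W_mul_NV.
  - split; first by move=> z ->; mem.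
    by exists x; split; [apply: NV_sub; exact: Nx|apply/eqP; exact: x0].
move=> [C [pC sC]].
have [_ [c [C1c nC0c]]] := sC 0%N isT; have [_ [z [C2z nC1z]]] := sC 1%N isT.
have p1 := pC 1%N isT; have p2 := pC 2%N isT; have h1 := prime_idl p1; have h2 := prime_idl p2.
have c0 : c != 0 by apply/eqP => c0; apply: nC0c; rewrite c0; apply: idl0 (prime_idl (pC 0%N isT)).
have z0 : z != 0 by apply/eqP => z0; apply: nC1z; rewrite z0; mem.
have nWz : ~ W z^-1 by move=> h; apply: (prime_n1 p2); apply: (idl_unit h2 C2z).
have hz : NV z by rewrite -[z]invrK; apply: W_inv => //; rewrite invr_neq0.
have [k hk] := W_arch c0 hz z0; apply: nC1z.
apply: (primeX rW p1 (n := k)); first exact: idlS h2 C2z.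
have ck0 : c / z ^+ k != 0 by rewrite mulf_neq0 // invr_neq0 // expf_neq0.
have [_ tot] := W_valuation; have [//|] := tot _ ck0; rewrite invf_div => h.
by have -> : z ^+ k = (z ^+ k / c) * c; [rewrite divfK|mem].
Qed.

(** * The complete integral closure *)

Lemma closure_almost th : complete_integral_closure S th ->
  exists d, [/\ S d, d != 0 & forall k, S (d * th ^+ k)].
Proof.
move=> [_ _ _ [d [Sd d0 h]]]; exists d; split=> // k; apply: h.
exists 'X^k; split; last by rewrite hornerXn.
by move=> i; rewrite coefXn; case: (i == k); rewrite ?mulr1n ?mulr0n; mem.
Qed.

Lemma closure_sub_W : subp (complete_integral_closure S) W.
Proof.
move=> th /closure_almost [d [Sd d0 h]]; apply: NNPP => nW.
have t0 : th != 0 by apply/eqP => t0; apply: nW; rewrite t0; mem.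
have [k] := W_arch d0 (W_inv t0 nW) (invr_neq0 t0); apply.
by rewrite exprVn invrK; apply: VW; apply: SV.
Qed.

(** In a DVR no nonzero d is divisible by all powers of a nonunit, so each DVR above S contains the
    closure. *)
Lemma closure_sub_T : subp (complete_integral_closure S) T.
Proof.
move=> th /closure_almost [d [Sd d0 h]] B [[rB vB] nB _] [sB _]; apply: NNPP => nBt.
have t0 : th != 0 by apply/eqP => t0; apply: nBt; rewrite t0; mem.
have [//|Bt] := vB th t0; move/eqP: d0; apply.
apply: (noeth_cap nB Bt (invr_neq0 t0)); first by rewrite invrK.
by move=> n; rewrite exprVn invrK; apply: sB.
Qed.

Lemma W_cap_T_colon : subp (interp W T) (colon N).
Proof.
move=> q [Wq Tq] n Nn; have h := W_mul_NV Wq (NV_sub Nn).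
have Sq : S (q * n).
  apply: boundary_hull; first exact: (idlS hNV).
  by have rT := hull_subring; have ? := hull_sub (union_max_sub Nn); mem.
apply: NNPP => /(union_unit Sq) [q0 /SV h']; apply: NV_n1.
exact: (idl_unit hNV h q0).
Qed.

(** As q maps N into itself, x S[q] stays inside N; x is a common denominator. *)
Lemma colon_closure : subp (colon N) (complete_integral_closure S).
Proof.
move=> q hq; split.
- by exists 0; split; [move=> i; rewrite coef0; mem|rewrite horner0].
- move=> _ _ [p [hp ->]] [r [hr ->]]; exists (p + r); split; last by rewrite hornerD.
  by move=> i; rewrite coefD; have ? := hp i; have ? := hr i; mem.
- move=> s _ Ss [p [hp ->]]; exists (s *: p); split; last by rewrite hornerZ.
  by move=> i; rewrite coefZ; have ? := hp i; mem.
exists x; split=> //; first exact: x0.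
move=> _ [p [hp ->]]; rewrite horner_coef mulr_sumr; apply: union_max_sub.
apply: (idl_sum _ hN) => i _; rewrite mulrCA; apply: (idlM hN) => //.
elim: (nat_of_ord i) => [|k IH]; first by rewrite expr0 mulr1; exact: Nx.
by rewrite exprS mulrCA; apply: hq.
Qed.

Lemma closure_colon : complete_integral_closure S = colon N.
Proof.
apply: subp_anti; last exact: colon_closure.
by move=> q h; apply: W_cap_T_colon; split; [apply: closure_sub_W|apply: closure_sub_T].
Qed.

Lemma closure_W_cap_T : complete_integral_closure S = interp W T.
Proof.
apply: subp_anti => q h; last by apply: colon_closure; apply: W_cap_T_colon.
by split; [apply: closure_sub_W|apply: closure_sub_T].
Qed.

Lemma valuation_local (U : F -> Prop) : valuation_ring U -> local U.
Proof.
move=> [rU vU]; split=> //; split; last exact: maxideal_n1.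
have hM a u : U a -> maxideal U u -> maxideal U (a * u).
  move=> Ua [Uu hu]; split; first by mem.
  case: (eqVneq (a * u) 0) => [|au0]; [by left|right=> h].
  move: (au0); rewrite mulf_eq0 negb_or => /andP [a0 u0].
  case: hu => [e|]; first by rewrite e eqxx in u0.
  by apply; have -> : u^-1 = a * (a * u)^-1; [field; rewrite a0 u0|mem].
have hD u v : u != 0 -> maxideal U v -> maxideal U u -> U (u / v) -> v != 0 -> maxideal U (u + v).
  move=> u0 mv mu h v0; have -> : u + v = (u / v + 1) * v by field.
  by apply: hM => //; mem.
split=> //.
- by move=> u [].
- by split; [mem|left].
- move=> u v mu mv.
  case: (eqVneq u 0) => [->|u0]; first by rewrite add0r.
  case: (eqVneq v 0) => [->|v0]; first by rewrite addr0.
  have uv0 : u / v != 0 by rewrite mulf_neq0 // invr_neq0.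
  have [h|] := vU _ uv0; first exact: hD.
  by rewrite invf_div => h; rewrite addrC; apply: hD.
Qed.

(** The elements divisible by all powers of z form a prime ideal without z; if it were nonzero, it
    would sit strictly between 0 and the maximal ideal. *)
Lemma rank_one_arch (U : F -> Prop) c z : rank_one_valuation_ring U -> c != 0 -> U z -> z != 0 ->
  ~ U z^-1 -> exists k, ~ U (c / z ^+ k).
Proof.
move=> [vU [_ nch]] c0 Uz z0 nz; apply: NNPP => /not_ex_all_not hno.
have hc k : U (c / z ^+ k) by apply: NNPP; apply: hno.
have [rU tot] := vU; have lU := valuation_local vU.
pose P : F -> Prop := fun u => forall k, U (u / z ^+ k).
have hP : ideal U P.
  split.
  - by move=> u /(_ 0%N); rewrite expr0 divr1.
  - by move=> k; rewrite mul0r; mem.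
  - by move=> u v hu hv k; rewrite mulrDl; have ? := hu k; have ? := hv k; mem.
  - by move=> a u Ua hu k; rewrite -mulrA; have ? := hu k; mem.
have P1 : ~ P 1 by move=> /(_ 1%N); rewrite expr1 mul1r.
have zk k := expf_neq0 k z0.
apply: nch; exists (fun k => match k with 0 => zeroid | 1 => P | _ => maxideal U end).
split=> [[|[|k]] _|[|[|k]] //= _].
- exact: prime_zero.
- split=> // a b Ua Ub hab; apply: NNPP => /not_or_and [/not_all_ex_not [k ha] /not_all_ex_not [l hb]].
  have a0 : a != 0 by apply/eqP => e; apply: ha; rewrite e mul0r; mem.
  have b0 : b != 0 by apply/eqP => e; apply: hb; rewrite e mul0r; mem.
  have ak0 : a / z ^+ k != 0 by rewrite mulf_neq0 // invr_neq0.
  have bl0 : b / z ^+ l != 0 by rewrite mulf_neq0 // invr_neq0.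
  have [//|h1] := tot _ ak0; have [//|h2] := tot _ bl0; apply: nz.
  have h3 := hab (k + l).+1.
  have -> : z^-1 = (a / z ^+ k)^-1 * (b / z ^+ l)^-1 * (a * b / z ^+ (k + l).+1); last by mem.
  by rewrite exprS exprD; field; rewrite z0 a0 b0 !zk.
- exact: max_prime.
- split; first by move=> u ->; mem.
  by exists c; split=> //; apply/eqP.
- split.
    move=> u hu; split; first exact: (idlS hP).
    by case: (eqVneq u 0) => [|u0]; [left|right=> h; apply: P1; apply: (idl_unit hP hu)].
  exists z; split; first by split=> //; right.
  by move=> /(_ 2%N); rewrite (_ : z / z ^+ 2 = z^-1) //; field.
Qed.

(* A rank one valuation is determined on [S] by the elements [a^j / x^k] of [T] in its ring. *)
Lemma valuation_compare (U U' : F -> Prop) : valuation_ring U -> subp S U ->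
  rank_one_valuation_ring U' -> subp S U' -> ~ U' x^-1 ->
  (forall q, T q -> U q <-> U' q) -> subp U U'.
Proof.
move=> [rU _] SU rk SU' nx' hT q Uq; have [[rU' tot'] _] := rk; apply: NNPP => nq.
have q0 : q != 0 by apply/eqP => e; apply: nq; rewrite e; mem.
have [//|Uq'] := tot' q q0.
have [a [b [Sa Sb b0 e]]] := union_frac q.
have a0 : a != 0 by apply: contra q0; rewrite e => /eqP ->; rewrite mul0r.
(* As 1/q is a nonunit of U', some power q^-j is divisible by x there. *)
have [j hj] : exists j, ~ U' (x / q^-1 ^+ j).
  by apply: rank_one_arch => //; rewrite ?invr_neq0 ?invrK //; exact: x0.
have xj0 : x / q^-1 ^+ j != 0 by rewrite mulf_neq0 ?x0 // invr_neq0 // expf_neq0 // invr_neq0.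
have [//|] := tot' _ xj0; rewrite invf_div => hz.
have aj0 : a ^+ j != 0 by exact: expf_neq0.
have [k hk] := rank_one_arch rk aj0 (SU' _ Sx) x0 nx'.
(* At this l, b^j / x^(l+1) is the product of a^j / x^l and q^-j / x, so it is in U' and, being in
   T, in U. Multiplication by q^j puts a^j / x^(l+1) in U, hence in U', a contradiction. *)
have [l [h1 h2]] : exists l, U' (a ^+ j / x ^+ l) /\ ~ U' (a ^+ j / x ^+ l.+1).
  elim: k hk => [|k IH] hk; first by case: hk; rewrite expr0 divr1; apply: SU'; mem.
  by case: (classic (U' (a ^+ j / x ^+ k))) => h; [exists k|apply: IH].
have rT := hull_subring; have Tx := hull_inv_x.
have Ts s k' : S s -> T (s / x ^+ k') by move=> /hull_sub ?; rewrite -exprVn; mem.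
apply: h2; apply/hT; first by apply: Ts; mem.
have -> : a ^+ j / x ^+ l.+1 = q ^+ j * (b ^+ j / x ^+ l.+1).
  by rewrite e exprMn exprVn; field; rewrite ?x0 ?expf_neq0 ?x0.
apply: (subM rU); first by mem.
apply/hT; first by apply: Ts; mem.
have -> : b ^+ j / x ^+ l.+1 = (a ^+ j / x ^+ l) * (q^-1 ^+ j / x).
  by rewrite e invf_div exprMn exprVn exprS; field; rewrite ?x0 ?expf_neq0 ?x0.
mem.
Qed.

(** U and W have the same trace on T. As 1/x lies in T but not in W, x is a nonunit of both, so
    [valuation_compare] works in both directions. *)
Lemma W_unique U : rank_one_valuation_ring U -> subp S U ->
  complete_integral_closure S = interp U T -> U = W.
Proof.
move=> rk SU E; have E' := closure_W_cap_T; have SW : subp S W by move=> s /SV /VW.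
have nWx : ~ W x^-1 by apply: NV_inv; [apply: NV_sub; exact: Nx|exact: x0].
have hT q : T q -> U q <-> W q.
  move=> Tq; split=> h.
    by have [] : interp W T q by rewrite -E' E.
  by have [] : interp U T q by rewrite -E E'.
have nUx : ~ U x^-1 by move=> /(hT _ hull_inv_x).
have [vU _] := rk; have [vW _] := W_rank_one.
apply: subp_anti; first exact: (valuation_compare vU SU W_rank_one SW nWx hT).
by apply: (valuation_compare vW SW rk SU nUx) => q Tq; apply: iff_sym; apply: hT.
Qed.

End Archimedean.

Theorem theorem6p2 (F : fieldType) (R : F -> Prop) (Rs : nat -> F -> Prop) (x : F) :
  regular_local R -> frac_field R -> same_set (Rs 0%N) R ->
  (forall i, local_quadratic_transform (Rs i) (Rs i.+1)) ->
  (forall i, ssubp (Rs i) (Rs i.+1)) ->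
  (forall i, regular_local (Rs i) /\ exists d, krull_dim (Rs i) d /\ (2 <= d)%N) ->
  union_seq Rs x ->
  same_set (radical (union_seq Rs) (principal (union_seq Rs) x)) (union_max Rs) ->
  (exists M, mult_set R M /\ same_set (noetherian_hull (union_seq Rs)) (loc_mult R M)) ->
  archimedean (union_seq Rs) ->
  ~ DVR (union_seq Rs) ->
  let S := union_seq Rs in
  let N := union_max Rs in
  let T := noetherian_hull S in
  let Sstar := complete_integral_closure S in
  let V := boundary_valuation_ring Rs in
  let NV := gen_ideal V N in
  let W := loc V NV in
  [/\ height_one_prime V NV,
      same_set Sstar (colon N) /\ same_set Sstar (interp W T),
      rank_one_valuation_ring W /\ subp S W &
      forall W', rank_one_valuation_ring W' -> subp S W' ->
        same_set Sstar (interp W' T) -> same_set W' W].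
Proof.
move=> _ frR e0 lqt _ rgd Sx rad [M [[sMR _ nM0 _] eT]] arch ndvr.
have rg i : regular_local (Rs i) by case: (rgd i).
have hy i : exists y, qstep (Rs i) (Rs i.+1) y by apply: lqt_qstep.
pose y i := proj1_sig (constructive_indefinite_description _ (hy i)).
have st i : qstep (Rs i) (Rs i.+1) (y i).
  by rewrite /y; case: constructive_indefinite_description.
have R_sub : subp R (union_seq Rs) by move=> a /e0 Ra; exists 0%N.
have fr i : frac_field (Rs i).
  move=> q; have [a [b [/e0 Ra /e0 Rb b0 e]]] := frR q.
  by exists a, b; split=> //; apply: (Rs_le st (leq0n i)).
(* T is a localization of R, so each element is a/b with a in R and 1/b in T, and [hull_unit]
   handles 1/b. *)
have hull : subp (noetherian_hull (union_seq Rs)) (Sx1 Rs x).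
  have rT : subring (Sx1 Rs x) by exact: (Sx1_subring rg st Sx).
  move=> q /eT [a [b [Ra Mb ->]]]; have Rb := sMR b Mb.
  have b0 : b != 0 by apply/eqP => b0; apply: nM0; rewrite -b0.
  apply: (subM rT); first by apply: Sx1_sub; apply: R_sub.
  apply: (hull_unit rg fr st Sx rad) => //; first exact: R_sub.
  apply/eT; exists 1, b; rewrite mul1r; split=> //; apply/e0.
  by have [lA _ _] := rg 0%N; have rA := local_sub lA; mem.
move=> S N T Sstar V NV W; split.
- exact: (NV_height_one rg fr st Sx rad arch ndvr).
- split=> q.
    by rewrite /Sstar (closure_colon rg fr st Sx rad arch ndvr hull).
  by rewrite /Sstar (closure_W_cap_T rg fr st Sx rad arch ndvr hull).
- split; first exact: (W_rank_one rg fr st Sx rad arch ndvr).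
  move=> s /(boundary_sub rg st); apply: loc_sub; first exact: boundary_subring.
  exact: (NV_prime rg fr st Sx rad arch ndvr).
- move=> U rk SU /same_setE E.
  by rewrite (W_unique rg fr st Sx rad arch ndvr hull rk SU E).
Qed.
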